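(* Let $n,p\ge1$, let $A$ be a real symmetric positive definite $n\times n$ matrix with eigenvalues $w_1^2,\dots,w_n^2$ and $B$ a real symmetric positive definite $p\times p$ matrix with eigenvalues $\mu_1^2,\dots,\mu_p^2$ (counted with multiplicity), where $w_i>0$ and $\mu_i>0$. Let $h_0>0$, $h\in(0,h_0]$, and consider $$H(h)=-h^2\Delta_x-\Delta_y+\langle Ax,x\rangle_{\mathbb{R}^n_x}+\langle By,y\rangle_{\mathbb{R}^p_y}\quad\text{on }L^2(\mathbb{R}^n_x\times\mathbb{R}^p_y).$$ Then $$\sigma(H(h))=\sigma_{disc}(H(h))=\left\{\sum_{i=1}^n(2n_i+1)h w_i+\sum_{i=1}^p(2m_i+1)\mu_i\;:\;n_i,m_i\in\{0,1,2,\dots\}\right\}.$$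
   Context: $H(h)$ denotes the self-adjoint operator obtained as the closure of the given differential expression on $C_0^\infty(\mathbb{R}^n_x\times\mathbb{R}^p_y)$ (essentially self-adjoint there). The discrete spectrum $\sigma_{disc}(T)$ of an operator $T$ is the set of eigenvalues of $T$ of finite multiplicity that are isolated points of the spectrum $\sigma(T)$. *)

(* Defs.v *)
From HB Require Import structures.
From mathcomp Require Import all_boot all_order all_algebra.
From mathcomp Require Import complex.
From mathcomp Require Import all_classical all_reals all_analysis.
From mathcomp Require Import measurable_realfun.

Set Implicit Arguments.
Unset Strict Implicit.
Unset Printing Implicit Defensive.

Import Order.TTheory GRing.Theory Num.Theory.
Import numFieldNormedType.Exports.

Local Open Scope classical_set_scope.
Local Open Scope ring_scope.
Local Open Scope complex_scope.

(* Matrices carry the sigma-algebra generated by their entries. *)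
Definition measure_matrix_display : measure_display -> measure_display.
Proof. exact. Qed.

Section measurable_matrix.
Context d (T : measurableType d) (m n : nat).

Definition matrix_measurable : set (set 'M[T]_(m, n)) :=
  <<s \bigcup_(ij in [set: 'I_m * 'I_n])
        preimage_set_system setT (fun M : 'M[T]_(m, n) => M ij.1 ij.2)
                            measurable >>.

Let matrix_set0 : matrix_measurable set0.
Proof. exact: sigma_algebra0. Qed.

Let matrix_setC A : matrix_measurable A -> matrix_measurable (~` A).
Proof. exact: sigma_algebraC. Qed.

Let matrix_bigcup (F : _^nat) :
  (forall i, matrix_measurable (F i)) -> matrix_measurable (\bigcup_i F i).
Proof. exact: sigma_algebra_bigcup. Qed.

HB.instance Definition _ := @isMeasurable.Build (measure_matrix_display d)
  'M[T]_(m, n) matrix_measurable matrix_set0 matrix_setC matrix_bigcup.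

Lemma measurable_fun_entry (i : 'I_m) (j : 'I_n) :
  measurable_fun setT (fun M : 'M[T]_(m, n) => M i j).
Proof.
move=> _ Y mY; rewrite setTI; apply: sub_sigma_algebra.
by exists (i, j) => //; exists Y => //; rewrite setTI.
Qed.

Lemma measurable_fun_matrix d' (S : measurableType d') (f : S -> 'M[T]_(m, n)) :
  (forall i j, measurable_fun setT (fun s => f s i j)) -> measurable_fun setT f.
Proof.
move=> mf.
apply: (measurability (\bigcup_(ij in [set: 'I_m * 'I_n])
  preimage_set_system setT (fun M : 'M[T]_(m, n) => M ij.1 ij.2) measurable))
  => // _ [_ [[i j] _ [B mB <-]] <-].
by rewrite setTI; exact: mf.
Qed.

End measurable_matrix.

(* Lebesgue measure on R^n, R^n being the space of column vectors: the point
   mass at the unique vector for n = 0, then the image of the product measure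
   on R x R^n under (t, v) |-> col_mx t v. *)
Section lebesgue_colvec.
Context {R : realType}.

Definition colvec_cons n (z : R * 'cV[R]_n) : 'cV[R]_n.+1 :=
  col_mx (const_mx z.1 : 'cV[R]_1) z.2.

Definition colvec_uncons n (v : 'cV[R]_n.+1) : R * 'cV[R]_n :=
  (v ord0 0, \col_i v (lift ord0 i) 0).

Lemma colvec_cons0 n (z : R * 'cV[R]_n) j : colvec_cons z ord0 j = z.1.
Proof.
have -> : ord0 = lshift n (ord0 : 'I_1) by exact: val_inj.
by rewrite [LHS]col_mxEu mxE.
Qed.

Lemma colvec_consS n (z : R * 'cV[R]_n) i j :
  colvec_cons z (lift ord0 i) j = z.2 i j.
Proof.
have -> : lift ord0 i = rshift 1 i by exact: val_inj.
by rewrite [LHS]col_mxEd.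
Qed.

Lemma colvec_consK n : cancel (@colvec_cons n) (@colvec_uncons n).
Proof.
move=> z; rewrite /colvec_uncons colvec_cons0 [RHS]surjective_pairing.
by congr pair; apply/colP => i; rewrite mxE colvec_consS.
Qed.

Lemma measurable_colvec_cons n : measurable_fun setT (@colvec_cons n).
Proof.
apply: measurable_fun_matrix => i j; case: (unliftP ord0 i) => [k ->|->].
  under eq_fun do rewrite colvec_consS.
  exact: (measurableT_comp (measurable_fun_entry k j)).
under eq_fun do rewrite colvec_cons0.
exact: measurable_fst.
Qed.

Lemma measurable_colvec_uncons n : measurable_fun setT (@colvec_uncons n).
Proof.
apply/measurable_fun_pairP; split; first exact: measurable_fun_entry.
apply: measurable_fun_matrix => i j; rewrite /comp/=.
under eq_fun do rewrite mxE.
exact: measurable_fun_entry.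
Qed.

Section step.
Variables (n : nat) (m : {sigma_finite_measure set 'cV[R]_n -> \bar R}).

Definition lebesgue_colvec_step : set 'cV[R]_n.+1 -> \bar R :=
  pushforward (@lebesgue_measure R \x m)%E (@colvec_cons n).

Let step0 : lebesgue_colvec_step set0 = 0%E.
Proof. by rewrite /lebesgue_colvec_step /pushforward preimage_set0 measure0. Qed.

Let step_ge0 A : (0 <= lebesgue_colvec_step A)%E.
Proof. exact: (measure_ge0 (@lebesgue_measure R \x m)%E). Qed.

Let step_sigma_additive : semi_sigma_additive lebesgue_colvec_step.
Proof.
exact: (@measure_semi_sigma_additive _ _ _
  (measure_function_pushforward__canonical__measure_function_Measure
     (@lebesgue_measure R \x m)%E (@measurable_colvec_cons n))).
Qed.

HB.instance Definition _ := isMeasure.Build _ _ _ lebesgue_colvec_step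
  step0 step_ge0 step_sigma_additive.

Let step_sigma_finite : sigma_finite setT lebesgue_colvec_step.
Proof.
have /sigma_finiteP[F [TF ndF Foo]] := sigma_finiteT (@lebesgue_measure R).
have /sigma_finiteP[G [TG ndG Goo]] := sigma_finiteT m.
exists (fun k => @colvec_uncons n @^-1` (F k `*` G k)).
  rewrite -preimage_bigcup (_ : \bigcup_k _ = setT) ?preimage_setT//.
  rewrite -subTset => -[x y] _; have : setT x /\ setT y by [].
  rewrite {1}TF TG => -[[i _ Fix] [k _ Gky]]; exists (maxn i k) => //; split.
    by move: x Fix; exact/subsetPset/ndF/leq_maxl.
  by move: y Gky; exact/subsetPset/ndG/leq_maxr.
move=> k; have [mF ?] := Foo k; have [mG ?] := Goo k; split.
  rewrite -[X in measurable X]setTI; apply: measurable_colvec_uncons => //.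
  exact: measurableX.
rewrite /lebesgue_colvec_step /pushforward -comp_preimage.
rewrite (_ : _ \o _ = id) ?preimage_id; last exact/funext/colvec_consK.
by rewrite product_measure1E// lte_mul_pinfty// ge0_fin_numE.
Qed.

HB.instance Definition _ := Measure_isSigmaFinite.Build _ _ _
  lebesgue_colvec_step step_sigma_finite.

End step.

Fixpoint lebesgue_colvec n : {sigma_finite_measure set 'cV[R]_n -> \bar R} :=
  match n with
  | 0 => dirac (0 : 'cV[R]_0)
  | n'.+1 => lebesgue_colvec_step (lebesgue_colvec n')
  end.

End lebesgue_colvec.
Arguments lebesgue_colvec : clear implicits.

(* The complex Hilbert space L^2(mu): measurable functions to R[i] whose real
   and imaginary parts are in L^2, modulo almost everywhere equality. *)
Section L2.
Context d (T : measurableType d) (R : realType).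
Variable mu : {measure set T -> \bar R}.

Definition L2pred : {pred T -> R[i]} :=
  [pred f : T -> R[i] | ((fun x => complex.Re (f x)) \in Lfun mu 2%:E)
                     && ((fun x => complex.Im (f x)) \in Lfun mu 2%:E)].

Let le12 : (1 <= 2%:E :> \bar R)%E := lee1n 2.

Let mN (h : T -> R) : measurable_fun setT h ->
  measurable_fun setT ((fun x => `|(EFin \o h) x| `^ 2)%E : T -> \bar R).
Proof.
move=> mh; apply: (measurableT_comp (measurable_poweR 2)).
by apply: measurableT_comp => //; exact/measurable_EFinP.
Qed.

Lemma Lnorm2_le (f g : T -> R) :
  measurable_fun setT f -> measurable_fun setT g ->
  (forall x, `|f x| <= `|g x|) ->
  ('N[mu]_2%:E[EFin \o f] <= 'N[mu]_2%:E[EFin \o g])%E.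
Proof.
move=> mf mg fg; rewrite unlock /Lnorm gt0_ler_poweR ?invr_ge0//.
- by rewrite in_itv/= leey integral_ge0// => x _; exact: poweR_ge0.
- by rewrite in_itv/= leey integral_ge0// => x _; exact: poweR_ge0.
apply: ge0_le_integral => //; try exact: mN.
  by move=> x _; exact: poweR_ge0.
by move=> x _ /=; rewrite lee_fin; apply: ge0_ler_powR; rewrite ?nnegrE.
Qed.

Lemma Lfun2P (f : T -> R) : f \in Lfun mu 2%:E ->
  measurable_fun setT f /\ ('N[mu]_2%:E[EFin \o f] < +oo)%E.
Proof. by case/andP; rewrite !inE. Qed.

Lemma Lfun2_dom (f g : T -> R) : measurable_fun setT f ->
  g \in Lfun mu 2%:E -> (forall x, `|f x| <= `|g x|) -> f \in Lfun mu 2%:E.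
Proof.
move=> mf /Lfun2P[mg fing] fg; apply/andP; rewrite !inE; split => //=.
exact: le_lt_trans (Lnorm2_le mf mg fg) fing.
Qed.

Fact L2pred_submod_closed : submod_closed L2pred.
Proof.
split.
  by rewrite inE; apply/andP; split; exact: (rpred0 (Lfun mu 2%:E)).
move=> a f g /andP[rf imf] /andP[rg img]; apply/andP; split.
  have -> : (fun x => complex.Re ((a *: f + g) x)) =
    complex.Re a *: (fun x => complex.Re (f x))
     - complex.Im a *: (fun x => complex.Im (f x)) + (fun x => complex.Re (g x)).
    apply/funext => x; rewrite !fctE /=.
    by case: a (f x) (g x) => [a b] [c e] [k l].
  apply: rpredD => //; apply: rpredB; exact: rpredZ.
have -> : (fun x => complex.Im ((a *: f + g) x)) =
    complex.Re a *: (fun x => complex.Im (f x))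
     + complex.Im a *: (fun x => complex.Re (f x)) + (fun x => complex.Im (g x)).
  apply/funext => x; rewrite !fctE /=.
  by case: a (f x) (g x) => [a b] [c e] [k l].
apply: rpredD => //; apply: rpredD; exact: rpredZ.
Qed.


HB.instance Definition _ :=
  GRing.isSubmodClosed.Build R[i] (T -> R[i]) L2pred L2pred_submod_closed.

Record L2fun := MkL2fun { L2fun_val :> T -> R[i]; _ : L2fun_val \in L2pred }.

HB.instance Definition _ := [isSub for L2fun_val].
HB.instance Definition _ := [Choice of L2fun by <:].
HB.instance Definition _ := [SubChoice_isSubLmodule of L2fun by <:].

Definition L2null : {pred L2fun} :=
  [pred f : L2fun | `[< {ae mu, forall x, f x = 0} >]].

Fact L2null_submod_closed : submod_closed L2null.
Proof.
split; first by apply/asboolP; exact: nearW.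
move=> a f g /asboolP f0 /asboolP g0; apply/asboolP.
by move: f0 g0; apply: filterS2 => x /= f0 g0; rewrite !fctE f0 g0 scaler0 addr0.
Qed.

HB.instance Definition _ :=
  GRing.isSubmodClosed.Build R[i] L2fun L2null L2null_submod_closed.

Definition L2 : Type := Quotient.quot L2null.

HB.instance Definition _ := GRing.Zmodule.on L2.

Definition L2class (f : L2fun) : L2 := (\pi_(Quotient.quot L2null) f)%qT.
Definition L2repr (u : L2) : L2fun := repr (u : Quotient.quot L2null).

Lemma L2reprK : cancel L2repr L2class.
Proof. exact: reprK. Qed.

Lemma L2classP (f g : L2fun) :
  L2class f = L2class g <-> {ae mu, forall x, f x = g x}.
Proof.
transitivity ((f - g) \in L2null).
  by rewrite Quotient.idealrBE; split=> [/eqP|/eqP].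
split=> [/asboolP|] fg; last apply/asboolP; apply: filterS fg => x /=.
  by rewrite !fctE => /subr0_eq.
by rewrite !fctE => ->; rewrite subrr.
Qed.

Lemma L2classD : {morph L2class : f g / f + g}.
Proof. exact: (raddfD (\pi_(Quotient.quot L2null))%qT). Qed.

Definition L2scale (a : R[i]) (u : L2) : L2 := L2class (a *: L2repr u).

Lemma L2scale_class a f : L2scale a (L2class f) = L2class (a *: f).
Proof.
apply/L2classP; have /L2classP := L2reprK (L2class f).
by apply: filterS => x /= fx; rewrite !fctE fx.
Qed.

Fact L2scaleA a b u : L2scale a (L2scale b u) = L2scale (a * b) u.
Proof. by rewrite -[u]L2reprK !L2scale_class scalerA. Qed.

Fact L2scale1 : left_id 1 L2scale.
Proof. by move=> u; rewrite -[u]L2reprK L2scale_class scale1r. Qed.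

Fact L2scaleDr : right_distributive L2scale +%R.
Proof.
move=> a u v; rewrite -[u]L2reprK -[v]L2reprK -L2classD !L2scale_class.
by rewrite -L2classD scalerDr.
Qed.

Fact L2scaleDl u : {morph L2scale^~ u : a b / a + b}.
Proof.
by move=> a b; rewrite -[u]L2reprK !L2scale_class -L2classD scalerDl.
Qed.

HB.instance Definition _ := GRing.Zmodule_isLmodule.Build R[i] L2
  L2scaleA L2scale1 L2scaleDr L2scaleDl.

Definition normc_fun (f : T -> R[i]) : T -> R := fun x => Normc.normc (f x).

Lemma normc_fun_Lfun (f : L2fun) : normc_fun f \in Lfun mu 2%:E.
Proof.
case: f => f /= /andP[rf imf].
have [[mr _] [mi _]] := (Lfun2P rf, Lfun2P imf).
have Nf : (fun x => `|complex.Re (f x)| + `|complex.Im (f x)|) \in Lfun mu 2%:E.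
  rewrite -/((Num.norm \o (fun x => complex.Re (f x)))
              + (Num.norm \o (fun x => complex.Im (f x)))) rpredD//.
    by apply: (Lfun2_dom _ rf) => [|x/=]; [exact: measurableT_comp|rewrite normr_id].
  by apply: (Lfun2_dom _ imf) => [|x/=]; [exact: measurableT_comp|rewrite normr_id].
apply: (Lfun2_dom _ Nf) => [|x].
  rewrite /normc_fun (_ : (fun x => _) = (fun x => @Num.sqrt R
      (complex.Re (f x) ^+ 2 + complex.Im (f x) ^+ 2))); last first.
    by apply/funext => x; case: (f x).
  apply: measurableT_comp; last first.
    by apply: measurable_funD; exact: measurable_funX.
  by apply: continuous_measurable_fun; exact: sqrt_continuous.
rewrite /normc_fun; case: (f x) => a b /=.
rewrite (ger0_norm (sqrtr_ge0 _)) (ger0_norm (addr_ge0 _ _))//.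
rewrite -(@ler_pXn2r _ 2)// ?nnegrE ?addr_ge0 ?sqrtr_ge0//.
rewrite sqr_sqrtr ?addr_ge0 ?sqr_ge0// sqrrD !real_normK ?num_real//.
by rewrite addrAC lerDl mulrn_wge0// mulr_ge0.
Qed.

Definition L2norm (u : L2) : R[i] :=
  (fine 'N[mu]_2%:E[EFin \o normc_fun (L2repr u)])%:C.

Let nm (f : T -> R) : R := fine 'N[mu]_2%:E[EFin \o f].

Let nmE f : f \in Lfun mu 2%:E -> (nm f)%:E = 'N[mu]_2%:E[EFin \o f]%E.
Proof. by move=> /Lfun2P[_ fy]; rewrite fineK// ge0_fin_numE// Lnorm_ge0. Qed.

Let nm_le f g : f \in Lfun mu 2%:E -> g \in Lfun mu 2%:E ->
  (forall x, `|f x| <= `|g x|) -> nm f <= nm g.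
Proof.
move=> Lf Lg fg; rewrite -lee_fin !nmE//.
by apply: Lnorm2_le => //; [case: (Lfun2P Lf)|case: (Lfun2P Lg)].
Qed.

Let ae_nm f g : f \in Lfun mu 2%:E -> g \in Lfun mu 2%:E ->
  {ae mu, forall x, f x = g x} -> nm f = nm g.
Proof.
move=> /Lfun2P[mf _] /Lfun2P[mg _] fg; rewrite /nm unlock /Lnorm.
congr (fine (_ `^ _)%E).
apply: ae_eq_integral => //; try exact: mN.
by apply: filterS fg => x /= -> .
Qed.

Lemma L2norm_class f : L2norm (L2class f) = (nm (normc_fun f))%:C.
Proof.
congr (_%:C); apply: ae_nm; try exact: normc_fun_Lfun.
have /L2classP := L2reprK (L2class f).
by apply: filterS => x; rewrite /normc_fun => ->.
Qed.

Fact L2normD u v : L2norm (u + v) <= L2norm u + L2norm v.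
Proof.
rewrite -[u]L2reprK -[v]L2reprK -L2classD !L2norm_class -rmorphD/= lecR.
set f := L2repr u; set g := L2repr v.
have [Lf Lg] := (normc_fun_Lfun f, normc_fun_Lfun g).
have Lfg : normc_fun f + normc_fun g \in Lfun mu 2%:E by rewrite rpredD.
apply: (@le_trans _ _ (nm (normc_fun f + normc_fun g))).
  apply: nm_le => [||x]; [exact: (normc_fun_Lfun (f + g))|exact: Lfg|].
  have n0 (z : R[i]) : 0 <= Normc.normc z by case: z => a b; exact: sqrtr_ge0.
  by rewrite /normc_fun !fctE !ger0_norm ?addr_ge0// le_normcD.
have [[mf _] [mg _]] := (Lfun2P Lf, Lfun2P Lg).
by rewrite -lee_fin EFinD !nmE//; exact: eminkowski.
Qed.

Fact L2normZ a u : L2norm (a *: u) = `|a| * L2norm u.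
Proof.
rewrite -[u]L2reprK [_ *: _]L2scale_class !L2norm_class.
set f := L2repr u; have Lf := normc_fun_Lfun f.
have -> : `|a| = (Normc.normc a)%:C by [].
rewrite -rmorphM/=; congr (_%:C).
have -> : normc_fun (a *: f) = Normc.normc a \*: normc_fun f.
  by apply/funext => x; rewrite /normc_fun /= [LHS]Normc.normcM.
have LfE : Lfun_Sub le12 Lf = normc_fun f :> (T -> R) by [].
apply: EFin_inj; rewrite EFinM nmE; last first.
  by rewrite -[_ \*: _]/(Normc.normc a *: normc_fun f) rpredZ.
rewrite -LfE LnormZ LfE nmE// ger0_norm//.
by case: a {LfE} => b c; exact: sqrtr_ge0.
Qed.

Fact L2norm_eq0 u : L2norm u = 0 -> u = 0.
Proof.
rewrite -[u]L2reprK L2norm_class; set f := L2repr u => -[f0].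
have Lf := normc_fun_Lfun f.
have := @fine_Lnormr_eq0 _ _ _ mu _ le12 (Lfun_Sub le12 Lf) f0.
rewrite -(_ : L2class 0 = 0); last first.
  by rewrite /L2class; exact: (raddf0 (\pi_(Quotient.quot L2null))%qT).
move=> fae; apply/L2classP; apply: filterS fae => x /(_ I) /= nf.
exact: Normc.eq0_normc.
Qed.

HB.instance Definition _ := Lmodule_isNormed.Build R[i] L2
  L2normD L2normZ L2norm_eq0.
End L2.

(* An unbounded operator is given by its graph. *)
Section spectrum.
Context {K : numFieldType} {V : normedModType K}.
Implicit Type H : set (V * V).

(* z is in the resolvent set when H - z has a bounded two-sided inverse S. *)
Definition resolvent_set H : set K :=
  [set z | exists S : {linear V -> V},
    [/\ continuous S,
        forall v, H (S v, v + z *: S v) &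
        forall u v, H (u, v) -> S (v - z *: u) = u]].

Definition spectrum H : set K := ~` resolvent_set H.

Definition eigenspace_of H (z : K) : set V := [set u | H (u, z *: u)].

Definition is_eigenvalue H (z : K) := exists2 u, eigenspace_of H z u & u != 0.

Definition finite_multiplicity H (z : K) :=
  exists k (b : 'I_k -> V), forall u, eigenspace_of H z u ->
    exists c : 'I_k -> K, u = \sum_i c i *: b i.

Definition discrete_spectrum H : set K :=
  [set z | [/\ is_eigenvalue H z, finite_multiplicity H z
             & isolated (spectrum H) z]].

End spectrum.

Section test_functions.
Context {R : realType} {V : normedModType R}.

Definition iter_derive (s : seq V) (f : V -> R) : V -> R :=
  foldr (fun v g => 'D_v g) f s.

(* Derivatives of all orders, along arbitrary vectors, exist and are continuous;
   in finite dimension this is C^oo. *)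
Definition smooth (f : V -> R) :=
  forall s : seq V, continuous (iter_derive s f) /\
    forall x v, derivable (iter_derive s f) x v.

Definition test_function (f : V -> R[i]) :=
  [/\ smooth (fun x => complex.Re (f x)), smooth (fun x => complex.Im (f x))
    & compact (closure [set x | f x != 0])].

Definition cderive (v : V) (f : V -> R[i]) : V -> R[i] := fun x =>
  'D_v (fun y => complex.Re (f y)) x +i* 'D_v (fun y => complex.Im (f y)) x.

Definition laplacian k (b : 'I_k -> V) (f : V -> R[i]) : V -> R[i] :=
  fun x => \sum_i cderive (b i) (cderive (b i) f) x.

End test_functions.

Section oscillator.
Context {R : realType}.

Definition dotv n (u v : 'cV[R]_n) : R := \sum_i u i 0 * v i 0.

Definition posdef n (A : 'M[R]_n) :=
  A^T = A /\ forall x : 'cV[R]_n, x != 0 -> 0 < dotv (A *m x) x.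

Definition basis_x n p (i : 'I_n) : 'cV[R]_n * 'cV[R]_p := (delta_mx i 0, 0).
Definition basis_y n p (j : 'I_p) : 'cV[R]_n * 'cV[R]_p := (0, delta_mx j 0).

Variables (n p : nat) (h : R) (A : 'M[R]_n) (B : 'M[R]_p).

Definition oscillator_expr (f : 'cV[R]_n * 'cV[R]_p -> R[i]) :
    'cV[R]_n * 'cV[R]_p -> R[i] := fun xy =>
  - (h ^+ 2)%:C * laplacian (@basis_x n p) f xy
  - laplacian (@basis_y n p) f xy
  + (dotv (A *m xy.1) xy.1)%:C * f xy + (dotv (B *m xy.2) xy.2)%:C * f xy.

Definition lebesgue_xy : {measure set ('cV[R]_n * 'cV[R]_p) -> \bar R} :=
  (lebesgue_colvec R n \x lebesgue_colvec R p)%E.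

(* Every test function f, and oscillator_expr f, is square integrable, so that
   quantifying over f g : L2fun below leaves out no test function. *)
Definition oscillator_min : set (L2 lebesgue_xy * L2 lebesgue_xy) :=
  [set uv | exists f g : L2fun lebesgue_xy,
    [/\ test_function f, g = oscillator_expr f :> (_ -> _)
      & uv = (L2class f, L2class g)]].

(* The operator H(h), as the closure of the graph on test functions. *)
Definition oscillator : set (L2 lebesgue_xy * L2 lebesgue_xy) :=
  closure oscillator_min.

End oscillator.

(* Main.v *)
Require Import Defs.
From HB Require Import structures.
From mathcomp Require Import all_boot all_order all_algebra.
From mathcomp Require Import complex.
From mathcomp Require Import all_classical all_reals all_analysis.
From mathcomp Require Import measurable_realfun.
From mathcomp Require Import ring lra.

Set Implicit Arguments.
Unset Strict Implicit.
Unset Printing Implicit Defensive.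

Import Order.TTheory GRing.Theory Num.Theory.
Import numFieldNormedType.Exports.

Local Open Scope classical_set_scope.
Local Open Scope ring_scope.
Local Open Scope complex_scope.

(* An orthogonal change of variables in x and in y, followed by a dilation of each
   coordinate, turns H(h) into the sum of nu_i (- d_i^2 + l_i^2), where the l_i are
   linear coordinates and nu_i is h w_i or mu_j. The products of one-dimensional
   Hermite functions hermite_fun (alpha_i) (l_i x) are then eigenfunctions, with
   eigenvalues the sums of nu_i (2 alpha_i + 1).

   They belong to the domain of the closure because the Hermite functions have
   smooth cutoffs along which the operator converges in L^2, and a vector (u, v) of
   the graph satisfies <v, e> = lambda <u, e> for every eigenfunction e, by
   integration by parts on test functions. They are complete: if f is orthogonal to
   all of them, so is f times any Gaussian in a coordinate l_i with a small
   exponent; pointwise limits of polynomials in such Gaussians give indicators of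
   half-spaces, hence of all measurable sets, so f = 0. A closed operator that is
   diagonal in a complete orthogonal family, with eigenvalues tending to infinity,
   has discrete spectrum equal to the set of these eigenvalues. *)

(** * Diagonal operators *)

(** The coordinates l_i stay linear forms on the original space, and no integral is transported by
    the change of variables. Lebesgue measure then enters through translation invariance,
    integrability of Gaussians and positivity of the total mass; orthogonality and non-vanishing of
    the Hermite functions come from integration by parts instead of computed integrals. The dilation
    t = sqrt(w/h) x turns -h^2 d_x^2 + w^2 x^2 into h w (-d_t^2 + t^2), so both terms carry the same
    weight nu. The identity <v, e> = lambda <u, e> does the work of self-adjointness: with
    closedness and completeness it determines the resolvent coefficient by coefficient. Hermite
    functions are bounded by C exp(-t^2/4): half of the exponent of exp(-t^2/2) is spent on
    absorbing polynomials. The remaining 1/4 fixes how small the Gaussian exponents must be in the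
    completeness proof (1/16); larger exponents are reached as powers of small ones. *)

Section diagonal_operator.
Context {R : realType}.
Local Notation K := (R[i]).
Context {V : normedModType K}.
Variable ip : V -> V -> K.
Hypothesis ip_lin : forall a u v w, ip (a *: u + v) w = a * ip u w + ip v w.
Hypothesis ip_conj : forall u v, ip u v = (ip v u)^*%R.
Hypothesis ip_norm : forall u, ip u u = `|u| ^+ 2.

Let ip0l v : ip 0 v = 0.
Proof. by have := ip_lin (-1) v v v; rewrite scaleN1r addNr => ->; rewrite mulN1r addNr. Qed.

Let ipZl a u w : ip (a *: u) w = a * ip u w.
Proof. by have := ip_lin a u 0 w; rewrite addr0 ip0l addr0. Qed.

Let ipDl u v w : ip (u + v) w = ip u w + ip v w.
Proof. by have := ip_lin 1 u v w; rewrite scale1r mul1r. Qed.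

Let ipNl u w : ip (- u) w = - ip u w.
Proof. by rewrite -scaleN1r ipZl mulN1r. Qed.

Let ip0r v : ip v 0 = 0.
Proof. by rewrite ip_conj ip0l conjC0. Qed.

Let ipZr a u w : ip w (a *: u) = a^*%R * ip w u.
Proof. by rewrite ip_conj ipZl rmorphM/= -ip_conj. Qed.

Let ipDr u v w : ip w (u + v) = ip w u + ip w v.
Proof. by rewrite ip_conj ipDl rmorphD/= -!ip_conj. Qed.

Let ip_suml (I : Type) (r : seq I) (P : pred I) (F : I -> V) w :
  ip (\sum_(i <- r | P i) F i) w = \sum_(i <- r | P i) ip (F i) w.
Proof. by elim/big_rec2: _ => [|i y1 y2 _ <-]; rewrite ?ip0l ?ipDl. Qed.

Let pythagoras u v : ip u v = 0 -> `|u + v| ^+ 2 = `|u| ^+ 2 + `|v| ^+ 2.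
Proof.
move=> uv; rewrite -!ip_norm ipDl !ipDr uv (ip_conj v u) uv conjC0.
by rewrite addr0 add0r.
Qed.

(** Pythagoras for the splitting of [u] into its projection [c *: w] and an orthogonal remainder
    bounds the projection by [u]. *)
Lemma cauchy_schwarz u w : `|ip u w| <= `|u| * `|w|.
Proof.
have [->|w0] := eqVneq w 0; first by rewrite ip0r !normr0 mulr0.
have nw : 0 < `|w| by rewrite normr_gt0.
pose c := ip u w / ip w w.
have cE : c * ip w w = ip u w by rewrite divfK// ip_norm expf_neq0// gt_eqF.
have o : ip (u - c *: w) (c *: w) = 0 by rewrite ipZr ipDl ipNl ipZl cE subrr mulr0.
have := pythagoras o; rewrite subrK => uE.
have cu : `|c| * `|w| <= `|u|.
  rewrite -(@ler_pXn2r _ 2)// ?nnegrE ?mulr_ge0// uE exprMn normrZ exprMn lerDr.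
  exact: exprn_ge0.
rewrite -cE ip_norm normrM normrX normr_id expr2 mulrA; exact: ler_wpM2r.
Qed.

Hypothesis complete : forall u : nat -> V,
  (forall eps : K, 0 < eps -> exists N, forall i j, (N <= i)%N -> (N <= j)%N ->
    `|u i - u j| < eps) ->
  exists l, forall eps : K, 0 < eps -> exists N, forall i, (N <= i)%N ->
    `|u i - l| < eps.

Variables (e : nat -> V) (lam : nat -> K).
Hypothesis orth : forall i j, i != j -> ip (e i) (e j) = 0.
Hypothesis total : forall u, (forall k, ip u (e k) = 0) -> u = 0.

(** Zero vectors are allowed in the family [e], because the enumeration of multi-indices by natural
    numbers has gaps. At such [k] the coefficient is 0 by the convention x / 0 = 0. *)
Let coef v k := ip v (e k) / ip (e k) (e k).

Let psum (a : nat -> K) N : V := \sum_(0 <= k < N) a k *: e k.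

Let ip_psum a N k : ip (psum a N) (e k) =
  if (k < N)%N then a k * ip (e k) (e k) else 0.
Proof.
rewrite /psum ip_suml; elim: N => [|N IH]; first by rewrite big_geq.
rewrite big_nat_recr //= IH ipZl ltnS; case: (ltngtP k N) => [kN|kN|->].
- by rewrite (@orth N k) ?mulr0 ?addr0// gtn_eqF.
- by rewrite (@orth N k) ?mulr0 ?addr0// ltn_eqF.
- by rewrite add0r.
Qed.

Let ip_coef v k : coef v k * ip (e k) (e k) = ip v (e k).
Proof.
rewrite /coef; have [->|ek0] := eqVneq (e k) 0; first by rewrite !ip0r mulr0.
by rewrite divfK// ip_norm expf_eq0/= normr_eq0.
Qed.

Let psum_diff a M N : (M <= N)%N ->
  `|psum a N - psum a M| ^+ 2 = \sum_(M <= k < N) `|a k| ^+ 2 * `|e k| ^+ 2.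
Proof.
move=> MN; have -> : psum a N - psum a M = \sum_(M <= k < N) a k *: e k.
  by rewrite /psum (big_cat_nat (leq0n M) MN)/= addrAC subrr add0r.
elim: N MN => [|N IH]; first by rewrite leqn0 => /eqP ->; rewrite !big_geq ?normr0 ?expr0n.
rewrite leq_eqVlt => /predU1P[->|]; first by rewrite !big_geq ?normr0 ?expr0n.
rewrite ltnS => MN; rewrite !big_nat_recr//= pythagoras ?IH ?normrZ ?exprMn//.
rewrite ip_suml big1_seq// => k; rewrite mem_index_iota => /andP[_ /andP[_ kN]].
by rewrite ipZl ipZr orth ?mulr0// ltn_eqF.
Qed.

Let psum0 a : psum a 0 = 0. Proof. by rewrite /psum big_geq. Qed.

(** The remainder [v - psum (coef v) N] is orthogonal to the partial sum, so Pythagoras applies. *)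
Let bessel v N : \sum_(0 <= k < N) `|coef v k| ^+ 2 * `|e k| ^+ 2 <= `|v| ^+ 2.
Proof.
rewrite -psum_diff// psum0 subr0.
have : ip (v - psum (coef v) N) (psum (coef v) N) = 0.
  rewrite ip_conj {2}/psum ip_suml big1_seq ?conjC0// => k.
  rewrite mem_index_iota => /andP[_ /andP[_ kN]].
  by rewrite ipZl ip_conj ipDl ipNl ip_psum kN ip_coef subrr conjC0 mulr0.
by move/pythagoras; rewrite subrK => ->; rewrite lerDr exprn_ge0.
Qed.

(** Nonnegative elements of [R[i]] are real, so the claim reduces to monotone convergence of the
    real parts. *)
Let ser_cauchy (s : nat -> K) (M : K) : (forall k, 0 <= s k) ->
  (forall N, \sum_(0 <= k < N) s k <= M) ->
  forall eps : K, 0 < eps -> exists N, forall i j, (N <= i)%N -> (i <= j)%N ->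
    \sum_(i <= k < j) s k < eps.
Proof.
move=> s0 sM eps eps0.
have sE k : s k = (complex.Re (s k))%:C by rewrite RRe_real// ger0_real.
have sumE i j : \sum_(i <= k < j) s k = (\sum_(i <= k < j) complex.Re (s k))%:C.
  by rewrite rmorph_sum; apply: eq_bigr.
have M0 : 0 <= M by have := sM 0%N; rewrite big_geq.
have ME : M = (complex.Re M)%:C by rewrite RRe_real// ger0_real.
have epsE : eps = (complex.Re eps)%:C by rewrite RRe_real// gtr0_real.
have t0 k : 0 <= complex.Re (s k) by rewrite -lecR -sE.
pose S := series (fun k => complex.Re (s k)).
have ndS : nondecreasing_seq S by exact: nondecreasing_series.
have ubS : has_ubound (range S).
  by exists (complex.Re M) => _ [N _ <-]; rewrite -lecR /S /series/= -sumE -ME.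
have cS := nondecreasing_is_cvgn ndS ubS.
have /cvgrPdist_lt : S n @[n --> \oo] --> limn S by exact: cS.
have e0 : 0 < complex.Re eps by rewrite -ltcR -epsE.
move=> /(_ _ e0)[N _ HN]; exists N => i j Ni ij.
rewrite sumE epsE ltcR.
have -> : \sum_(i <= k < j) complex.Re (s k) = S j - S i.
  by rewrite /S /series/= (big_cat_nat (leq0n i) ij)/= addrAC subrr add0r.
have := HN i Ni; rewrite /= ger0_norm ?subr_ge0; last exact: nondecreasing_cvgn_le.
apply: le_lt_trans; rewrite lerD2r; exact: nondecreasing_cvgn_le.
Qed.

Let psum_cauchy (a : nat -> K) (M : K) :
  (forall N, \sum_(0 <= k < N) `|a k| ^+ 2 * `|e k| ^+ 2 <= M) ->
  exists l, forall eps : K, 0 < eps -> exists N, forall i, (N <= i)%N ->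
    `|psum a i - l| < eps.
Proof.
move=> aM; apply: complete => eps eps0.
have a0 k : 0 <= `|a k| ^+ 2 * `|e k| ^+ 2 by rewrite mulr_ge0 ?exprn_ge0.
have [N HN] := ser_cauchy a0 aM (exprn_gt0 2 eps0).
exists N => i j Ni Nj; rewrite -(@ltr_pXn2r _ 2)// ?nnegrE ?normr_ge0 ?(ltW eps0)//.
case/orP: (leq_total i j) => ij.
  by rewrite distrC psum_diff// HN.
by rewrite psum_diff// HN.
Qed.

Let small_eq0 (x : K) : 0 <= x -> (forall eps : K, 0 < eps -> x < eps) -> x = 0.
Proof.
move=> x0 H; apply/eqP; move: x0; rewrite le_eqVlt eq_sym => /orP[//|x0].
by have := H x x0; rewrite ltxx.
Qed.

Let cauchy_schwarz_unit u k : `|ip u (e k)| <= `|u| * `|e k|.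
Proof.
have := bessel u k.+1; rewrite big_nat_recr//=.
move=> H; rewrite -(@ler_pXn2r _ 2)// ?nnegrE ?mulr_ge0//.
rewrite exprMn -(ip_coef u k) normrM exprMn ip_norm [`| `|e k| ^+ 2|]ger0_norm ?exprn_ge0//.
rewrite [X in _ * X]expr2 mulrA ler_wpM2r ?exprn_ge0//; apply: le_trans H.
by rewrite lerDr sumr_ge0// => i _; rewrite mulr_ge0 ?exprn_ge0.
Qed.

Let ip_lim (u : nat -> V) l k c :
  (forall eps : K, 0 < eps -> exists N, forall i, (N <= i)%N -> `|u i - l| < eps) ->
  (exists N0, forall i, (N0 <= i)%N -> ip (u i) (e k) = c) -> ip l (e k) = c.
Proof.
move=> ul [N0 uc].
have [ek0|ek0] := eqVneq (e k) 0.
  by rewrite ek0 ip0r -(uc N0)// ek0 ip0r.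
apply/eqP; rewrite -subr_eq0 -normr_eq0; apply/eqP.
apply: small_eq0 => // eps eps0.
have ekn : 0 < `|e k| by rewrite normr_gt0.
have [N HN] := ul (eps / `|e k|) (divr_gt0 eps0 ekn).
have := HN (maxn N N0) (leq_maxl _ _); rewrite ltr_pdivlMr//; apply: le_lt_trans.
rewrite -(uc (maxn N N0) (leq_maxr _ _)) -ipNl -ipDl distrC.
exact: cauchy_schwarz_unit.
Qed.

(** The partial sums converge by Bessel's inequality and completeness of the space; their limit has
    the coefficients of [v], hence equals [v] by totality. *)
Let expansion v : forall eps : K, 0 < eps -> exists N, forall i, (N <= i)%N ->
    `|psum (coef v) i - v| < eps.
Proof.
have [l Hl] := psum_cauchy (bessel v).
suff vl : v = l by rewrite {2}vl.
apply/eqP; rewrite -subr_eq0; apply/eqP; apply: total => k.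
rewrite ipDl ipNl; apply/eqP; rewrite subr_eq0 eq_sym; apply/eqP.
apply: (ip_lim Hl); exists k.+1 => i ki.
by rewrite ip_psum ki ip_coef.
Qed.

(** [H_sym] is the part of self-adjointness that the argument uses: elements of the graph are tested
    against the eigenvectors only. [lam_infty] lets the eigenvalues leave every unit disc;
    isolation, finite multiplicity and the uniform distance in [gap] all come from it. *)
Variable H : set (V * V).
Hypothesis H_lin : forall a u v u' v', H (u, v) -> H (u', v') ->
  H (a *: u + u', a *: v + v').
Hypothesis H_closed : forall u v, (forall eps : K, 0 < eps -> exists u' v',
  [/\ H (u', v'), `|u' - u| < eps & `|v' - v| < eps]) -> H (u, v).
Hypothesis H_eig : forall k, H (e k, lam k *: e k).
Hypothesis H_sym : forall u v k, H (u, v) -> ip v (e k) = lam k * ip u (e k).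
Hypothesis lam_infty : forall z, exists N, forall k, (N <= k)%N -> e k != 0 ->
  1 <= `|lam k - z|.

Let H0 : H (0, 0).
Proof.
by have := H_lin (-1) (H_eig 0) (H_eig 0); rewrite !scaleN1r !addNr.
Qed.

(** The second component is split off as a shift by [z] to match the equation H u = v + z u of the
    resolvent. *)
Let H_psum a N z : H (psum a N, psum (fun k => (lam k - z) * a k) N + z *: psum a N).
Proof.
rewrite /psum; elim: N => [|N IH]; first by rewrite !big_geq// scaler0 addr0.
have := H_lin (a N) (H_eig N) IH.
rewrite !big_nat_recr//=; set u := \sum_(0 <= k < N) _; set v := \sum_(0 <= k < N) _.
congr (H (_, _)); first by rewrite addrC.
rewrite scalerDr !scalerA mulrBl scalerBl (mulrC (lam N)) [RHS]addrACA subrK.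
by rewrite [LHS]addrCA -addrA (addrC (_ *: u)).
Qed.

(** Beyond some index the distance is at least 1; [d] is the minimum of 1 and the finitely many
    remaining nonzero distances. *)
Let gap z : exists2 d : K, 0 < d &
  forall k, e k != 0 -> lam k != z -> d <= `|lam k - z|.
Proof.
have [N HN] := lam_infty z.
have [d d0 Hd] : exists2 d : K, 0 < d <= 1 &
    forall k, (k < N)%N -> lam k != z -> d <= `|lam k - z|.
  elim: {HN} N => [|N [d /andP[d0 d1] Hd]]; first by exists 1; rewrite ?lexx ?ltr01.
  have [lz|lz] := eqVneq (lam N) z.
    exists d; rewrite ?d0// => k; rewrite ltnS leq_eqVlt => /orP[/eqP->|]; last exact: Hd.
    by rewrite lz eqxx.
  have nz : 0 < `|lam N - z| by rewrite normr_gt0 subr_eq0.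
  have nr : `|lam N - z| \is Num.real by exact: normr_real.
  case/orP: (real_leVge (gtr0_real d0) nr) => dn.
    exists d; rewrite ?d0// => k; rewrite ltnS leq_eqVlt => /orP[/eqP->//|]; exact: Hd.
  exists `|lam N - z|; rewrite ?nz ?(le_trans dn)// => k.
  rewrite ltnS leq_eqVlt => /orP[/eqP->//|kN /(Hd _ kN)]; exact: le_trans.
case/andP: d0 => d0 d1; exists d => // k ek lz.
case: (ltnP k N) => kN; first exact: Hd.
exact: le_trans (HN _ kN ek).
Qed.

Let kernel0 u z : H (u, z *: u) -> forall k, lam k != z -> ip u (e k) = 0.
Proof.
move=> /H_sym Hu k lz; have := Hu k; rewrite ipZl => /eqP.
by rewrite -subr_eq0 -mulrBl mulf_eq0 subr_eq0 eq_sym (negbTE lz) => /eqP.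
Qed.

(** Dividing the coefficients of [v] by [lam k - z] gives a convergent series, since these factors
    stay away from 0; closedness of [H] then passes to the limit. *)
Let solve z : (forall k, e k != 0 -> lam k != z) -> forall v, exists u,
  H (u, v + z *: u).
Proof.
move=> zE v; have [d d0 Hd] := gap z.
pose a k := (lam k - z)^-1 * coef v k.
(* Where [e k = 0] nothing bounds [lam k - z] away from 0, so these coefficients are set to 0. *)
pose b k := if e k == 0 then 0 else a k.
have [l Hl] : exists l, forall eps : K, 0 < eps -> exists N, forall i, (N <= i)%N ->
    `|psum b i - l| < eps.
  apply: (@psum_cauchy _ (d^-1 ^+ 2 * `|v| ^+ 2)) => N.
  apply: le_trans (ler_wpM2l _ (bessel v N)); last by rewrite exprn_ge0// invr_ge0 ltW.
  rewrite mulr_sumr ler_sum// => k _; rewrite /b.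
  have [->|ek] := eqVneq (e k) 0; first by rewrite !normr0 !expr0n/= !mulr0.
  rewrite /a normrM exprMn -mulrA ler_wpM2r ?mulr_ge0 ?exprn_ge0//.
  rewrite normfV lerXn2r// ?nnegrE ?invr_ge0 ?normr_ge0 ?(ltW d0)//.
  rewrite lef_pV2 ?posrE//; first exact: Hd (zE _ ek).
  by rewrite normr_gt0 subr_eq0 zE.
exists l; apply: H_closed => eps eps0.
(* The error in the second component contains [z] times the error of the partial sums; the divisor 1
   + |z| absorbs this factor. *)
have hz : 0 < eps / 2 / (1 + `|z|).
  by rewrite !divr_gt0// ltr_wpDr.
have [N1 HN1] := Hl _ hz.
have [N2 HN2] := expansion v (divr_gt0 eps0 (ltr0Sn _ 1)).
have [N3 HN3] := Hl _ eps0.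
pose N := maxn N3 (maxn N1 N2).
exists (psum b N), (psum (fun k => (lam k - z) * b k) N + z *: psum b N).
split; [exact: H_psum|by apply: HN3; rewrite leq_maxl|].
have -> : psum (fun k => (lam k - z) * b k) N = psum (coef v) N.
  apply: eq_bigr => k _; rewrite /b.
  have [->|ek] := eqVneq (e k) 0; first by rewrite !scaler0.
  by rewrite /a mulrA mulfV ?mul1r// subr_eq0 zE.
rewrite opprD addrACA -scalerBr (le_lt_trans (ler_normD _ _))//.
rewrite [ltRHS](_ : _ = eps / 2 + eps / 2); last by rewrite -splitr.
apply: ltr_leD; first by apply: HN2; rewrite /N !leq_max leqnn !orbT.
rewrite normrZ.
have /ltW := HN1 N (leq_trans (leq_maxl _ _) (leq_maxr _ _)).
rewrite ler_pdivlMr ?ltr_wpDr// mulrC; apply: le_trans.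
by rewrite ler_wpM2r// lerDr.
Qed.

Let unique z : (forall k, e k != 0 -> lam k != z) -> forall v u u',
  H (u, v + z *: u) -> H (u', v + z *: u') -> u = u'.
Proof.
move=> zE v u u' Hu Hu'; apply/eqP; rewrite -subr_eq0; apply/eqP; apply: total => k.
have [->|ek] := eqVneq (e k) 0; first by rewrite ip0r.
apply: (@kernel0 _ z); last exact: zE.
have := H_lin (-1) Hu' Hu; rewrite !scaleN1r (addrC (- u')).
congr (H (_, _)); rewrite opprD addrACA addNr add0r scalerBr addrC //.
Qed.

Let bound z : (forall k, e k != 0 -> lam k != z) -> exists2 C : K, 0 < C &
  forall u v, H (u, v + z *: u) -> `|u| <= C * `|v|.
Proof.
move=> zE; have [d d0 Hd] := gap z; exists d^-1; first by rewrite invr_gt0.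
move=> u v Huv.
have uv k : e k != 0 -> coef u k = (lam k - z)^-1 * coef v k.
  move=> ek; rewrite /coef mulrA; congr (_ / _).
  have := H_sym k Huv; rewrite ipDl ipZl => /eqP; rewrite eq_sym -subr_eq -mulrBl => /eqP <-.
  by rewrite mulKf// subr_eq0 zE.
have nn N : `|psum (coef u) N| <= d^-1 * `|v|.
  rewrite -(@ler_pXn2r _ 2)// ?nnegrE ?mulr_ge0 ?invr_ge0 ?(ltW d0)//.
  rewrite -[psum _ _]subr0 -[X in _ - X](psum0 (coef u)) psum_diff// exprMn.
  apply: le_trans (ler_wpM2l _ (bessel v N)); last by rewrite exprn_ge0// invr_ge0 ltW.
  rewrite mulr_sumr ler_sum// => k _.
  have [->|ek] := eqVneq (e k) 0; first by rewrite !normr0 !expr0n/= !mulr0.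
  rewrite uv// normrM exprMn -mulrA ler_wpM2r ?mulr_ge0 ?exprn_ge0//.
  rewrite normfV lerXn2r// ?nnegrE ?invr_ge0 ?normr_ge0 ?(ltW d0)//.
  rewrite lef_pV2 ?posrE//; first exact: Hd (zE _ ek).
  by rewrite normr_gt0 subr_eq0 zE.
have dv : d^-1 * `|v| \is Num.real by rewrite ger0_real// mulr_ge0// invr_ge0 ltW.
(* If |u| exceeded the bound, a partial sum closer to [u] than the excess would violate [nn]. *)
rewrite real_leNgt ?normr_real//; apply/negP => lt.
have [N HN] := expansion u (etrans (subr_gt0 _ _) lt).
have := HN N (leqnn _); rewrite real_ltNge ?normr_real ?rpredB ?normr_real//.
case/negP; rewrite distrC; apply: le_trans (lerB_dist _ _).
by rewrite lerD2l lerN2.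
Qed.

Let in_resolvent z : (forall k, e k != 0 -> lam k != z) -> resolvent_set H z.
Proof.
move=> zE; have [S HS] := choice (solve zE).
have uniq := unique zE.
have linS : linear S.
  move=> a u v; apply: (uniq (a *: u + v)); first exact: HS.
  have := H_lin a (HS u) (HS v); congr (H (_, _)).
  by rewrite !scalerDr addrACA !scalerA (mulrC a z).
pose S' : {linear V -> V} := HB.pack S (GRing.isLinear.Build _ _ _ _ S linS).
exists S'; split => //.
- have [C C0 HC] := bound zE.
  apply: (@bounded_linear_continuous _ _ _ S').
  apply/linear_boundedP; exists C; split; first by rewrite gtr0_real.
  by move=> r Cr x; apply: le_trans (HC _ _ (HS x)) _; rewrite ler_wpM2r// ltW.
- move=> u v Huv; apply: (uniq (v - z *: u)); first exact: HS.
  by rewrite subrK.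
Qed.

Let eig_spectrum k : e k != 0 -> spectrum H (lam k).
Proof.
move=> ek [S [_ _ /(_ _ _ (H_eig k))]]; rewrite subrr linear0 => /eqP.
by rewrite eq_sym (negbTE ek).
Qed.

Let spectrumE : spectrum H = [set z | exists2 k, e k != 0 & z = lam k].
Proof.
apply/seteqP; split => z; last by move=> [k ek ->]; exact: eig_spectrum.
move=> zs; apply: contrapT => nz; apply: zs; apply: in_resolvent => k ek.
by apply/eqP => lz; apply: nz; exists k.
Qed.

Lemma spectrum_diagonal : spectrum H = discrete_spectrum H /\
  discrete_spectrum H = [set z | exists2 k, e k != 0 & z = lam k].
Proof.
suff E : discrete_spectrum H = spectrum H by rewrite E -spectrumE.
apply/seteqP; split => z; first by move=> [_ _ /isolatedS].
move=> zs; have := zs; rewrite spectrumE => -[k ek zk]; split.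
- by exists (e k) => //; rewrite zk; exact: H_eig.
(* Past [N] no relevant [lam j] equals [z], so an eigenvector is orthogonal to those [e j] and
   equals its N-th partial sum. *)
- have [N HN] := lam_infty z; exists N, (fun i => e i) => u Hu.
  exists (coef u); apply/eqP; rewrite -subr_eq0; apply/eqP; apply: total => j.
  have -> : \sum_(i < N) coef u i *: e i = psum (coef u) N by rewrite /psum big_mkord.
  rewrite ipDl ipNl ip_psum; case: ltnP => jN; first by rewrite ip_coef subrr.
  rewrite subr0; have [->|ej] := eqVneq (e j) 0; first by rewrite ip0r.
  apply: (kernel0 Hu); have := HN _ jN ej.
  by apply: contraTneq => ->; rewrite subrr normr0 ler10.
- split; first exact: mem_set.
  have [d d0 Hd] := gap z.
  exists (ball (z : K^o) d); first exact: (nbhsx_ballx (z : K^o)).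
  apply/seteqP; split => y /=; last by move=> ->; split => //; exact: ballxx.
  rewrite spectrumE => -[zy [j ej yj]]; apply/eqP.
  apply: contraTT zy => yz; apply/negP => /=.
  by rewrite distrC => /lt_geF; rewrite yj Hd// -yj.
Qed.

End diagonal_operator.

(** * The inner product of L^2 *)

(** The intervals of radius 2 M / 2^k around [s k] are nested, and the supremum of their left ends
    lies in all of them. This gives the rate of convergence together with the limit. *)
Lemma summable_increments {R : realType} (s : nat -> R) (M : R) :
  (forall k, `|s k.+1 - s k| <= M / 2 ^+ k) ->
  exists2 l : R, s n @[n --> \oo] --> l & forall k, `|l - s k| <= 2 * M / 2 ^+ k.
Proof.
move=> sM.
have M0 : 0 <= M by have := sM 0%N; rewrite expr0 divr1; apply: le_trans.
pose lo k := s k - 2 * M / 2 ^+ k; pose up k := s k + 2 * M / 2 ^+ k.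
have half k : 2 * M / 2 ^+ k.+1 = M / 2 ^+ k.
  by rewrite exprS invfM mulrACA divff ?mul1r// pnatr_eq0.
have dbl k : 2 * M / 2 ^+ k = M / 2 ^+ k + M / 2 ^+ k.
  by rewrite -mulrA mulr_natl mulr2n.
have lou k : lo k <= up k.
  by rewrite /lo /up lerD2l ge0_cp// mulr_ge0 ?invr_ge0 ?exprn_ge0// mulr_ge0.
have lo1 k : lo k <= lo k.+1.
  rewrite /lo half dbl; have := sM k; rewrite ler_norml => /andP[]; lra.
have up1 k : up k.+1 <= up k.
  rewrite /up half dbl; have := sM k; rewrite ler_norml => /andP[]; lra.
have ndlo : {homo lo : m n / (m <= n)%N >-> m <= n} by apply: homo_leq => //; exact: le_trans.
have niup m n : (m <= n)%N -> up n <= up m.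
  elim: n => [|n IH]; first by rewrite leqn0 => /eqP ->.
  by rewrite leq_eqVlt => /predU1P[->//|/IH]; apply: le_trans.
have loup j k : lo j <= up k.
  apply: (@le_trans _ _ (lo (maxn j k))); first by apply: ndlo; rewrite leq_maxl.
  by apply: le_trans (lou _) _; apply: niup; rewrite leq_maxr.
have hub : has_ubound (range lo) by exists (up 0%N) => _ [j _ <-]; exact: loup.
pose l := sup (range lo).
have lol k : lo k <= l by apply: ub_le_sup => //; exists k.
have lup k : l <= up k by apply: ge_sup; [exists (lo 0%N), 0%N|move=> _ [j _ <-]; exact: loup].
have bnd k : `|l - s k| <= 2 * M / 2 ^+ k.
  by rewrite ler_norml; have := lol k; have := lup k; rewrite /lo /up; lra.
exists l => //; apply/cvgrPdist_le => e e0.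
have : (2 * M) * (2^-1) ^+ k @[k --> \oo] --> (2 * M) * 0.
  by apply: cvgMr; apply: cvg_expr; rewrite ger0_norm ?invr_ge0// invf_lt1// ltr1n.
rewrite mulr0 => /cvgrPdist_le /(_ _ e0); apply: filterS => k.
rewrite sub0r normrN => H; apply: le_trans (bnd k) _; apply: le_trans H.
by rewrite exprVn ler_norm.
Qed.

Section L2_inner_product.
Context d (T : measurableType d) (R : realType).
Variable mu : {measure set T -> \bar R}.
Local Notation L := (Lfun mu 2%:E).
Local Notation intg f := (mu.-integrable setT (EFin \o f)).

Lemma sqr_integrable_Lfun (f : T -> R) : measurable_fun setT f ->
  (\int[mu]_x ((f x) ^+ 2)%:E < +oo)%E -> f \in L.
Proof.
move=> mf fi; apply/andP; rewrite !inE/=; split => //.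
rewrite /finite_norm unlock /Lnorm poweR_lty//.
by under eq_integral do rewrite /= powR_mulrn// real_normK ?num_real//.
Qed.

Let le12 : (1 <= 2%:E :> \bar R)%E := lee1n 2.

Lemma Lfun0 : (fun=> 0) \in L.
Proof. by have : (0 : T -> R) \in L by rewrite rpred0. Qed.

Lemma LfunD (f g : T -> R) : f \in L -> g \in L -> (fun x => f x + g x) \in L.
Proof. by move=> Lf Lg; have : f + g \in L by rewrite rpredD. Qed.

Lemma LfunB (f g : T -> R) : f \in L -> g \in L -> (fun x => f x - g x) \in L.
Proof. by move=> Lf Lg; have : f - g \in L by rewrite rpredB. Qed.

Lemma LfunZ (r : R) (f : T -> R) : f \in L -> (fun x => r * f x) \in L.
Proof. by move=> Lf; have : r *: f \in L by rewrite rpredZ. Qed.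

Lemma Lfun_mul_integrable (f g : T -> R) : f \in L -> g \in L ->
  intg (fun x => f x * g x).
Proof. by move=> Lf Lg; apply/Lfun1_integrable; exact: Lfun2_mul_Lfun1. Qed.

Lemma Lfun_measurable (f : T -> R) : f \in L -> measurable_fun setT f.
Proof. by move/Lfun2P => []. Qed.

Lemma Lfun_sqr_lty (f : T -> R) : f \in L -> (\int[mu]_x ((f x) ^+ 2)%:E < +oo)%E.
Proof. by move=> /Lfun2_integrable_sqr/integrable_lty; exact. Qed.

Lemma ae_eq_Rintegral (f g : T -> R) : measurable_fun setT f ->
  measurable_fun setT g -> {ae mu, forall x, f x = g x} ->
  \int[mu]_x f x = \int[mu]_x g x.
Proof.
move=> mf mg fg; rewrite /Rintegral; congr fine; apply: ae_eq_integral => //.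
- exact/measurable_EFinP.
- exact/measurable_EFinP.
- by apply: filterS fg => x /= ->.
Qed.

Lemma Re_Lfun (f : L2fun mu) : (fun x => complex.Re (f x)) \in L.
Proof. by case: f => f /= /andP[]. Qed.

Lemma Im_Lfun (f : L2fun mu) : (fun x => complex.Im (f x)) \in L.
Proof. by case: f => f /= /andP[]. Qed.

(** The integral of f times the conjugate of g, split into integrals of real functions. *)
Definition L2_dot (f g : L2fun mu) : R[i] :=
  (\int[mu]_x (complex.Re (f x) * complex.Re (g x))
   + \int[mu]_x (complex.Im (f x) * complex.Im (g x))) +i*
  (\int[mu]_x (complex.Im (f x) * complex.Re (g x))
   - \int[mu]_x (complex.Re (f x) * complex.Im (g x))).

Definition L2_ip (u v : L2 mu) : R[i] := L2_dot (L2repr u) (L2repr v).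

Let rint_ae (a b c e : T -> R) : a \in L -> b \in L -> c \in L -> e \in L ->
  {ae mu, forall x, a x = b x} -> {ae mu, forall x, c x = e x} ->
  \int[mu]_x (a x * c x) = \int[mu]_x (b x * e x).
Proof.
move=> La Lb Lc Le ab ce; apply: ae_eq_Rintegral.
- by apply: measurable_funM; exact: Lfun_measurable.
- by apply: measurable_funM; exact: Lfun_measurable.
- by move: ab ce; apply: filterS2 => x -> ->.
Qed.

Let rint_lin (r : R) (a b c : T -> R) : a \in L -> b \in L -> c \in L ->
  \int[mu]_x ((r * a x + b x) * c x) =
  r * \int[mu]_x (a x * c x) + \int[mu]_x (b x * c x).
Proof.
move=> La Lb Lc; rewrite -RintegralZl//; last exact: Lfun_mul_integrable.
rewrite -RintegralD//; last exact: Lfun_mul_integrable.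
  by apply: eq_Rintegral => x _; rewrite mulrDl mulrA.
have := @integrableZl _ _ _ mu setT measurableT r _ (Lfun_mul_integrable La Lc).
by apply: eq_integrable.
Qed.

Lemma L2_ip_class f g : L2_ip (L2class f) (L2class g) = L2_dot f g.
Proof.
have /L2classP fE := L2reprK (L2class f); have /L2classP gE := L2reprK (L2class g).
have ref : {ae mu, forall x, complex.Re (L2repr (L2class f) x) = complex.Re (f x)}.
  by apply: filterS fE => x ->.
have imf : {ae mu, forall x, complex.Im (L2repr (L2class f) x) = complex.Im (f x)}.
  by apply: filterS fE => x ->.
have reg : {ae mu, forall x, complex.Re (L2repr (L2class g) x) = complex.Re (g x)}.
  by apply: filterS gE => x ->.
have img : {ae mu, forall x, complex.Im (L2repr (L2class g) x) = complex.Im (g x)}.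
  by apply: filterS gE => x ->.
rewrite /L2_ip /L2_dot; congr (_ +i* _).
- by congr (_ + _); apply: rint_ae => //; (exact: Re_Lfun || exact: Im_Lfun).
- by congr (_ - _); apply: rint_ae => //; (exact: Re_Lfun || exact: Im_Lfun).
Qed.

Let rint_lin2 (r s : R) (a b c e : T -> R) : a \in L -> b \in L -> c \in L -> e \in L ->
  \int[mu]_x ((r * a x + s * b x + c x) * e x) =
  r * \int[mu]_x (a x * e x) + s * \int[mu]_x (b x * e x) + \int[mu]_x (c x * e x).
Proof.
move=> La Lb Lc Le; under eq_Rintegral do rewrite -addrA.
rewrite rint_lin//; first by rewrite rint_lin// addrA.
by apply: LfunD => //; exact: LfunZ.
Qed.

Lemma L2_ip_linear a u v w : L2_ip (a *: u + v) w = a * L2_ip u w + L2_ip v w.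
Proof.
rewrite -[u]L2reprK -[v]L2reprK -[w]L2reprK [_ *: L2class _]L2scale_class -L2classD.
rewrite !L2_ip_class; set f := L2repr u; set g := L2repr v; set k := L2repr w.
have E1 (b : T -> R) : b \in L -> \int[mu]_x (complex.Re ((a *: f + g) x) * b x) =
   complex.Re a * \int[mu]_x (complex.Re (f x) * b x)
   + (- complex.Im a) * \int[mu]_x (complex.Im (f x) * b x)
   + \int[mu]_x (complex.Re (g x) * b x).
  move=> Lb; rewrite -rint_lin2 ?Re_Lfun ?Im_Lfun//; apply: eq_Rintegral => x _.
  congr (_ * _); have -> : (a *: f + g) x = a * f x + g x by [].
  by case: a (f x) (g x) => [a1 a2] [b1 b2] [c1 c2] /=; rewrite mulNr.
have E2 (b : T -> R) : b \in L -> \int[mu]_x (complex.Im ((a *: f + g) x) * b x) =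
   complex.Re a * \int[mu]_x (complex.Im (f x) * b x)
   + complex.Im a * \int[mu]_x (complex.Re (f x) * b x)
   + \int[mu]_x (complex.Im (g x) * b x).
  move=> Lb; rewrite -rint_lin2 ?Re_Lfun ?Im_Lfun//; apply: eq_Rintegral => x _.
  congr (_ * _); have -> : (a *: f + g) x = a * f x + g x by [].
  by case: a {E1} (f x) (g x) => [a1 a2] [b1 b2] [c1 c2].
rewrite /L2_dot !E1 ?Re_Lfun ?Im_Lfun// !E2 ?Re_Lfun ?Im_Lfun//.
by case: a {E1 E2} => a1 a2 /=; apply/eqP; rewrite eq_complex /=; apply/andP; split;
  apply/eqP; ring.
Qed.

Lemma L2_ip_conj u v : L2_ip u v = (L2_ip v u)^*%R.
Proof.
rewrite /L2_ip /L2_dot; set f := L2repr u; set g := L2repr v.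
apply/eqP; rewrite eq_complex/= opprB; apply/andP; split; apply/eqP.
  by congr (_ + _); apply: eq_Rintegral => x _; rewrite mulrC.
by congr (_ - _); apply: eq_Rintegral => x _; rewrite mulrC.
Qed.

Lemma L2_norm_sqr (f : L2fun mu) : `|L2class f| ^+ 2 =
  (\int[mu]_x (complex.Re (f x) ^+ 2 + complex.Im (f x) ^+ 2))%:C.
Proof.
rewrite [`|_|]L2norm_class -rmorphXn/=; congr (_%:C).
have Lf := normc_fun_Lfun f.
set r := fine _; have rE : ('N[mu]_2%:E[EFin \o normc_fun f] = r%:E)%E.
  by rewrite fineK// ge0_fin_numE ?Lnorm_ge0//; case: (Lfun2P Lf).
suff : (\int[mu]_x (complex.Re (f x) ^+ 2 + complex.Im (f x) ^+ 2)%:E = (r ^+ 2)%:E)%E.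
  by move=> H; rewrite /Rintegral H.
rewrite -powR_mulrn ?fine_ge0 ?Lnorm_ge0// -poweR_EFin -rE powR_Lnorm//.
apply: eq_integral => x _.
rewrite /= powR_mulrn// real_normK ?num_real// /normc_fun.
by case: (f x) => a b /=; rewrite sqr_sqrtr// addr_ge0 ?sqr_ge0.
Qed.

Lemma L2_ip_norm u : L2_ip u u = `|u| ^+ 2.
Proof.
rewrite -[u]L2reprK L2_ip_class L2_norm_sqr /L2_dot; set f := L2repr u.
have -> : \int[mu]_x (complex.Im (f x) * complex.Re (f x)) =
          \int[mu]_x (complex.Re (f x) * complex.Im (f x)).
  by apply: eq_Rintegral => x _; rewrite mulrC.
rewrite subrr -RintegralD ?Lfun_mul_integrable ?Re_Lfun ?Im_Lfun//.
Qed.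

Definition L2_of_real (f : T -> R) (Lf : f \in L) : L2fun mu.
Proof.
refine (@MkL2fun _ _ _ mu (fun x => (f x)%:C) _).
rewrite inE; apply/andP; split; [exact: Lf|exact: Lfun0].
Defined.

Definition L2_of_parts (f g : T -> R) (Lf : f \in L) (Lg : g \in L) : L2fun mu.
Proof.
refine (@MkL2fun _ _ _ mu (fun x => f x +i* g x) _).
by rewrite inE; apply/andP; split.
Defined.

Let Rintegral_ge0_lty (f : T -> R) : (forall x, 0 <= f x) ->
  (\int[mu]_x (f x)%:E < +oo)%E ->
  ((\int[mu]_x f x)%:E = \int[mu]_x (f x)%:E)%E.
Proof.
move=> f0 fi; rewrite /Rintegral fineK// ge0_fin_numE//.
by apply: integral_ge0 => x _; rewrite lee_fin.
Qed.

(** Riesz-Fischer with an explicit rate. The function [h], the sum of 4^k (a_(k+1) - a_k)^2, has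
    integral at most the sum of (4/8)^k, which is 2. Where [h] is finite the increments are at most
    sqrt(h) / 2^k, so the squared distance to the limit is at most 4 h / 4^k, with integral at most
    8 / 4^k. *)
Lemma Lfun_complete (a : nat -> T -> R) : (forall k, a k \in L) ->
  (forall k, \int[mu]_x (a k.+1 x - a k x) ^+ 2 <= 8^-1 ^+ k) ->
  exists2 l : T -> R, l \in L &
    forall k, \int[mu]_x (a k x - l x) ^+ 2 <= 8 * 4^-1 ^+ k.
Proof.
move=> La inc.
have Ld k : (a k.+1 - a k) \in L by apply: LfunB.
have dI k : (\int[mu]_x ((a k.+1 x - a k x) ^+ 2)%:E <= (8^-1 ^+ k)%:E)%E.
  rewrite -Rintegral_ge0_lty ?lee_fin//; first by move=> x; exact: sqr_ge0.
  exact: Lfun_sqr_lty (Ld k).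
have ma k : measurable_fun setT (a k) by exact: Lfun_measurable.
pose g k x := (4 ^+ k * (a k.+1 x - a k x) ^+ 2)%:E.
have g0 k x : (0 <= g k x)%E by rewrite lee_fin mulr_ge0 ?sqr_ge0// exprn_ge0.
have mg k : measurable_fun setT (g k).
  apply/measurable_EFinP; apply: measurable_funM => //.
  by apply: measurable_funX; exact: measurable_funB.
pose h x := (\sum_(0 <= k <oo) g k x)%E.
have h0 x : (0 <= h x)%E by apply: nneseries_ge0 => n _ _.
have mh : measurable_fun setT h by apply: ge0_emeasurable_sum => // k x _ _.
have hI : (\int[mu]_x h x <= 2%:E)%E.
  rewrite integral_nneseries//.
  (* The bound 2^-k is written 2 / 2^(k+1), the shape that [epsilon_trick] sums to 2. *)
  apply: (@le_trans _ _ (\sum_(0 <= k <oo) (0 + (2 / (2 ^ k.+1)%:R)%:E))%E); last first.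
    apply: le_trans (epsilon_trick (A:=fun=> 0%E) xpredT _ _) _ => //.
    by rewrite eseries0// add0e.
  apply: lee_nneseries => [k _ _|k _]; first exact: integral_ge0.
  rewrite /g; under eq_integral do rewrite EFinM.
  rewrite ge0_integralZl//; last 2 first.
    by apply/measurable_EFinP; apply: measurable_funX; exact: measurable_funB.
    by move=> x _; rewrite lee_fin sqr_ge0.
  rewrite add0e (le_trans (lee_wpmul2l _ (dI k)))//.
  rewrite -EFinM lee_fin -exprMn natrX exprS invfM mulrA divff ?mul1r ?pnatr_eq0//.
  by rewrite -exprVn (_ : 4 * 8^-1 = 2^-1)//; field.
have ih : mu.-integrable setT h.
  apply/integrableP; split => //; under eq_integral do rewrite gee0_abs//.
  exact: le_lt_trans hI (ltry _).
have aefin := integrable_ae measurableT ih.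
pose E := [set x | (h x < +oo)%E].
have mE : measurable E.
  have -> : E = setT `&` h @^-1` (~` [set +oo%E]).
    by rewrite setTI; apply/seteqP; split => x; rewrite /E/= ltey => /eqP.
  by apply: mh => //; apply: measurableC; exact: emeasurable_set1.
(* The sequence is set to 0 off [E], so that the limit exists at every point and its measurability
   follows. *)
pose b k x := a k x * \1_E x.
have bE k x : E x -> b k x = a k x by move=> xE; rewrite /b indicE mem_set// mulr1.
have bN k x : ~ E x -> b k x = 0 by move=> xE; rewrite /b indicE memNset// mulr0.
pose s x := Num.sqrt (fine (h x)).
have hfin x : E x -> h x = (fine (h x))%:E.
  by move=> xE; rewrite fineK// ge0_fin_numE.
have incb x k : `|b k.+1 x - b k x| <= (if `[< E x >] then s x else 0) / 2 ^+ k.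
  case: asboolP => xE; last by rewrite !bN// subrr normr0 mul0r.
  rewrite !bE// ler_pdivlMr ?exprn_gt0// -(@ger0_norm _ (2 ^+ k)) ?exprn_ge0//.
  rewrite -normrM -sqrtr_sqr ler_wsqrtr//.
  rewrite -lee_fin -hfin// exprMn mulrC -exprM mulnC exprM -natrX.
  apply: (@le_trans _ _ (\sum_(0 <= j < k.+1) g j x)%E); last exact: nneseries_lim_ge.
  rewrite big_nat_recr//= leeDr//; exact: sume_ge0.
have lim x : exists l : R, b k x @[k --> \oo] --> l /\
    forall k, `|l - b k x| <= 2 * (if `[< E x >] then s x else 0) / 2 ^+ k.
  by have [y ? ?] := summable_increments (incb x); exists y.
have [l Hl] := choice lim.
have mb k : measurable_fun setT (b k).
  by apply: measurable_funM => //; exact: measurable_indic.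
have ml : measurable_fun setT l.
  by apply: (measurable_fun_cvg mb) => x _; case: (Hl x).
have aeE : {ae mu, forall x, E x}.
  by apply: filterS aefin => x /(_ I); rewrite ge0_fin_numE.
have key k : (\int[mu]_x ((a k x - l x) ^+ 2)%:E <= (8 * 4^-1 ^+ k)%:E)%E.
  apply: (@le_trans _ _ (\int[mu]_x ((4 * 4^-1 ^+ k)%:E * h x))%E).
    apply: ae_ge0_le_integral => //.
    - by move=> x _; rewrite lee_fin sqr_ge0.
    - by apply/measurable_EFinP; apply: measurable_funX; exact: measurable_funB.
    - by move=> x _; rewrite mule_ge0// lee_fin mulr_ge0// exprn_ge0.
    - exact: measurable_funeM.
    apply: filterS aeE => x xE _; rewrite hfin// -EFinM lee_fin.
    have [_ /(_ k)] := Hl x; rewrite asboolT// bE// distrC => H.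
    have {}H : `|a k x - l x| ^+ 2 <= (2 * s x / 2 ^+ k) ^+ 2.
      by rewrite lerXn2r// nnegrE//; apply: le_trans H.
    rewrite real_normK ?num_real// in H; apply: le_trans H _.
    have -> : (4^-1 : R) ^+ k = (2 ^+ k)^-1 ^+ 2.
      by rewrite -exprVn -exprM mulnC exprM exprVn -natrX.
    rewrite -[fine (h x)]sqr_sqrtr ?fine_ge0// -/(s x) le_eqVlt; apply/orP; left.
    by apply/eqP; move: (2 ^- k) (s x) => q t; ring.
  rewrite ge0_integralZl//; apply: (le_trans (lee_wpmul2l _ hI)) => //.
  by rewrite -EFinM lee_fin mulrAC -natrM.
(* [l] is square integrable as the difference of [a 0] and [a 0 - l]. *)
exists l.
  have : (a 0 - l) \in L.
    apply: sqr_integrable_Lfun; first exact: measurable_funB.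
    exact: le_lt_trans (key 0%N) (ltry _).
  by move=> /(LfunB (La 0%N)); under eq_fun do rewrite !fctE subKr.
move=> k; rewrite -lee_fin Rintegral_ge0_lty//; first by move=> x; exact: sqr_ge0.
exact: le_lt_trans (key k) (ltry _).
Qed.

Let Rint_add (f g : T -> R) : f \in L -> g \in L ->
  \int[mu]_x (f x ^+ 2 + g x ^+ 2) = \int[mu]_x f x ^+ 2 + \int[mu]_x g x ^+ 2.
Proof. by move=> Lf Lg; rewrite RintegralD// Lfun2_integrable_sqr. Qed.

Lemma L2_norm_sqrE (f : L2fun mu) : `|L2class f| ^+ 2 =
  (\int[mu]_x complex.Re (f x) ^+ 2 + \int[mu]_x complex.Im (f x) ^+ 2)%:C.
Proof. by rewrite L2_norm_sqr Rint_add ?Re_Lfun ?Im_Lfun. Qed.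

Lemma L2fun_subE (f g : L2fun mu) x : (f - g) x = f x - g x.
Proof. by []. Qed.

Lemma L2classN (f : L2fun mu) : L2class (- f) = - L2class f.
Proof.
apply/eqP; rewrite -addr_eq0 -L2classD addNr; apply/eqP.
by rewrite /L2class; exact: (raddf0 (\pi_(Quotient.quot (@L2null _ _ _ mu)))%qT).
Qed.

Lemma L2classB (f g : L2fun mu) : L2class (f - g) = L2class f - L2class g.
Proof. by rewrite L2classD L2classN. Qed.

Lemma L2_complete (u : nat -> L2 mu) :
  (forall eps : R[i], 0 < eps -> exists N, forall i j, (N <= i)%N -> (N <= j)%N ->
    `|u i - u j| < eps) ->
  exists l, forall eps : R[i], 0 < eps -> exists N, forall i, (N <= i)%N ->
    `|u i - l| < eps.
Proof.
move=> uC.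
(* Distances below 3^-k have squares below 9^-k, within the 8^-k required by [Lfun_complete]. *)
have pos k : 0 < ((3^-1 ^+ k)%:C : R[i]) by rewrite ltcR exprn_gt0// invr_gt0.
have [n Hn] := choice (fun k => uC _ (pos k)).
(* A nondecreasing choice of indices above the thresholds [n k]; the summand [k] also makes [s k]
   tend to infinity. *)
pose s k := (k + \sum_(i < k.+1) n i)%N.
have sS k : (s k <= s k.+1)%N by rewrite /s [X in (_ <= _ + X)%N]big_ord_recr/= leq_add// leq_addr.
have ns k : (n k <= s k)%N by rewrite /s big_ord_recr/= addnA leq_addl.
pose f k := L2repr (u (s k)).
have fB k : `|L2class (f k.+1 - f k)| ^+ 2 <= ((8^-1 ^+ k)%:C : R[i]).
  rewrite L2classB !L2reprK; apply: (@le_trans _ _ (((3^-1 ^+ k)%:C : R[i]) ^+ 2)).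
    rewrite lerXn2r// ?nnegrE ?(ltW (pos k))//.
    by apply/ltW/Hn => //; exact: leq_trans (ns k) (sS k).
  rewrite -rmorphXn lecR/= -exprM mulnC exprM lerXn2r// ?nnegrE ?exprn_ge0 ?invr_ge0//.
  by rewrite exprVn lef_pV2 ?posrE// -natrX ler_nat.
have sqr0 (g : T -> R) : 0 <= \int[mu]_x g x ^+ 2 by apply: Rintegral_ge0 => x _; exact: sqr_ge0.
have [a La Ha] : exists2 l : T -> R, l \in L & forall k,
    \int[mu]_x (complex.Re (f k x) - l x) ^+ 2 <= 8 * 4^-1 ^+ k.
  apply: Lfun_complete => k; first exact: Re_Lfun.
  have := fB k; rewrite L2_norm_sqrE lecR; apply: le_trans.
  rewrite -[leLHS]addr0 lerD// le_eqVlt; apply/orP; left; apply/eqP.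
  by apply: eq_Rintegral => x _; rewrite L2fun_subE; case: (f k.+1 x) (f k x) => ? ? [? ?].
have [b Lb Hb] : exists2 l : T -> R, l \in L & forall k,
    \int[mu]_x (complex.Im (f k x) - l x) ^+ 2 <= 8 * 4^-1 ^+ k.
  apply: Lfun_complete => k; first exact: Im_Lfun.
  have := fB k; rewrite L2_norm_sqrE lecR; apply: le_trans.
  rewrite -[leLHS]add0r lerD// le_eqVlt; apply/orP; left; apply/eqP.
  by apply: eq_Rintegral => x _; rewrite L2fun_subE; case: (f k.+1 x) (f k x) => ? ? [? ?].
exists (L2class (L2_of_parts La Lb)) => eps eps0.
set l := L2class _.
have dist k : `|u (s k) - l| ^+ 2 <= ((16 * 4^-1 ^+ k)%:C : R[i]).
  rewrite -[u (s k)]L2reprK -L2classB L2_norm_sqrE lecR.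
  rewrite (_ : 16 * _ = 8 * 4^-1 ^+ k + 8 * 4^-1 ^+ k); last by rewrite -mulrDl -natrD.
  apply: lerD; [apply: le_trans (Ha k)|apply: le_trans (Hb k)];
    rewrite le_eqVlt; apply/orP; left; apply/eqP;
    by apply: eq_Rintegral => x _; rewrite L2fun_subE /f /=; case: (L2repr _ x).
have dist' k : `|u (s k) - l| <= ((4 * 2^-1 ^+ k)%:C : R[i]).
  rewrite -(@ler_pXn2r _ 2)// ?nnegrE// ?lecR ?mulr_ge0 ?exprn_ge0 ?invr_ge0//.
  apply: le_trans (dist k) _; rewrite -rmorphXn lecR/= exprMn -exprM mulnC exprM.
  have -> : (4^-1 : R) = 2^-1 ^+ 2 by field.
  by rewrite -natrX.
have e2 : 0 < eps / 2 by rewrite divr_gt0.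
have [N1 HN1] := uC _ e2.
have epsE : eps / 2 = (complex.Re (eps / 2))%:C by rewrite RRe_real// gtr0_real.
have re0 : 0 < complex.Re (eps / 2) by rewrite -ltcR -epsE.
have [N2 HN2] : exists N2, forall k, (N2 <= k)%N -> 4 * (2^-1 : R) ^+ k < complex.Re (eps / 2).
  have : (4 : R) * (2^-1) ^+ k @[k --> \oo] --> (4 : R) * 0.
    by apply: cvgMr; apply: cvg_expr; rewrite ger0_norm ?invr_ge0// invf_lt1// ltr1n.
  rewrite mulr0 => /cvgrPdist_lt /(_ _ re0)[N _ HN]; exists N => k /HN/=.
  by rewrite sub0r normrN; apply: le_lt_trans; exact: ler_norm.
exists N1 => i N1i.
pose k := maxn N1 N2.
have k2 : (N2 <= k)%N by rewrite leq_maxr.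
have k1 : (N1 <= s k)%N by rewrite (leq_trans (leq_maxl N1 N2))// leq_addr.
rewrite -(subrKA (u (s k))) (le_lt_trans (ler_normD _ _))// (splitr eps).
apply: ltrD; first exact: HN1.
by apply: le_lt_trans (dist' k) _; rewrite epsE ltcR HN2.
Qed.

End L2_inner_product.

(** * Hermite functions on the line *)

Section bump.
Context {R : realType}.

(* [flat 0] is the classical smooth function vanishing on (-oo, 0]; the powers
   of s^-1 make the family stable under derivation. *)
Definition flat (j : nat) (s : R) : R := if 0 < s then s ^- j * expR (- s^-1) else 0.

Lemma flat_ge0 j s : 0 <= flat j s.
Proof. by rewrite /flat; case: ifP => // s0; rewrite mulr_ge0 ?expR_ge0// invr_ge0 exprn_ge0// ltW. Qed.

Lemma flatM j s : flat j s = flat j.+1 s * s.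
Proof.
rewrite /flat; case: ifP => s0; last by rewrite mul0r.
by rewrite exprS invfM mulrAC [s^-1 * _]mulrC mulfVK ?gt_eqF.
Qed.

(** The term of degree j + 1 of the exponential series bounds exp(1/s) from below. The linear factor
    |s| gives continuity at 0. *)
Lemma flat_le j s : flat j s <= (j.+1)`!%:R * `|s|.
Proof.
rewrite /flat; case: ifPn => [s0|_]; last by rewrite mulr_ge0.
rewrite (gtr0_norm s0) expRN ler_pdivrMl ?exprn_gt0//.
rewrite mulrCA -exprSr -[leRHS]invrK lef_pV2 ?posrE ?expR_gt0//; last first.
  by rewrite invr_gt0 mulr_gt0 ?exprn_gt0// ltr0n fact_gt0.
have : 0 <= s^-1 by rewrite invr_ge0 ltW.
move=> /(@expR_ge1Dxn _ _ j); apply: le_trans.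
by rewrite invfM -exprVn mulrC ler_wpDl.
Qed.

Lemma flat_le_fact j s : s <= 1 -> flat j s <= (j.+1)`!%:R.
Proof.
move=> s1; have [s0|s0] := ltP 0 s; last by rewrite /flat ltNge s0.
by apply: le_trans (flat_le j s) _; rewrite gtr0_norm// ler_piMr.
Qed.

(** At 0 Caratheodory's criterion applies: by [flatM] the slope function is [flat j.+1], which
    [flat_le] makes continuous there with value 0. *)
Lemma is_derive_flat (j : nat) (s : R) :
  is_derive s (1 : R) (flat j) (- j%:R * flat j.+1 s + flat j.+2 s).
Proof.
have [s0|s0|->] := ltgtP s 0.
- apply: (@near_eq_is_derive _ _ _ (cst 0)).
    near=> t; rewrite /flat ltNge ltW//.
    by near: t; exact: lt_nbhsl.
  rewrite /flat !ltNge !ltW//= mulr0 addr0; exact: is_derive_cst.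
- apply: (@near_eq_is_derive _ _ _ ((fun y : R => y^-1) ^+ j * (fun y => expR (- y^-1)))).
    near=> t; rewrite /flat ifT; first by rewrite !fctE exprVn.
    by near: t; exact: lt_nbhsr.
  have dV : is_derive s 1 (fun y : R => y^-1) (- s ^- 2).
    by apply: is_derive_eq; [apply: is_deriveV; rewrite ?gt_eqF//|rewrite /GRing.scale/= mulr1].
  have dE : is_derive s 1 (fun y : R => expR (- y^-1)) (expR (- s^-1) * s ^- 2).
    apply: (@is_derive1_comp _ expR (fun y => - y^-1)).
    by apply: is_derive_eq; rewrite opprK.
  have dX : is_derive s 1 ((fun y : R => y^-1) ^+ j) _ := is_deriveX j dV.
  apply: (is_derive_eq (is_deriveM dX dE)).
  rewrite /flat s0 /GRing.scale/= -!exprVn fctE.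
  case: j {dX} => [|j]; first by rewrite /= mulr0n; ring.
  by rewrite /= !exprS; ring.
- apply/is_derive1_caratheodory; exists (flat j.+1); split.
  + by move=> z; rewrite {2}/flat ltxx !subr0 flatM.
  + apply/cvgrPdist_le => e e0; near=> t.
    rewrite {1}/flat ltxx sub0r normrN ger0_norm ?flat_ge0// (le_trans (flat_le _ _))//.
    rewrite -ler_pdivlMl ?ltr0n ?fact_gt0//; near: t.
    apply: (@nbhs0_le R R^o); by rewrite mulr_gt0// invr_gt0 ltr0n fact_gt0.
  + by rewrite /flat ltxx mulr0 addr0.
Unshelve. all: by end_near. Qed.

End bump.

Section hermite.
Context {R : realType}.

(** The Hermite polynomials in the physicists' normalization, with leading coefficient 2^k. *)
Fixpoint hermite (k : nat) : {poly R} :=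
  if k is k'.+1 then 2 *: 'X * hermite k' - (hermite k')^`() else 1.

Arguments hermite : simpl never.

Lemma hermiteS k : hermite k.+1 = 2 *: 'X * hermite k - (hermite k)^`().
Proof. by []. Qed.

Lemma deriv_hermite k : (hermite k.+1)^`() = (2 * k.+1)%:R *: hermite k.
Proof.
elim: k => [|k IH].
  by rewrite /hermite mulr1 derivB derivZ derivX (_ : 1 = 1%:P)// derivC deriv0 subr0.
rewrite [in LHS]hermiteS derivB derivM derivZ derivX {2}IH derivZ.
rewrite IH alg_polyC (hermiteS k) -!mul_polyC !polyC_natr !natrM -[k.+2%:R]natr1.
by ring.
Qed.

Lemma hermite_recurrence k :
  'X * hermite k.+1 = 2^-1 *: hermite k.+2 + k.+1%:R *: hermite k.
Proof.
rewrite (hermiteS k.+1) deriv_hermite scalerBr -scalerAl !scalerA.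
by rewrite mulVf ?pnatr_eq0// scale1r natrM mulKf ?pnatr_eq0// subrK.
Qed.

Lemma hermite_ode k : (hermite k)^`()^`() - 2 *: 'X * (hermite k)^`() = - (2 * k)%:R *: hermite k.
Proof.
case: k => [|k]; first by rewrite /hermite (_ : 1 = 1%:P)// !derivC mulr0 subr0 muln0 oppr0 scale0r.
rewrite deriv_hermite derivZ hermiteS scaleNr -scalerAr -scalerBr -scalerN opprB.
by [].
Qed.

Lemma hermite_odeE k : (hermite k)^`()^`() = 2 *: 'X * (hermite k)^`() - (2 * k)%:R *: hermite k.
Proof. by rewrite -scaleNr -hermite_ode addrC subrK. Qed.

Definition gauss_poly (p : {poly R}) (t : R) : R := p.[t] * expR (- (t ^+ 2 / 2)).

(** The effect on p of differentiating p(t) exp(-t^2/2), so that derivatives remain of the form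
    [gauss_poly]. *)
Definition gauss_deriv (p : {poly R}) : {poly R} := p^`() - 'X * p.

Lemma is_derive_gauss (t : R) :
  is_derive t (1 : R) (fun t : R => expR (- (t ^+ 2 / 2))) (- t * expR (- (t ^+ 2 / 2))).
Proof.
rewrite mulrC; apply: (@is_derive1_comp R expR (fun t => - (t ^+ 2 / 2))).
have -> : (fun t : R => - (t ^+ 2 / 2)) = horner (- (2^-1 *: 'X^2)).
  by apply/funext => u; rewrite hornerN hornerZ hornerXn mulrC.
apply: is_derive_eq; rewrite derivN derivZ derivXn /= !hornerE.
by field.
Qed.

Lemma is_derive_gauss_poly (p : {poly R}) (t : R) :
  is_derive t (1 : R) (gauss_poly p) (gauss_poly (gauss_deriv p) t).
Proof.
have dp := is_derive_poly p t; have dg := is_derive_gauss t.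
apply: (is_derive_eq (is_deriveM dp dg)).
by rewrite /gauss_poly /gauss_deriv ?(hornerM, hornerD, hornerN, hornerZ, hornerX) /GRing.scale/=; ring.
Qed.

Definition hermite_fun k := gauss_poly (hermite k).

Lemma hermite_fun_ode k (t : R) :
  - gauss_poly (gauss_deriv (gauss_deriv (hermite k))) t + t ^+ 2 * hermite_fun k t
  = (2 * k + 1)%:R * hermite_fun k t.
Proof.
rewrite /hermite_fun /gauss_poly /gauss_deriv derivB derivM derivX hermite_odeE ?(hornerM, hornerD, hornerN, hornerZ, hornerX, hornerC).
rewrite natrD natrM. ring.
Qed.

(** The creation and annihilation relations together determine the ratio of the norms of consecutive
    Hermite functions, see [hermite_tensor_norm_succ]. *)
Lemma hermite_fun_create k (t : R) :
  hermite_fun k.+1 t = t * hermite_fun k t - gauss_poly (gauss_deriv (hermite k)) t.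
Proof. rewrite /hermite_fun /gauss_poly /gauss_deriv hermiteS ?(hornerM, hornerD, hornerN, hornerZ, hornerX). ring. Qed.

Lemma hermite_fun_annihilate k (t : R) :
  (2 * k.+1)%:R * hermite_fun k t =
  t * hermite_fun k.+1 t + gauss_poly (gauss_deriv (hermite k.+1)) t.
Proof. rewrite /hermite_fun /gauss_poly /gauss_deriv deriv_hermite ?(hornerM, hornerD, hornerN, hornerZ, hornerX). ring. Qed.

(** Induction on the polynomial: in 'X q + c, half of the exponent serves q and the other half
    absorbs |t| <= 1 + t^2. *)
Lemma poly_le_exp (p : {poly R}) (a : R) : 0 < a ->
  exists2 C, 0 <= C & forall t, `|p.[t]| <= C * expR (a * t ^+ 2).
Proof.
elim/poly_ind: p a => [|p c IH] a a0.
  by exists 0 => // t; rewrite horner0 normr0 mul0r.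
have a20 : 0 < a / 2 by rewrite divr_gt0.
have [C C0 HC] := IH _ a20; pose D := 1 + (a / 2)^-1.
have D0 : 0 <= D by rewrite addr_ge0// invr_ge0 ltW.
exists (C * D + `|c|); first by rewrite addr_ge0// mulr_ge0.
move=> t; rewrite hornerMXaddC (le_trans (ler_normD _ _))// mulrDl lerD//; last first.
  by rewrite ler_peMr// -expR0 ler_expR mulr_ge0 ?sqr_ge0// ltW.
have tD : `|t| <= D * expR (a / 2 * t ^+ 2).
  have a2V : 0 <= (a / 2)^-1 by rewrite invr_ge0 ltW.
  apply: (@le_trans _ _ (D * (1 + a / 2 * t ^+ 2))); last by rewrite ler_wpM2l// expR_ge1Dx.
  have : `|t| <= 1 + t ^+ 2.
    rewrite -[t ^+ 2]real_normK ?num_real//; have := sqr_ge0 (`|t| - 1).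
    have := normr_ge0 t; nra.
  move=> /le_trans; apply; have := sqr_ge0 t; rewrite /D mulrDl mul1r mulrDr mulr1 mulKf ?gt_eqF//; nra.
rewrite normrM (le_trans (ler_pM _ _ (HC t) tD))// mulrACA -expRD -mulrDl -splitr//.
Qed.

End hermite.

(** * A class of smooth functions on the line, and cutoffs of Hermite functions *)

Section smooth_functions.
Context {R : realType}.

(** A syntactic class stable under derivation: existence of derivatives of all orders reduces to a
    single derivative, computed constructor by constructor. *)
Inductive smooth1 : (R -> R) -> Prop :=
| smooth1_poly p : smooth1 (horner p)
| smooth1_gauss : smooth1 (fun t => expR (- (t ^+ 2 / 2)))
| smooth1_flat c j : smooth1 (fun t => flat j (1 - c * t ^+ 2))
| smooth1_add f g : smooth1 f -> smooth1 g -> smooth1 (f + g)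
| smooth1_mul f g : smooth1 f -> smooth1 g -> smooth1 (f * g).

Lemma is_derive_flat_comp (c : R) (j : nat) (t : R) :
  is_derive t (1 : R) (fun t => flat j (1 - c * t ^+ 2))
    ((- j%:R * flat j.+1 (1 - c * t ^+ 2) + flat j.+2 (1 - c * t ^+ 2)) * (- (2 * c) * t)).
Proof.
have dp : is_derive t (1 : R) (fun t => 1 - c * t ^+ 2) (- (2 * c) * t).
  have -> : (fun t : R => 1 - c * t ^+ 2) = horner (1 - c *: 'X^2).
    by apply/funext => u; rewrite hornerD hornerN hornerZ hornerXn hornerC.
  apply: is_derive_eq.
  by rewrite derivB derivZ derivXn (_ : 1 = 1%:P)// derivC sub0r /= !hornerE; ring.
exact: (@is_derive1_comp R (flat j) (fun t => 1 - c * t ^+ 2) t _ _ (is_derive_flat _ _) dp).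
Qed.

Lemma smooth1_derive f : smooth1 f ->
  exists2 f', smooth1 f' & forall t : R, is_derive t (1 : R) f (f' t).
Proof.
elim => [p||c j|{}f g sf [f' sf' df] sg [g' sg' dg]|{}f g sf [f' sf' df] sg [g' sg' dg]].
- by exists (horner p^`()); [exact: smooth1_poly|move=> t; exact: is_derive_poly].
- exists (horner (- 'X) * (fun t => expR (- (t ^+ 2 / 2)))).
    by apply: smooth1_mul; [exact: smooth1_poly|exact: smooth1_gauss].
  by move=> t; apply: is_derive_eq (is_derive_gauss t) _; rewrite fctE hornerN hornerX.
- exists ((horner (- j%:R)%:P * (fun t => flat j.+1 (1 - c * t ^+ 2)) +
           (fun t => flat j.+2 (1 - c * t ^+ 2))) * horner (- (2 * c) *: 'X)).
    apply: smooth1_mul; last exact: smooth1_poly.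
    apply: smooth1_add; last exact: smooth1_flat.
    by apply: smooth1_mul; [exact: smooth1_poly|exact: smooth1_flat].
  move=> t; apply: is_derive_eq (is_derive_flat_comp c j t) _.
  by rewrite !fctE hornerC hornerZ hornerX.
- by exists (f' + g'); [exact: smooth1_add|move=> t; exact: is_deriveD].
- exists (f * g' + g * f'); first by apply: smooth1_add; exact: smooth1_mul.
  by move=> t; exact: is_deriveM.
Qed.

Lemma is_derive_continuous (f f' : R -> R) :
  (forall t : R, is_derive t (1 : R) f (f' t)) -> continuous f.
Proof. by move=> df t; apply/differentiable_continuous/derivable1_diffP; case: (df t). Qed.

Lemma smooth1_continuous f : smooth1 f -> continuous f.
Proof. by move=> /smooth1_derive[f' _]; exact: is_derive_continuous. Qed.

Lemma smooth1_measurable f : smooth1 f -> measurable_fun setT f.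
Proof. by move=> /smooth1_continuous; exact: continuous_measurable_fun. Qed.

Lemma smooth1_scale c f : smooth1 f -> smooth1 (fun t => c * f t).
Proof.
move=> sf; have -> : (fun t => c * f t) = horner c%:P * f.
  by apply/funext => t; rewrite fctE hornerC.
by apply: smooth1_mul => //; exact: smooth1_poly.
Qed.

Lemma smooth1_gauss_poly p : smooth1 (gauss_poly p).
Proof. by apply: smooth1_mul; [exact: smooth1_poly|exact: smooth1_gauss]. Qed.

Lemma gauss_poly_le (p : {poly R}) :
  exists2 C, 0 <= C & forall t, `|gauss_poly p t| <= C * expR (- (t ^+ 2 / 4)).
Proof.
have q0 : 0 < (4^-1 : R) by rewrite invr_gt0.
have [C C0 HC] := poly_le_exp p q0; exists C => // t.
rewrite /gauss_poly normrM (ger0_norm (expR_ge0 _)).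
apply: le_trans (ler_wpM2r (expR_ge0 _) (HC t)) _.
by rewrite -mulrA -expRD (_ : _ + _ = - (t ^+ 2 / 4))//; field.
Qed.

(** The inverse square of the cutoff radius N + 1: flat j (1 - scl N t^2) vanishes once |t| >= N +
    1. *)
Let scl (N : nat) : R := (N.+1%:R ^+ 2)^-1.

Let scl_ge0 N : 0 <= scl N. Proof. by rewrite invr_ge0 exprn_ge0. Qed.

Let scl_le1 N : scl N <= 1.
Proof. by rewrite invf_le1 ?exprn_gt0 ?ltr0n// exprn_ege1// ler1n. Qed.

Let cvg_scl : scl N @[N --> \oo] --> 0.
Proof.
have H : (N.+1%:R^-1 : R) @[N --> \oo] --> 0 by exact: cvg_harmonic.
have -> : scl = (fun N => N.+1%:R^-1 * N.+1%:R^-1) by apply/funext => N; rewrite /scl expr2 invfM.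
have H2 := cvgM H H; rewrite mulr0 in H2; exact: H2.
Qed.

(** Pointwise convergence under a Gaussian bound uniform in N, the input of dominated
    convergence. *)
Let dominated_cvg_to (F : nat -> R -> R) (G : R -> R) := exists2 C : R, 0 <= C &
  (forall N t, `|F N t| <= C * expR (- (t ^+ 2 / 4))) /\
  (forall t, F N t @[N --> \oo] --> G t).

Let dct_add F G F' G' : dominated_cvg_to F G -> dominated_cvg_to F' G' ->
  dominated_cvg_to (fun N t => F N t + F' N t) (fun t => G t + G' t).
Proof.
move=> [C C0 [FC FG]] [C' C0' [FC' FG']]; exists (C + C'); first exact: addr_ge0.
split=> [N t|t]; last exact: cvgD.
by rewrite mulrDl (le_trans (ler_normD _ _))// lerD.
Qed.

Let dct_scale a F G : dominated_cvg_to F G ->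
  dominated_cvg_to (fun N t => a * F N t) (fun t => a * G t).
Proof.
move=> [C C0 [FC FG]]; exists (`|a| * C); first exact: mulr_ge0.
split=> [N t|t]; last exact: cvgMr.
by rewrite normrM -mulrA ler_wpM2l.
Qed.

Let F c j (t : R) : R := flat j (1 - c * t ^+ 2).

Let F_le c j t : 0 <= c -> `|F c j t| <= (j.+1)`!%:R.
Proof.
move=> c0; rewrite ger0_norm ?flat_ge0// flat_le_fact// gerBl.
by rewrite mulr_ge0// sqr_ge0.
Qed.

Let cvg_F j t : F (scl N) j t @[N --> \oo] --> flat j 1.
Proof.
have cf : continuous (@flat R j) by exact: is_derive_continuous (is_derive_flat j).
have : 1 - scl N * t ^+ 2 @[N --> \oo] --> 1 - 0 * t ^+ 2.
  by apply: cvgB; [exact: cvg_cst|apply: cvgMl; exact: cvg_scl].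
by rewrite mul0r subr0 => /(continuous_cvg _ (cf 1)).
Qed.

Let dct_base0 j q : dominated_cvg_to (fun N t => F (scl N) j t * gauss_poly q t)
  (fun t => flat j 1 * gauss_poly q t).
Proof.
have [C C0 HC] := gauss_poly_le q; exists ((j.+1)`!%:R * C); first exact: mulr_ge0.
split=> [N t|t]; last by apply: cvgMl; exact: cvg_F.
by rewrite normrM -mulrA ler_pM// F_le.
Qed.

(** Each derivative that falls on the cutoff brings a factor [scl N], which tends to 0; such terms
    disappear in the limit. *)
Let dct_base m j q : (0 < m)%N ->
  dominated_cvg_to (fun N t => scl N ^+ m * (F (scl N) j t * gauss_poly q t))
  (fun t => 0).
Proof.
move=> m0; have [C C0 [FC FG]] := dct_base0 j q; exists C => //; split=> [N t|t].
  apply: le_trans (FC N t); rewrite normrM ler_piMl// ger0_norm ?exprn_ge0//.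
  by rewrite exprn_ile1.
rewrite (_ : 0 = 0 ^+ m * (flat j 1 * gauss_poly q t)); last by rewrite expr0n gtn_eqF ?mul0r.
apply: cvgM => //.
exact: (continuous_cvg _ (@exprn_continuous R m 0) cvg_scl).
Qed.

Lemma is_derive_flat_gauss (c : R) j (q : {poly R}) (t : R) :
  is_derive t (1 : R) (fun t => flat j (1 - c * t ^+ 2) * gauss_poly q t)
    ((- j%:R * flat j.+1 (1 - c * t ^+ 2) + flat j.+2 (1 - c * t ^+ 2))
       * (- (2 * c) * gauss_poly ('X * q) t)
     + flat j (1 - c * t ^+ 2) * gauss_poly (gauss_deriv q) t).
Proof.
apply: (is_derive_eq (is_deriveM (is_derive_flat_comp c j t) (is_derive_gauss_poly q t))).
by rewrite /GRing.scale/= /gauss_poly hornerM hornerX; ring.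
Qed.

Lemma hermite_cutoff k : exists (f f1 f2 : nat -> R -> R) (C : R),
  [/\ [/\ forall N, smooth1 (f N),
     forall N (t : R), is_derive t (1 : R) (f N) (f1 N t) &
     forall N (t : R), is_derive t (1 : R) (f1 N) (f2 N t)],
     [/\ 0 <= C, forall N t, N.+1%:R < `|t| -> f N t = 0,
     forall N t, `|f N t| <= C * expR (- (t ^+ 2 / 4)) &
     forall N t, `|- f2 N t + t ^+ 2 * f N t| <= C * expR (- (t ^+ 2 / 4))],
     forall t, f N t @[N --> \oo] --> hermite_fun k t &
     forall t, - f2 N t + t ^+ 2 * f N t @[N --> \oo] -->
       (2 * k + 1)%:R * hermite_fun k t].
Proof.
pose p : {poly R} := hermite k; pose e : R := expR 1; pose D := @gauss_deriv R.
(* As N grows the cutoff tends to flat 0 1 = exp(-1); the factor e normalizes this limit to 1. *)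
have eflat : e * flat 0 1 = 1.
  by rewrite /flat ltr01 expr0 invr1 mul1r /e -expRD subrr expR0.
pose f N t := e * (F (scl N) 0 t * gauss_poly p t).
pose f1 N t := e * (- 2 * (scl N * (F (scl N) 2 t * gauss_poly ('X * p) t))
               + F (scl N) 0 t * gauss_poly (D p) t).
pose f2 N t := e * (8 * (- scl N ^+ 2 * (F (scl N) 3 t * gauss_poly ('X * ('X * p)) t))
   + 4 * (scl N ^+ 2 * (F (scl N) 4 t * gauss_poly ('X * ('X * p)) t))
   + (- 2) * (scl N ^+ 1 * (F (scl N) 2 t * gauss_poly (D ('X * p)) t))
   + (- 2) * (scl N ^+ 1 * (F (scl N) 2 t * gauss_poly ('X * D p) t))
   + F (scl N) 0 t * gauss_poly (D (D p)) t).
(* -f2 + t^2 f regrouped into terms covered by [dct_base] and [dct_base0]. The two without a factor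
   [scl N] survive and give the Hermite equation. *)
pose kap N t := (- e * 8) * (- 1 * (scl N ^+ 2 * (F (scl N) 3 t * gauss_poly ('X * ('X * p)) t)))
   + (- e * 4) * (scl N ^+ 2 * (F (scl N) 4 t * gauss_poly ('X * ('X * p)) t))
   + (e * 2) * (scl N ^+ 1 * (F (scl N) 2 t * gauss_poly (D ('X * p)) t))
   + (e * 2) * (scl N ^+ 1 * (F (scl N) 2 t * gauss_poly ('X * D p) t))
   + (- e) * (F (scl N) 0 t * gauss_poly (D (D p)) t)
   + e * (F (scl N) 0 t * gauss_poly ('X * ('X * p)) t).
have kapE N t : - f2 N t + t ^+ 2 * f N t = kap N t.
  rewrite /f2 /f /kap [gauss_poly ('X * ('X * p)) t]/gauss_poly !hornerM hornerX.
  by rewrite /gauss_poly; ring.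
have [C1 C10 [C1f C1c]] := dct_scale e (dct_base0 0 p).
have [C2 C20 [C2f C2c]] : dominated_cvg_to kap (fun t => (- e * 8) * (- 1 * 0)
   + (- e * 4) * 0 + (e * 2) * 0 + (e * 2) * 0
   + (- e) * (flat 0 1 * gauss_poly (D (D p)) t)
   + e * (flat 0 1 * gauss_poly ('X * ('X * p)) t)).
  by do 5 ?apply: dct_add; repeat apply: dct_scale; (exact: dct_base || exact: dct_base0).
exists f, f1, f2, (C1 + C2); split.
- split.
  + move=> N; apply: smooth1_scale; apply: smooth1_mul; first exact: smooth1_flat.
    exact: smooth1_gauss_poly.
  + move=> N t; apply: (is_derive_eq (is_deriveZ e (is_derive_flat_gauss (scl N) 0 p t))).
    by rewrite /f1 /GRing.scale/= /F; ring.
  + move=> N t; have d2 := is_derive_flat_gauss (scl N) 2 ('X * p) t.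
    have d0 := is_derive_flat_gauss (scl N) 0 (D p) t.
    have := is_deriveZ e (is_deriveD (is_deriveZ (- 2) (is_deriveZ (scl N) d2)) d0).
    move/is_derive_eq; apply.
    by rewrite /f2 /GRing.scale/= /F; ring.
- split.
  + exact: addr_ge0.
  + move=> N t Nt; rewrite /f /F /flat ltNge ifF ?mul0r ?mulr0//.
    apply/negbTE; rewrite negbK subr_le0 /scl mulrC ler_pdivlMr ?exprn_gt0// mul1r.
    by rewrite -[t ^+ 2]real_normK ?num_real// lerXn2r ?nnegrE// ltW.
  + move=> N t; apply: le_trans (C1f N t) _.
    by rewrite ler_wpM2r ?expR_ge0// lerDl.
  + move=> N t; rewrite kapE; apply: le_trans (C2f N t) _.
    by rewrite ler_wpM2r ?expR_ge0// lerDr.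
- by move=> t; have := C1c t; rewrite mulrA eflat mul1r.
- move=> t; under eq_fun do rewrite kapE.
  have := C2c t; rewrite !mulr0 !add0r mulNr !(mulrA e) eflat !mul1r -hermite_fun_ode.
  by rewrite (_ : gauss_poly ('X * _) t = t ^+ 2 * hermite_fun k t)// /hermite_fun
    /gauss_poly !hornerM hornerX; ring.
Qed.

End smooth_functions.

(** * Lebesgue measure on R^n x R^p *)

Section measure_preserving.
Context {R : realType}.

Definition preserves d (T : measurableType d) (m : set T -> \bar R) (phi : T -> T) :=
  measurable_fun setT phi /\
  forall A, measurable A -> m (phi @^-1` A) = m A.

(** Lebesgue measure is determined by its values on half-open intervals, whose length is unchanged
    by a translation. *)
Lemma preserves_lebesgue_shift (a : R) : preserves (@lebesgue_measure R) (fun t => t + a).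
Proof.
have ms : measurable_fun setT (fun t : R => t + a) by exact: measurable_funD.
split=> // A mA.
have ms' : measurable_fun (setT : set (measurableTypeR R))
    (fun t : measurableTypeR R => (t + a : R) : measurableTypeR R) by exact: ms.
pose m' := measure_function_pushforward__canonical__measure_function_Measure
     (@lebesgue_measure R) ms'.
apply/esym/(@lebesgue_measure_unique R m') => // X [[b c] /= bc <-].
rewrite /pushforward.
have -> : (fun t => t + a) @^-1` `]b, c]%classic = `]b - a, c - a]%classic.
  apply/seteqP; split => t; rewrite /= !in_itv/= => /andP[? ?]; apply/andP; split; lra.
by rewrite !lebesgue_measure_itv/= !lte_fin ltrD2r -!EFinB opprD addrACA subrr addr0.
Qed.

Lemma preserves_prod d1 d2 (T1 : measurableType d1) (T2 : measurableType d2)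
    (m1 : {sigma_finite_measure set T1 -> \bar R})
    (m2 : {sigma_finite_measure set T2 -> \bar R}) f g :
  preserves m1 f -> preserves m2 g ->
  preserves (m1 \x m2)%E (fun z => (f z.1, g z.2)).
Proof.
move=> [mf pf] [mg pg].
have mfg : measurable_fun setT (fun z : T1 * T2 => (f z.1, g z.2)).
  apply/measurable_fun_pairP; split; first exact: (measurableT_comp mf measurable_fst).
  exact: (measurableT_comp mg measurable_snd).
split=> // A mA.
pose m' := measure_function_pushforward__canonical__measure_function_Measure
     (m1 \x m2)%E mfg.
apply/esym/(@product_measure_unique _ _ _ _ _ m1 m2 m') => // B C mB mC.
rewrite /= /pushforward.
have -> : (fun z : T1 * T2 => (f z.1, g z.2)) @^-1` (B `*` C) = (f @^-1` B) `*` (g @^-1` C) by [].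
have mpf : measurable (f @^-1` B) by rewrite -[X in measurable X]setTI; exact: mf.
have mpg : measurable (g @^-1` C) by rewrite -[X in measurable X]setTI; exact: mg.
rewrite product_measure1E//; congr (_ * _)%E; [exact: pf|exact: pg].
Qed.

Lemma preserves_integral d (T : measurableType d) (m : {measure set T -> \bar R})
    (phi : T -> T) (F : T -> R) : preserves m phi ->
  m.-integrable setT (EFin \o F) ->
  m.-integrable setT (EFin \o (F \o phi)) /\
  \int[m]_x F (phi x) = \int[m]_x F x.
Proof.
move=> [mphi pm] iF.
have mF : measurable_fun setT (EFin \o F) by case/integrableP: iF.
have mFp : measurable_fun setT (EFin \o F \o phi) by exact: measurableT_comp.
have E (G : T -> \bar R) : measurable_fun setT G -> (forall x, 0 <= G x)%E ->
    (\int[m]_x G (phi x) = \int[m]_x G x)%E.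
  move=> mG G0; have := @ge0_integral_pushforward _ _ _ _ R phi mphi m setT G measurableT mG.
  rewrite preimage_setT => <-; last by move=> x _; exact: G0.
  by apply: eq_measure_integral => A mA _; rewrite -pm.
have iFp : m.-integrable setT (EFin \o (F \o phi)).
  apply/integrableP; split => //; case/integrableP: iF => _.
  by rewrite -(E (fun x => `|(EFin \o F) x|%E))//; exact: measurableT_comp.
split=> //; rewrite /Rintegral; congr fine.
have := @integral_pushforward _ _ _ _ R phi mphi m setT (EFin \o F) mF.
rewrite preimage_setT => /(_ iFp measurableT) <-.
by apply: eq_measure_integral => A mA _; rewrite -pm.
Qed.

Lemma colvec_shift n (v : 'cV[R]_n.+1) (z : R * 'cV[R]_n) :
  colvec_cons z + v =
  colvec_cons (z.1 + (colvec_uncons v).1, z.2 + (colvec_uncons v).2).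
Proof.
apply/matrixP => i j; rewrite [j]ord1 mxE; case: (unliftP ord0 i) => [k ->|->].
  by rewrite !colvec_consS /colvec_uncons !mxE.
by rewrite !colvec_cons0.
Qed.

(** Induction on the dimension: through [colvec_cons] a translation is a product of translations. *)
Lemma preserves_colvec_shift n (v : 'cV[R]_n) :
  preserves (lebesgue_colvec R n) (fun x => x + v).
Proof.
elim: n v => [|n IH] v.
  have -> : (fun x : 'cV[R]_0 => x + v) = id by apply/funext => x; apply/matrixP => -[].
  by split => //; exact: measurable_id.
have ms : measurable_fun setT (fun x : 'cV[R]_n.+1 => x + v).
  apply: measurable_fun_matrix => i j; under eq_fun do rewrite mxE.
  by apply: measurable_funD => //; exact: measurable_fun_entry.
split => // A mA.
rewrite [LHS]/= [RHS]/= /lebesgue_colvec_step /pushforward.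
have mE : measurable (@colvec_cons R n @^-1` A).
  by rewrite -[X in measurable X]setTI; exact: measurable_colvec_cons.
have [_ /(_ _ mE)] := preserves_prod (preserves_lebesgue_shift (colvec_uncons v).1) (IH (colvec_uncons v).2).
by move=> <-; congr (_ _); apply/seteqP; split => z /=; rewrite colvec_shift.
Qed.

Lemma preserves_lebesgue_xy n p (v : 'cV[R]_n * 'cV[R]_p) :
  preserves (@lebesgue_xy R n p) (fun x => x + v).
Proof. exact: (preserves_prod (preserves_colvec_shift v.1) (preserves_colvec_shift v.2)). Qed.

Lemma lebesgue_colvec_gt0 n : (0 < lebesgue_colvec R n setT)%E.
Proof.
elim: n => [|n IH]; first by rewrite /= diracT lte01.
rewrite /= /lebesgue_colvec_step /pushforward preimage_setT -setXTT.
rewrite product_measure1E//= mule_gt0//.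
by rewrite (_ : lebesgue_measure _ = +oo%E)// -[LHS]/(lebesgue_measure setT) -set_itvNyy lebesgue_measure_itv.
Qed.

Lemma lebesgue_xy_gt0 n p : (0 < @lebesgue_xy R n p setT)%E.
Proof.
rewrite (_ : lebesgue_xy _ _ _ = (lebesgue_colvec R n \x lebesgue_colvec R p)%E (setT `*` setT)).
  by rewrite product_measure1E// mule_gt0// lebesgue_colvec_gt0.
by rewrite setXTT.
Qed.

Lemma integral_gauss_lty (a : R) : 0 < a ->
  (\int[@lebesgue_measure R]_t (expR (- (a * t ^+ 2)))%:E < +oo)%E.
Proof.
(* The standard deviation for which exp(-a t^2) is proportional to the centered normal density. *)
move=> a0; pose s := Num.sqrt (2 * a)^-1.
have a20 : 0 < (2 * a)^-1 by rewrite invr_gt0 mulr_gt0.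
have s0 : s != 0 by rewrite gt_eqF// sqrtr_gt0.
have p0 : 0 < normal_peak s.
  by rewrite /normal_peak invr_gt0 sqrtr_gt0 pmulrn_rgt0// mulr_gt0 ?pi_gt0// exprn_gt0// sqrtr_gt0.
have E t : (expR (- (a * t ^+ 2)))%:E = ((normal_peak s)^-1%:E * (normal_pdf 0 s t)%:E)%E.
  rewrite normal_pdfE// -EFinM mulKf ?gt_eqF// /normal_fun subr0 sqr_sqrtr ?(ltW a20)//.
  congr ((expR _)%:E); rewrite mulNr; congr (- _).
  by field; rewrite gt_eqF.
under eq_integral do rewrite E.
rewrite ge0_integralZl//.
- by rewrite integral_normal_pdf mule1 ltry.
- by apply/measurable_EFinP; exact: measurable_normal_pdf.
- by move=> t _; rewrite lee_fin normal_pdf_ge0.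
- by rewrite lee_fin invr_ge0 ltW.
Qed.

Definition sqnorm n (v : 'cV[R]_n) : R := \sum_i v i 0 ^+ 2.

Lemma measurable_sqnorm n : measurable_fun setT (@sqnorm n).
Proof.
apply: measurable_sum => i; apply: measurable_funX; exact: measurable_fun_entry.
Qed.

Let measurable_gauss n a : measurable_fun setT (fun v : 'cV[R]_n => (expR (- (a * sqnorm v)))%:E).
Proof.
apply/measurable_EFinP; apply: measurableT_comp => //; apply: measurableT_comp => //.
by apply: measurable_funM => //; exact: measurable_sqnorm.
Qed.

Let integral_prod_lty d1 d2 (T1 : measurableType d1) (T2 : measurableType d2)
    (m1 : {sigma_finite_measure set T1 -> \bar R})
    (m2 : {sigma_finite_measure set T2 -> \bar R}) (f : T1 -> R) (g : T2 -> R) :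
  measurable_fun setT f -> measurable_fun setT g ->
  (forall x, 0 <= f x) -> (forall x, 0 <= g x) ->
  (\int[m1]_x (f x)%:E < +oo)%E -> (\int[m2]_x (g x)%:E < +oo)%E ->
  (\int[m1 \x m2]_z (f z.1 * g z.2)%:E < +oo)%E.
Proof.
move=> mf mg f0 g0 fi gi; rewrite fubini_tonelli1; last 2 first.
- apply/measurable_EFinP; apply: measurable_funM; apply: measurableT_comp => //.
- by move=> z; rewrite lee_fin mulr_ge0.
have gI0 : (0 <= \int[m2]_x (g x)%:E)%E by apply: integral_ge0 => x _; rewrite lee_fin.
have E x : fubini_F m2 (fun z => (f z.1 * g z.2)%:E) x = ((f x)%:E * \int[m2]_x (g x)%:E)%E.
  rewrite /fubini_F /=; under eq_integral do rewrite EFinM.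
  rewrite ge0_integralZl//; last 2 first.
  - by move=> y _; rewrite lee_fin.
  - by rewrite lee_fin.
  exact/measurable_EFinP.
under eq_integral do rewrite E.
rewrite ge0_integralZr//; last 2 first.
- exact/measurable_EFinP.
- by move=> y _; rewrite lee_fin.
by rewrite lte_mul_pinfty// ?ge0_fin_numE//; apply: integral_ge0 => x _; rewrite lee_fin.
Qed.

Lemma integral_gauss_colvec_lty n a : 0 < a ->
  (\int[lebesgue_colvec R n]_v (expR (- (a * sqnorm v)))%:E < +oo)%E.
Proof.
move=> a0; elim: n => [|n IH].
  under eq_integral do rewrite /sqnorm big_ord0.
  by rewrite integral_dirac// diracT mul1e ltry.
pose phi := @colvec_cons R n.
pose m' := measure_function_pushforward__canonical__measure_function_Measure
     (@lebesgue_measure R \x lebesgue_colvec R n)%E (@measurable_colvec_cons R n).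
rewrite (_ : (\int[_]_v _)%E = (\int[m']_v (expR (- (a * sqnorm v)))%:E)%E)//.
rewrite ge0_integral_pushforward//; last 2 first.
- exact: measurable_colvec_cons.
- exact: measurable_gauss.
rewrite preimage_setT.
have E z : ((fun v => (expR (- (a * sqnorm v)))%:E) \o @colvec_cons R n) z =
    (expR (- (a * z.1 ^+ 2)) * expR (- (a * sqnorm z.2)))%:E.
  rewrite /= -expRD -opprD -mulrDr /sqnorm big_ord_recl colvec_cons0.
  by congr ((expR (- (a * (_ + _))))%:E); apply: eq_bigr => i _; rewrite colvec_consS.
under eq_integral do rewrite E.
apply: (@integral_prod_lty _ _ _ _ (@lebesgue_measure R) (lebesgue_colvec R n)
  (fun t : R => expR (- (a * t ^+ 2))) (fun v => expR (- (a * sqnorm v)))) => //.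
- apply: measurableT_comp => //; apply: measurableT_comp => //.
  by apply: measurable_funM => //; exact: measurable_funX.
- by apply/measurable_EFinP; exact: measurable_gauss.
- exact: integral_gauss_lty.
Qed.

Definition sqnorm_xy n p (x : 'cV[R]_n * 'cV[R]_p) : R := sqnorm x.1 + sqnorm x.2.

Lemma measurable_gauss_xy n p a :
  measurable_fun setT (fun x : 'cV[R]_n * 'cV[R]_p => expR (- (a * sqnorm_xy x))).
Proof.
apply: measurableT_comp => //; apply: measurableT_comp => //.
apply: measurable_funM => //; apply: measurable_funD;
  by apply: measurableT_comp => //; exact: measurable_sqnorm.
Qed.

Lemma integrable_gauss_xy n p a : 0 < a ->
  (@lebesgue_xy R n p).-integrable setT (EFin \o (fun x => expR (- (a * sqnorm_xy x)))).
Proof.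
move=> a0; apply/integrableP; split; first by apply/measurable_EFinP; exact: measurable_gauss_xy.
under eq_integral do rewrite /= ger0_norm ?expR_ge0// /sqnorm_xy mulrDr opprD expRD.
apply: (integral_prod_lty (f := fun v => expR (- (a * sqnorm v)))
   (g := fun v => expR (- (a * sqnorm v)))) => //.
- by apply/measurable_EFinP; exact: measurable_gauss.
- by apply/measurable_EFinP; exact: measurable_gauss.
- exact: integral_gauss_colvec_lty.
- exact: integral_gauss_colvec_lty.
Qed.

End measure_preserving.

(** * Products of functions of linear coordinates *)

Section tensor.
Context {R : realType} {V : normedModType R} {I : finType}.
Variable l : I -> V -> R.

Definition tensor (phi : I -> R -> R) (x : V) : R := \prod_i phi i (l i x).

Definition subst (phi : I -> R -> R) (i : I) (f : R -> R) : I -> R -> R :=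
  fun j => if j == i then f else phi j.

Lemma tensor_subst phi i f x :
  tensor (subst phi i f) x = f (l i x) * \prod_(j | j != i) phi j (l j x).
Proof.
rewrite /tensor (bigD1 i)//= /subst eqxx; congr (_ * _).
by apply: eq_bigr => j /negbTE ->.
Qed.

Lemma tensorD1 phi i x :
  tensor phi x = phi i (l i x) * \prod_(j | j != i) phi j (l j x).
Proof. by rewrite /tensor (bigD1 i). Qed.

Lemma subst_same phi i f g : subst (subst phi i f) i g = subst phi i g.
Proof. by apply/funext => j; rewrite /subst; case: eqP. Qed.

Hypothesis l_lin : forall i a x y, l i (a *: x + y) = a * l i x + l i y.
Hypothesis l_cont : forall i, continuous (l i).

(** The difference quotient of f o l_i along v is that of t |-> f(t l_i(v) + l_i(x)) at 0, which
    reduces the claim to the chain rule in one variable. *)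
Lemma is_derive_comp_lin i (f : R -> R) (df : R) (x v : V) :
  is_derive (l i x) (1 : R) f df -> is_derive x v (f \o l i) (l i v * df).
Proof.
move=> dfx.
have E : (fun h : R => h^-1 *: (((f \o l i) \o shift x) (h *: v) - (f \o l i) x)) =
   (fun h : R => h^-1 *: (((fun t => f (t * l i v + l i x)) \o shift 0) h%:A -
       (fun t => f (t * l i v + l i x)) 0)).
  apply/funext => h /=; rewrite l_lin addr0 mul0r add0r.
  by rewrite -[h%:A]/(h * 1) mulr1.
have daff : is_derive (0 : R) (1 : R) (fun t : R => t * l i v + l i x) (l i v).
  have -> : (fun t : R => t * l i v + l i x) = horner (l i v *: 'X + (l i x)%:P).
    by apply/funext => t; rewrite hornerD hornerZ hornerX hornerC mulrC.
  apply: is_derive_eq; rewrite derivD derivZ derivX derivC addr0 hornerZ.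
  by rewrite (_ : 1 = 1%:P)// hornerC mulr1.
have dfx' : is_derive (0 * l i v + l i x) (1 : R) f df by rewrite mul0r add0r.
have [d1 d2] := @is_derive1_comp R f (fun t => t * l i v + l i x) 0 _ _ dfx' daff.
by rewrite mulrC; apply: DeriveDef; [rewrite /derivable E|rewrite /derive E].
Qed.

Lemma is_derive_prod_seq (F : I -> V -> R) (dF : I -> R) (s : seq I) (x v : V) :
  uniq s -> (forall i, is_derive x v (F i) (dF i)) ->
  is_derive x v (fun y => \prod_(i <- s) F i y)
    (\sum_(i <- s) dF i * \prod_(j <- s | j != i) F j x).
Proof.
move=> + dFx; elim: s => [_|i s IH /= /andP[si us]].
  under eq_fun do rewrite big_nil.
  by rewrite big_nil; exact: is_derive_cst.
under eq_fun do rewrite big_cons.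
have := is_deriveM (dFx i) (IH us); move/is_derive_eq; apply.
rewrite big_cons [in RHS]big_cons eqxx /= addrC; congr (_ + _).
  rewrite /GRing.scale/= mulrC; congr (_ * _).
  rewrite big_seq [in RHS]big_seq_cond; apply: eq_bigl => j.
  by case js: (j \in s) => //=; apply/esym/eqP => ji; rewrite -ji js in si.
rewrite /GRing.scale/= mulr_sumr big_seq [RHS]big_seq; apply: eq_bigr => j js.
rewrite big_cons ifT; last by apply: contraNneq si => ->.
by rewrite mulrCA.
Qed.

Lemma is_derive_tensor (phi dphi : I -> R -> R) (x v : V) :
  (forall i (t : R), is_derive t (1 : R) (phi i) (dphi i t)) ->
  is_derive x v (tensor phi) (\sum_i l i v * tensor (subst phi i (dphi i)) x).
Proof.
move=> dphi_; have := @is_derive_prod_seq (fun i => phi i \o l i)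
  (fun i => l i v * dphi i (l i x)) (index_enum I) x v (index_enum_uniq I).
move=> /(_ (fun i => is_derive_comp_lin v (dphi_ i _))) /is_derive_eq; apply.
by apply: eq_bigr => i _; rewrite tensor_subst -mulrA.
Qed.

(** For j = i the outer substitution overwrites the inner one: the factor already differentiated
    once becomes [d2 i]. *)
Lemma is_derive2_tensor (phi d1 d2 : I -> R -> R) (x v : V) :
  (forall i (t : R), is_derive t (1 : R) (phi i) (d1 i t)) ->
  (forall i (t : R), is_derive t (1 : R) (d1 i) (d2 i t)) ->
  is_derive x v (fun y => \sum_i l i v * tensor (subst phi i (d1 i)) y)
   (\sum_i \sum_j l i v * l j v *
      tensor (subst (subst phi i (d1 i)) j (if j == i then d2 i else d1 j)) x).
Proof.
move=> D1 D2.
have D i : is_derive x v (tensor (subst phi i (d1 i)))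
   (\sum_j l j v * tensor (subst (subst phi i (d1 i)) j (if j == i then d2 i else d1 j)) x).
  apply: is_derive_tensor => j t; rewrite /subst.
  by case: (boolP (j == i)) => [/eqP ji|_]; [subst j; exact: D2|exact: D1].
have sumD (s : seq I) : is_derive x v
   (fun y => \sum_(i <- s) l i v * tensor (subst phi i (d1 i)) y)
   (\sum_(i <- s) l i v * (\sum_j l j v * tensor (subst (subst phi i (d1 i)) j (if j == i then d2 i else d1 j)) x)).
  elim: s => [|i s IH].
    under eq_fun do rewrite big_nil.
    by rewrite big_nil; exact: is_derive_cst.
  under eq_fun do rewrite big_cons.
  rewrite big_cons; exact: (is_deriveD (is_deriveZ (l i v) (D i)) IH).
apply: (is_derive_eq (sumD _)); apply: eq_bigr => i _.
by rewrite mulr_sumr; apply: eq_bigr => j _; rewrite mulrA.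
Qed.

(* Stable under directional derivatives, so that smoothness reduces to continuity. *)
Inductive smooth_expr : (V -> R) -> Prop :=
| smooth_expr_comp f i : smooth1 f -> smooth_expr (f \o l i)
| smooth_expr_cst c : smooth_expr (cst c)
| smooth_expr_add f g : smooth_expr f -> smooth_expr g -> smooth_expr (f + g)
| smooth_expr_mul f g : smooth_expr f -> smooth_expr g -> smooth_expr (f * g).

Lemma smooth_expr_derive f v : smooth_expr f ->
  exists2 f', smooth_expr f' & forall x, is_derive x v f (f' x).
Proof.
elim=> [{}f i sf|c|{}f g _ [f' sf' df] _ [g' sg' dg]|{}f g sf [f' sf' df] sg [g' sg' dg]].
- have [f' sf' df] := smooth1_derive sf.
  exists (cst (l i v) * (f' \o l i)).
    by apply: smooth_expr_mul; [exact: smooth_expr_cst|exact: smooth_expr_comp].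
  by move=> x; exact: is_derive_comp_lin.
- by exists (cst 0); [exact: smooth_expr_cst|move=> x; exact: is_derive_cst].
- by exists (f' + g'); [exact: smooth_expr_add|move=> x; exact: is_deriveD].
- exists (f * g' + g * f'); first by apply: smooth_expr_add; exact: smooth_expr_mul.
  by move=> x; exact: is_deriveM.
Qed.

Lemma smooth_expr_continuous f : smooth_expr f -> continuous f.
Proof.
elim=> [{}f i sf|c|{}f g _ cf _ cg|{}f g _ cf _ cg] x.
- by apply: continuous_comp; [exact: l_cont|exact: smooth1_continuous].
- exact: cvg_cst.
- exact: (cvgD (cf x) (cg x)).
- exact: (cvgM (cf x) (cg x)).
Qed.

Lemma smooth_expr_smooth f : smooth_expr f -> smooth f.
Proof.
move=> sf s; suff sD : smooth_expr (iter_derive s f).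
  split; first exact: smooth_expr_continuous.
  by move=> x v; have [f' _ df] := smooth_expr_derive v sD; case: (df x).
elim: s => //= v s IH; have [f' sf' df] := smooth_expr_derive v IH.
rewrite (_ : 'D_v _ = f')//; apply/funext => x.
by have := df x => dfx; rewrite derive_val.
Qed.

Lemma smooth_expr_tensor phi : (forall i, smooth1 (phi i)) -> smooth_expr (tensor phi).
Proof.
move=> sphi; rewrite (_ : tensor phi = \prod_i (phi i \o l i)); last first.
  by apply/funext => x; rewrite fct_prodE.
elim/big_ind : _ => [|f g|i _].
- exact: (smooth_expr_cst 1).
- exact: smooth_expr_mul.
- exact: smooth_expr_comp.
Qed.

Variable dual : I -> V.
Hypothesis frame : forall x, x = \sum_i l i x *: dual i.

(** Where the product is nonzero every coordinate lies in [-r, r], so the support is contained in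
    the continuous image of a compact cube. *)
Lemma tensor_compact_support phi (r : R) : (forall i t, r < `|t| -> phi i t = 0) ->
  compact (closure [set x | tensor phi x != 0]).
Proof.
move=> phir.
pose B := [set a : 'rV[R]_#|I| | forall i, a ord0 i \in `[(- r), r]].
have cB : compact B.
  apply: (@rV_compact _ _ (fun=> `[- r, r]%classic)).
  by move=> _; apply: segment_compact.
pose g (a : 'rV[R]_#|I|) : V := \sum_i a ord0 (enum_rank i) *: dual i.
have cg : continuous g.
  rewrite /g; elim: (index_enum I) => [|i s IH] a.
    by rewrite (_ : (fun a => _) = cst 0); [exact: cst_continuous|apply/funext => b; rewrite big_nil].
  rewrite (_ : (fun a => _) = (fun a : 'rV[R]_#|I| => a ord0 (enum_rank i) *: dual i) +
    (fun a => \sum_(i <- s) a ord0 (enum_rank i) *: dual i)); last first.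
    by apply/funext => b; rewrite big_cons.
  apply: continuousD; last exact: IH.

  have ca := @coord_continuous R 1 #|I| ord0 (enum_rank i) a.
  exact: (cvgZr_tmp ca).
have cgB : compact (g @` B).
  by apply: continuous_compact => //; exact: continuous_subspaceT.
have clgB : closed (g @` B) by apply: compact_closed => //; exact: norm_hausdorff.
apply: (subclosed_compact _ cgB); first exact: closed_closure.
move: clgB => /closure_id ->; apply: closure_subset => x /=.
rewrite /tensor => /prodf_neq0 xn; exists (\row_k l (enum_val k) x).
  move=> k /=; rewrite mxE in_itv/= -ler_norml leNgt; apply/negP => /phir kx.
  by have := xn (enum_val k) isT; rewrite kx eqxx.
rewrite /g [RHS]frame; apply: eq_bigr => i _; by rewrite mxE enum_rankK.
Qed.

End tensor.

(** * Gaussian bounds and integration by parts *)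

(** Lagrange's identity: the double sum of (a_i b_j - a_j b_i)^2 is twice the difference of the two
    sides. *)
Lemma cauchy_schwarz_sum (R : realDomainType) (I : finType) (a b : I -> R) :
  (\sum_i a i * b i) ^+ 2 <= (\sum_i a i ^+ 2) * (\sum_i b i ^+ 2).
Proof.
have : 0 <= \sum_i \sum_j (a i * b j - a j * b i) ^+ 2.
  by apply: sumr_ge0 => i _; apply: sumr_ge0 => j _; exact: sqr_ge0.
have -> : \sum_i \sum_j (a i * b j - a j * b i) ^+ 2 =
    ((\sum_i a i ^+ 2) * (\sum_i b i ^+ 2) - (\sum_i a i * b i) ^+ 2) *+ 2.
  have inner i : \sum_j (a i * b j - a j * b i) ^+ 2 = a i ^+ 2 * (\sum_j b j ^+ 2)
      + (b i ^+ 2 * (\sum_j a j ^+ 2) + - 2 * (a i * b i) * (\sum_j a j * b j)).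
    by rewrite !mulr_sumr -!big_split /=; apply: eq_bigr => j _; ring.
  under eq_bigr do rewrite inner.
  by rewrite !big_split /= -!mulr_suml -mulr_sumr; ring.
by rewrite pmulrn_lge0// subr_ge0.
Qed.

Lemma Rdominated_convergence d (T : measurableType d) (R : realType)
    (mu : {measure set T -> \bar R}) (f : nat -> T -> R) (g G : T -> R) :
  (forall k, measurable_fun setT (f k)) ->
  (forall x, f k x @[k --> \oo] --> g x) ->
  mu.-integrable setT (EFin \o G) -> (forall k x, `|f k x| <= G x) ->
  mu.-integrable setT (EFin \o g) /\
  (\int[mu]_x f k x @[k --> \oo] --> \int[mu]_x g x).
Proof.
move=> mf fg iG fG.
have mg : measurable_fun setT g by apply: (measurable_fun_cvg mf) => x _; exact: fg.
have cfg x : (f k x)%:E @[k --> \oo] --> (g x)%:E.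
  by apply: cvg_EFin; [exact: nearW|exact: fg].
have [ig _ cI] := @dominated_convergence _ _ _ mu setT measurableT
  (fun k x => (f k x)%:E) (fun x => (g x)%:E) (fun x => (G x)%:E)
  (fun k => (measurable_EFinP _ _).2 (mf k)) ((measurable_EFinP _ _).2 mg)
  (aeW _ (fun x _ => cfg x)) iG
  (aeW _ (fun x k _ => fG k x)).
split; first exact: ig.
apply: fine_cvg; rewrite /Rintegral fineK; first exact: cI.
exact: integrable_fin_num.
Qed.

Section frame_integrals.
Context {R : realType} {n p : nat} {I : finType}.
Local Notation X := ('cV[R]_n * 'cV[R]_p)%type.
Local Notation mu := (@lebesgue_xy R n p).
Local Notation intg f := (mu.-integrable setT (EFin \o f)).
Variable l : I -> X -> R.
Variable dual : I -> X.
Hypothesis l_lin : forall i a x y, l i (a *: x + y) = a * l i x + l i y.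
Hypothesis l_cont : forall i, continuous (l i).
Hypothesis l_meas : forall i, measurable_fun setT (l i).
Hypothesis frame : forall x, x = \sum_i l i x *: dual i.

Definition quad (x : X) : R := \sum_i l i x ^+ 2.

Lemma quad_ge0 x : 0 <= quad x.
Proof. by apply: sumr_ge0 => i _; exact: sqr_ge0. Qed.

Lemma measurable_quad : measurable_fun setT quad.
Proof. by apply: measurable_sum => i; apply: measurable_funX. Qed.

(** Cauchy-Schwarz applied to x = sum of l_i(x) dual_i. It transfers integrability from Gaussians in
    the standard norm to Gaussians in [quad]. *)
Lemma quad_coercive : exists2 M : R, 0 < M & forall x, sqnorm_xy x <= M * quad x.
Proof.
pose M := \sum_i sqnorm_xy (dual i).
have M0 : 0 <= M.
  by apply: sumr_ge0 => i _; apply: addr_ge0; apply: sumr_ge0 => k _; exact: sqr_ge0.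
exists (1 + M) => [|x]; first by rewrite ltr_wpDr.
apply: (@le_trans _ _ (M * quad x)); last by rewrite ler_wpM2r ?quad_ge0// lerDr.
rewrite /M /sqnorm_xy big_split /= /sqnorm mulrDl.
have x1 k : x.1 k 0 = \sum_i l i x * (dual i).1 k 0.
  rewrite {1}(frame x); elim/big_rec2: _ => [|i y z _ <-]; first by rewrite mxE.
  by rewrite /= !mxE.
have x2 k : x.2 k 0 = \sum_i l i x * (dual i).2 k 0.
  rewrite {1}(frame x); elim/big_rec2: _ => [|i y z _ <-]; first by rewrite mxE.
  by rewrite /= !mxE.
by rewrite lerD// exchange_big /= mulr_suml; apply: ler_sum => k _;
  rewrite ?x1 ?x2 mulrC; exact: cauchy_schwarz_sum.
Qed.

Definition gauss_dominated (a : R) (F : X -> R) :=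
  exists2 C : R, 0 <= C & forall x, `|F x| <= C * expR (- (a * quad x)).

Lemma integrable_gauss_quad a : 0 < a -> intg (fun x => expR (- (a * quad x))).
Proof.
move=> a0; have [M M0 HM] := quad_coercive.
have aM0 : 0 < a / M by rewrite divr_gt0.
apply: (le_integrable _ _ _ (integrable_gauss_xy n p aM0)) => //.
  apply/measurable_EFinP; apply: measurableT_comp => //; apply: measurableT_comp => //.
  by apply: measurable_funM => //; exact: measurable_quad.
move=> x _; rewrite lee_fin !ger0_norm ?expR_ge0// ler_expR lerN2 -mulrA ler_wpM2l ?(ltW a0)//.
by rewrite ler_pdivrMl.
Qed.

Lemma gauss_dominated_integrable a F : 0 < a -> measurable_fun setT F ->
  gauss_dominated a F -> intg F.
Proof.
move=> a0 mF [C C0 FC].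
have iG : intg (fun x => C * expR (- (a * quad x))).
  have := integrableZl measurableT C (integrable_gauss_quad a0).
  by apply: eq_integrable.
apply: (le_integrable _ _ _ iG) => //; first exact/measurable_EFinP.
by move=> x _; rewrite lee_fin [leRHS]ger0_norm// mulr_ge0 ?expR_ge0.
Qed.

Lemma gauss_dominated_mul a b F G : gauss_dominated a F -> gauss_dominated b G ->
  gauss_dominated (a + b) (fun x => F x * G x).
Proof.
move=> [C C0 FC] [D D0 GD]; exists (C * D); first exact: mulr_ge0.
move=> x; rewrite normrM mulrDl opprD expRD mulrACA; exact: ler_pM.
Qed.

Lemma gauss_dominated_add a F G : gauss_dominated a F -> gauss_dominated a G ->
  gauss_dominated a (fun x => F x + G x).
Proof.
move=> [C C0 FC] [D D0 GD]; exists (C + D); first exact: addr_ge0.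
by move=> x; rewrite mulrDl (le_trans (ler_normD _ _))// lerD.
Qed.

Lemma gauss_dominated_opp a F : gauss_dominated a F -> gauss_dominated a (fun x => - F x).
Proof. by move=> [C C0 FC]; exists C => // x; rewrite normrN. Qed.

Lemma gauss_dominated_scale a c F : gauss_dominated a F ->
  gauss_dominated a (fun x => c * F x).
Proof.
move=> [C C0 FC]; exists (`|c| * C); first exact: mulr_ge0.
by move=> x; rewrite normrM -mulrA ler_wpM2l.
Qed.

Lemma gauss_dominated_Lfun a F : 0 < a -> measurable_fun setT F ->
  gauss_dominated a F -> F \in Lfun mu 2%:E.
Proof.
move=> a0 mF FC; apply: sqr_integrable_Lfun => //.
have i2 : intg (fun x => F x * F x).
  apply: (@gauss_dominated_integrable (a + a)); first exact: addr_gt0.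
    exact: measurable_funM.
  exact: gauss_dominated_mul.
by have := integrable_lty measurableT i2; under eq_integral do rewrite /= -expr2.
Qed.

(** Expanding (l_i x + 2 s l_i v)^2 >= 0. The lemma keeps a Gaussian bound, at half the exponent,
    uniform along a short segment. *)
Lemma quad_shift x v (s : R) : `|s| <= 1 -> quad x / 2 - quad v <= quad (s *: v + x).
Proof.
move=> s1; rewrite /quad mulr_suml -sumrB; apply: ler_sum => i _; rewrite l_lin.
have s2 : s ^+ 2 <= 1 by rewrite -[s ^+ 2]real_normK ?num_real// exprn_ile1.
have := sqr_ge0 (l i x + 2 * s * l i v); have := sqr_ge0 (l i v); nra.
Qed.

Lemma is_derive_line (F F' : X -> R) (v x : X) (s : R) :
  (forall y, is_derive y v F (F' y)) ->
  is_derive s (1 : R) (fun t : R => F (t *: v + x)) (F' (s *: v + x)).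
Proof.
move=> dF; have [d1 d2] := dF (s *: v + x).
have E : (fun h : R => h^-1 *: ((F \o shift (s *: v + x)) (h *: v) - F (s *: v + x))) =
  (fun h : R => h^-1 *: (((fun t : R => F (t *: v + x)) \o shift s) h%:A - F (s *: v + x))).
  by apply/funext => h /=; rewrite -[h%:A]/(h * 1) mulr1 scalerDl addrA.
by apply: DeriveDef; [rewrite /derivable -E|rewrite /derive -E].
Qed.

(* The integral of a directional derivative vanishes: by translation invariance
   the difference quotients have integral zero. *)
Lemma integral_derive0 a (F F' : X -> R) (v : X) : 0 < a ->
  measurable_fun setT F -> gauss_dominated a F -> gauss_dominated a F' ->
  (forall x, is_derive x v F (F' x)) ->
  measurable_fun setT F' /\ \int[mu]_x F' x = 0.
Proof.
move=> a0 mF dF [C C0 F'C] derF.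
pose s (k : nat) : R := k.+1%:R^-1.
have s0 k : 0 < s k by rewrite invr_gt0.
pose D (k : nat) (x : X) := (s k)^-1 * (F (x + s k *: v) - F x).
have mshift k : measurable_fun setT (fun x : X => F (x + s k *: v)).
  by apply: measurableT_comp => //; case: (preserves_lebesgue_xy (s k *: v)).
have mD k : measurable_fun setT (D k).
  by apply: measurable_funM => //; exact: measurable_funB.
have cD x : D k x @[k --> \oo] --> F' x.
  have [d1 d2] := derF x; rewrite -d2.
  (* The derivative is a limit over nonzero increments, so the sequence must tend to 0 without
     reaching it. *)
  have cs : s k @[k --> \oo] --> (0 : R)^'.
    move=> A nA; have H : \forall k \near \oo, s k != 0 -> A (s k) := @cvg_harmonic R _ nA.
    by apply: filterS H => k; apply; rewrite gt_eqF.
  have := cvg_comp _ _ cs d1; rewrite /D /=; apply: cvg_trans.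
  by apply: near_eq_cvg; apply: nearW => k /=; rewrite [_ + x]addrC.
have mF' : measurable_fun setT F'.
  by apply: (measurable_fun_cvg mD) => x _; exact: cD.
split=> //.
pose G (x : X) := C * expR (a * quad v) * expR (- (a / 2 * quad x)).
(* The mean value theorem turns the difference quotient into a value of F' on the segment from x to
   x + v, where [quad_shift] bounds it. *)
have DG k x : `|D k x| <= G x.
  have [c] : exists2 c : R, c \in `[0, s k] &
      F (s k *: v + x) - F (0 *: v + x) = F' (c *: v + x) * (s k - 0).
    apply: (@MVT_segment R (fun t => F (t *: v + x)) (fun t => F' (t *: v + x))).
    - exact: ltW.
    - by move=> t _; exact: is_derive_line.
    - apply: derivable_within_continuous => t _.
      by have [] := @is_derive_line F F' v x t derF.
  rewrite in_itv/= => /andP[c0 cs] E.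
  have -> : D k x = F' (c *: v + x).
    rewrite /D [x + _]addrC; have -> : F x = F (0 *: v + x) by rewrite scale0r add0r.
    by rewrite E subr0 mulrC mulfK// gt_eqF.
  apply: le_trans (F'C _) _; rewrite /G -mulrA -expRD ler_wpM2l// ler_expR.
  have c1 : `|c| <= 1.
    by rewrite ger0_norm// (le_trans cs)// invf_le1// ler1n.
  have := quad_shift x v c1; have := quad_ge0 x; nra.
have iG : intg G.
  apply: (@gauss_dominated_integrable (a / 2)); first by rewrite divr_gt0.
    apply: measurable_funM => //; apply: measurableT_comp => //.
    apply: measurableT_comp => //; apply: measurable_funM => //; exact: measurable_quad.
  exists (C * expR (a * quad v)); first by rewrite mulr_ge0 ?expR_ge0.
  by move=> x; rewrite ger0_norm// /G !mulr_ge0 ?expR_ge0.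
have iF := gauss_dominated_integrable a0 mF dF.
have ID k : \int[mu]_x D k x = 0.
  have [iFs Fs] := preserves_integral (preserves_lebesgue_xy (s k *: v)) iF.
  rewrite /D RintegralZl//; last first.
    by have := integrableB measurableT iFs iF; apply: eq_integrable.
  by rewrite RintegralB// Fs subrr mulr0.
have [_] := Rdominated_convergence mD cD iG DG.
under eq_fun do rewrite ID.
by move=> /(cvg_lim (@Rhausdorff R)) <-; rewrite lim_cst//; exact: Rhausdorff.
Qed.

Definition gauss_dominated1 (a : R) (f : R -> R) :=
  exists2 C : R, 0 <= C & forall t, `|f t| <= C * expR (- (a * t ^+ 2)).

Lemma measurable_tensor phi : (forall i, measurable_fun setT (phi i)) ->
  measurable_fun setT (tensor l phi).
Proof.
move=> mphi; apply: measurable_prod => i _; exact: measurableT_comp.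
Qed.

Lemma tensor_dominated a phi : (forall i, gauss_dominated1 a (phi i)) ->
  gauss_dominated a (tensor l phi).
Proof.
move=> dphi.
have bnd i : exists C : R, 0 <= C /\ forall t, `|phi i t| <= C * expR (- (a * t ^+ 2)).
  by have [C C0 HC] := dphi i; exists C.
have [C HC] := choice bnd.
exists (\prod_i C i); first by apply: prodr_ge0 => i _; case: (HC i).
move=> x; rewrite /tensor /quad mulr_sumr -sumrN expR_sum -big_split /= normr_prod.
by apply: ler_prod => i _; rewrite normr_ge0/=; case: (HC i).
Qed.

(** The product of f with exp(a quad) is continuous, hence bounded on the compact support of f. *)
Lemma compact_support_dominated a (f : X -> R) : continuous f ->
  compact (closure [set x | f x != 0]) -> gauss_dominated a f.
Proof.
move=> cf csf; pose g x := f x * expR (a * quad x).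
have cq : continuous quad.
  rewrite /quad; elim: (index_enum I) => [|i s IH] x.
    by rewrite (_ : (fun x => _) = cst 0); [exact: cst_continuous|apply/funext => b; rewrite big_nil].
  rewrite (_ : (fun x => _) = (fun x => l i x ^+ 2) + (fun x => \sum_(i <- s) l i x ^+ 2)); last first.
    by apply/funext => b; rewrite big_cons.
  apply: continuousD; last exact: IH.
  by apply: (@continuous_comp _ _ _ (l i) (fun t : R => t ^+ 2)); [exact: l_cont|exact: exprn_continuous].
have cg : continuous g.
  move=> x; apply: cvgM; first exact: cf.
  apply: continuous_comp; last exact: continuous_expR.
  by apply: cvgMr; exact: cq.
have cgK : compact (g @` closure [set x | f x != 0]).
  by apply: continuous_compact => //; exact: continuous_subspaceT.
have [M [_ HM]] := compact_bounded cgK.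
have M1 : M < `|M| + 1 by rewrite (le_lt_trans (ler_norm _))// ltrDl.
exists (`|M| + 1); first by rewrite addr_ge0.
move=> x; rewrite expRN ler_pdivlMr ?expR_gt0// -[expR _]ger0_norm ?expR_ge0// -normrM -/(g x).
have [fx|fx] := eqVneq (f x) 0; first by rewrite /g fx mul0r normr0 addr_ge0.
by apply: (HM _ M1); exists x => //; exact: subset_closure.
Qed.

Lemma derive_support (f f' : X -> R) v : (forall x, is_derive x v f (f' x)) ->
  closure [set x | f' x != 0] `<=` closure [set x | f x != 0].
Proof.
move=> df; rewrite [X in _ `<=` X](closure_id _).1; last exact: closed_closure.
apply: closure_subset => x /=; apply: contraNP => /existsNP[B /not_implyP[nB fB]].
have f0 : \forall y \near x, cst 0 y = f y.
  apply: filterS nB => y By; apply/esym/eqP; apply: contra_notT fB => fy.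
  by exists y.
have [_ d0] := near_eq_is_derive f0 (is_derive_cst (0 : R) x v).
by have [_ d1] := df x; rewrite -d1 d0.
Qed.

(** The integrand f2 e - f e2 is the derivative along v of f1 e - f e1, so [integral_derive0]
    applies. *)
Lemma green a (f f1 f2 e e1 e2 : X -> R) (v : X) : 0 < a ->
  measurable_fun setT f -> measurable_fun setT e ->
  (forall x, is_derive x v f (f1 x)) -> (forall x, is_derive x v f1 (f2 x)) ->
  (forall x, is_derive x v e (e1 x)) -> (forall x, is_derive x v e1 (e2 x)) ->
  gauss_dominated a f -> gauss_dominated a f1 -> gauss_dominated a f2 ->
  gauss_dominated a e -> gauss_dominated a e1 -> gauss_dominated a e2 ->
  [/\ intg (fun x => f2 x * e x), intg (fun x => f x * e2 x) &
    \int[mu]_x (f2 x * e x) = \int[mu]_x (f x * e2 x)].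
Proof.
move=> a0 mf me df df1 de de1 Gf Gf1 Gf2 Ge Ge1 Ge2.
have [mf1 _] := integral_derive0 a0 mf Gf Gf1 df.
have [mf2 _] := integral_derive0 a0 mf1 Gf1 Gf2 df1.
have [me1 _] := integral_derive0 a0 me Ge Ge1 de.
have [me2 _] := integral_derive0 a0 me1 Ge1 Ge2 de1.
have a2 : 0 < a + a by rewrite addr_gt0.
have i1 : intg (fun x => f2 x * e x).
  by apply: (gauss_dominated_integrable a2); [exact: measurable_funM|exact: gauss_dominated_mul].
have i2 : intg (fun x => f x * e2 x).
  by apply: (gauss_dominated_integrable a2); [exact: measurable_funM|exact: gauss_dominated_mul].
split=> //; apply/eqP; rewrite -subr_eq0 -RintegralB//.
suff [_ ->] : measurable_fun setT (fun x => f2 x * e x - f x * e2 x) /\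
   \int[mu]_x (f2 x * e x - f x * e2 x) = 0 by [].
apply: (@integral_derive0 (a + a) (fun x => f1 x * e x - f x * e1 x) _ v a2).
- by apply: measurable_funB; exact: measurable_funM.
- apply: gauss_dominated_add; first exact: gauss_dominated_mul.
  by apply: gauss_dominated_opp; exact: gauss_dominated_mul.
- apply: gauss_dominated_add; first exact: gauss_dominated_mul.
  by apply: gauss_dominated_opp; exact: gauss_dominated_mul.
- move=> x; have := is_deriveB (is_deriveM (df1 x) (de x)) (is_deriveM (df x) (de1 x)).
  move/is_derive_eq; apply; rewrite /GRing.scale/=; ring.
Qed.

Lemma Rintegral_sum (K : Type) (s : seq K) (g : K -> X -> R) :
  (forall k, intg (g k)) ->
  intg (fun x => \sum_(k <- s) g k x) /\
  \int[mu]_x (\sum_(k <- s) g k x) = \sum_(k <- s) \int[mu]_x g k x.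
Proof.
move=> ig; elim: s => [|k s [IHi IH]].
  split; last by rewrite big_nil; under eq_Rintegral do rewrite big_nil; rewrite /Rintegral integral0.
  under eq_fun do rewrite big_nil; exact: integrable0.
split.
  have := integrableD measurableT (ig k) IHi; apply: eq_integrable => //.
  by move=> x _ /=; rewrite big_cons.
by under eq_Rintegral do rewrite big_cons; rewrite RintegralD// IH big_cons.
Qed.

End frame_integrals.

(** * Hermite functions in several variables *)

Section hermite_tensors.
Context {R : realType} {n p : nat} {I K : finType}.
Local Notation X := ('cV[R]_n * 'cV[R]_p)%type.
Local Notation mu := (@lebesgue_xy R n p).
Local Notation intg f := (mu.-integrable setT (EFin \o f)).
Variables (l : I -> X -> R) (dual : I -> X).
Hypothesis l_lin : forall i a x y, l i (a *: x + y) = a * l i x + l i y.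
Hypothesis l_cont : forall i, continuous (l i).
Hypothesis l_meas : forall i, measurable_fun setT (l i).
Hypothesis frame : forall x, x = \sum_i l i x *: dual i.
Hypothesis dual_id : forall i j, l i (dual j) = (i == j)%:R.

Lemma subst_ind (P : (R -> R) -> Prop) phi i f :
  (forall j, P (phi j)) -> P f -> forall j, P (subst (I:=I) phi i f j).
Proof. by move=> Pphi Pf j; rewrite /subst; case: eqP. Qed.

Definition hermite_tensor (alpha : I -> nat) : X -> R :=
  tensor l (fun i => hermite_fun (alpha i)).

Let a4 : 0 < (4^-1 : R). Proof. by rewrite invr_gt0. Qed.

Lemma gauss_poly_dominated q : gauss_dominated1 4^-1 (@gauss_poly R q).
Proof.
have [C C0 HC] := gauss_poly_le q; exists C => // t.
by have := HC t; rewrite [t ^+ 2 / 4]mulrC.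
Qed.

Lemma gauss_poly_measurable q : measurable_fun setT (@gauss_poly R q).
Proof. by apply: smooth1_measurable; exact: smooth1_gauss_poly. Qed.

Lemma hermite_tensor_measurable alpha : measurable_fun setT (hermite_tensor alpha).
Proof. by apply: measurable_tensor => // i; exact: gauss_poly_measurable. Qed.

Lemma hermite_tensor_dominated alpha : gauss_dominated l 4^-1 (hermite_tensor alpha).
Proof. by apply: tensor_dominated => i; exact: gauss_poly_dominated. Qed.

Lemma gauss_dominated_sum (J : Type) (s : seq J) a (F : J -> X -> R) :
  (forall j, gauss_dominated l a (F j)) ->
  gauss_dominated l a (fun x => \sum_(j <- s) F j x).
Proof.
move=> dF; elim: s => [|j s IH].
  by exists 0 => // x; rewrite big_nil normr0 mul0r.
by under eq_fun do rewrite big_cons; exact: gauss_dominated_add.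
Qed.

Let d1 (alpha : I -> nat) i := gauss_poly (gauss_deriv (@hermite R (alpha i))).
Let d2 (alpha : I -> nat) i := gauss_poly (gauss_deriv (gauss_deriv (@hermite R (alpha i)))).

Let D1 alpha i (t : R) : is_derive t (1 : R) (hermite_fun (alpha i)) (d1 alpha i t).
Proof. exact: is_derive_gauss_poly. Qed.

Let D2 alpha i (t : R) : is_derive t (1 : R) (d1 alpha i) (d2 alpha i t).
Proof. exact: is_derive_gauss_poly. Qed.

Let dom_fun (alpha : I -> nat) (i : I) : gauss_dominated1 4^-1 (@hermite_fun R (alpha i)).
Proof. exact: gauss_poly_dominated. Qed.

Let dom_d1 (alpha : I -> nat) (i : I) : gauss_dominated1 4^-1 (d1 alpha i).
Proof. exact: gauss_poly_dominated. Qed.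

Let dom_d2 (alpha : I -> nat) (i : I) : gauss_dominated1 4^-1 (d2 alpha i).
Proof. exact: gauss_poly_dominated. Qed.

Lemma green_hermite (f f1 f2 : X -> R) v alpha :
  measurable_fun setT f ->
  (forall x, is_derive x v f (f1 x)) -> (forall x, is_derive x v f1 (f2 x)) ->
  gauss_dominated l 4^-1 f -> gauss_dominated l 4^-1 f1 -> gauss_dominated l 4^-1 f2 ->
  [/\ intg (fun x => f2 x * hermite_tensor alpha x),
    intg (fun x => f x * 'D_v ('D_v (hermite_tensor alpha)) x) &
    \int[mu]_x (f2 x * hermite_tensor alpha x) =
    \int[mu]_x (f x * 'D_v ('D_v (hermite_tensor alpha)) x)].
Proof.
move=> mf df df1 Gf Gf1 Gf2.
have de x := is_derive_tensor l_lin x v (D1 alpha).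
have de1 x := is_derive2_tensor l_lin x v (D1 alpha) (D2 alpha).
have E1 : 'D_v (hermite_tensor alpha) = _ := funext (fun x => @derive_val _ _ _ _ _ _ _ (de x)).
have E2 : 'D_v ('D_v (hermite_tensor alpha)) = (fun x => \sum_i \sum_j l i v * l j v *
    tensor l (subst (subst (fun i => hermite_fun (alpha i)) i (d1 alpha i)) j
      (if j == i then d2 alpha i else d1 alpha j)) x).
  by rewrite E1; apply/funext => x; exact: (@derive_val _ _ _ _ _ _ _ (de1 x)).
have de' x : is_derive x v (hermite_tensor alpha) ('D_v (hermite_tensor alpha) x).
  by apply: derivableP; case: (de x).
have de1' x : is_derive x v ('D_v (hermite_tensor alpha)) ('D_v ('D_v (hermite_tensor alpha)) x).
  by apply: derivableP; rewrite E1; case: (de1 x).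
have Ge1 : gauss_dominated l 4^-1 ('D_v (hermite_tensor alpha)).
  rewrite E1; apply: gauss_dominated_sum => i; apply: gauss_dominated_scale.
  by apply: tensor_dominated; apply: subst_ind.
have Ge2 : gauss_dominated l 4^-1 ('D_v ('D_v (hermite_tensor alpha))).
  rewrite E2; apply: gauss_dominated_sum => i; apply: gauss_dominated_sum => j.
  apply: gauss_dominated_scale; apply: tensor_dominated.
  by apply: subst_ind; [exact: subst_ind|case: ifP].
apply: (green l_lin l_meas frame a4 mf _ df df1 de' de1') => //.
- exact: hermite_tensor_measurable.
- exact: hermite_tensor_dominated.
Qed.

(** The second-order part is the sum of c_k d_(e_k)^2. [orth] says that in the coordinates l_i it
    has no mixed derivatives and has weights nu_i, the same as in [potential]. *)
Variables (c : K -> R) (e : K -> X) (nu : I -> R).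
Hypothesis orth : forall i j, \sum_k c k * (l i (e k) * l j (e k)) = nu i *+ (i == j).

Definition potential (x : X) : R := \sum_i nu i * l i x ^+ 2.

Definition schrodinger (f : X -> R) (x : X) : R :=
  potential x * f x - \sum_k c k * 'D_(e k) ('D_(e k) f) x.

Lemma schrodinger_tensor phi dphi ddphi x :
  (forall i (t : R), is_derive t (1 : R) (phi i) (dphi i t)) ->
  (forall i (t : R), is_derive t (1 : R) (dphi i) (ddphi i t)) ->
  schrodinger (tensor l phi) x =
  \sum_i nu i * tensor l (subst phi i (fun t => - ddphi i t + t ^+ 2 * phi i t)) x.
Proof.
move=> Dphi DDphi.
pose T i j := tensor l (subst (subst phi i (dphi i)) j (if j == i then ddphi i else dphi j)) x.
have E k : 'D_(e k) ('D_(e k) (tensor l phi)) x =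
    \sum_i \sum_j l i (e k) * l j (e k) * T i j.
  have -> : 'D_(e k) (tensor l phi) = _ :=
    funext (fun y => @derive_val _ _ _ _ _ _ _ (is_derive_tensor l_lin y (e k) Dphi)).
  exact: (@derive_val _ _ _ _ _ _ _ (is_derive2_tensor l_lin x (e k) Dphi DDphi)).
have -> : schrodinger (tensor l phi) x =
    potential x * tensor l phi x - \sum_i nu i * T i i.
  congr (_ - _); under eq_bigr do rewrite E mulr_sumr.
  rewrite exchange_big /=; apply: eq_bigr => i _.
  under eq_bigr do rewrite mulr_sumr.
  rewrite exchange_big /= (bigD1 i)//= [X in _ + X]big1 => [|j ji].
    rewrite addr0; under eq_bigr do rewrite mulrA.
    by rewrite -mulr_suml orth eqxx.
  under eq_bigr do rewrite mulrA.
  by rewrite -mulr_suml orth eq_sym (negbTE ji) mul0r.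
rewrite /potential mulr_suml -sumrB; apply: eq_bigr => i _.
rewrite /T eqxx subst_same !tensor_subst (tensorD1 _ _ i); ring.
Qed.

Definition eigenvalue_of (alpha : I -> nat) : R := \sum_i nu i * (2 * alpha i + 1)%:R.

Lemma schrodinger_hermite alpha x :
  schrodinger (hermite_tensor alpha) x = eigenvalue_of alpha * hermite_tensor alpha x.
Proof.
rewrite (schrodinger_tensor x (D1 alpha) (D2 alpha)) /eigenvalue_of mulr_suml.
apply: eq_bigr => i _; rewrite tensor_subst /hermite_tensor (tensorD1 _ _ i).
by rewrite hermite_fun_ode -!mulrA.
Qed.

Lemma schrodinger_symmetric (f : X -> R) alpha :
  measurable_fun setT f -> smooth f -> compact (closure [set x | f x != 0]) ->
  \int[mu]_x (schrodinger f x * hermite_tensor alpha x) =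
  eigenvalue_of alpha * \int[mu]_x (f x * hermite_tensor alpha x).
Proof.
move=> mf sf csf; set g := hermite_tensor alpha.
have df v x : is_derive x v f ('D_v f x).
  by apply: derivableP; have [_] := sf [::]; exact.
have df1 v x : is_derive x v ('D_v f) ('D_v ('D_v f) x).
  by apply: derivableP; have [_] := sf [:: v]; exact.
have cs v : compact (closure [set x | 'D_v f x != 0]).
  by apply: (subclosed_compact _ csf); [exact: closed_closure|exact: derive_support].
have cs2 v : compact (closure [set x | 'D_v ('D_v f) x != 0]).
  by apply: (subclosed_compact _ (cs v)); [exact: closed_closure|exact: derive_support].
have Gf : gauss_dominated l 4^-1 f.
  by apply: compact_support_dominated => //; have [] := sf [::].
have Gf1 v : gauss_dominated l 4^-1 ('D_v f).
  by apply: compact_support_dominated => //; have [] := sf [:: v].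
have Gf2 v : gauss_dominated l 4^-1 ('D_v ('D_v f)).
  by apply: compact_support_dominated => //; have [] := sf [:: v; v].
have G k := green_hermite alpha mf (df (e k)) (df1 (e k)) Gf (Gf1 (e k)) (Gf2 (e k)).
(* The contribution of direction e_k to (S f) g - f (S g), up to sign; Green's formula makes its
   integral vanish. *)
pose h k x := c k * ('D_(e k) ('D_(e k) f) x * g x) - c k * (f x * 'D_(e k) ('D_(e k) g) x).
have ih k : intg (h k).
  have [i1 i2 _] := G k.
  have j1 := integrableZl measurableT (c k) i1.
  have j2 := integrableZl measurableT (c k) i2.
  by have := integrableB measurableT j1 j2; apply: eq_integrable.
have h0 k : \int[mu]_x h k x = 0.
  have [i1 i2 E] := G k.
  have j1 := integrableZl measurableT (c k) i1.
  have j2 := integrableZl measurableT (c k) i2.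
  by rewrite /h RintegralB// !RintegralZl// E subrr.
have [ihs hs] := Rintegral_sum (index_enum K) ih.
have ifg : intg (fun x => f x * g x).
  apply: (gauss_dominated_integrable l_meas frame (addr_gt0 a4 a4)).
    by apply: measurable_funM => //; exact: hermite_tensor_measurable.
  by apply: gauss_dominated_mul => //; exact: hermite_tensor_dominated.
have E x : schrodinger f x * g x = eigenvalue_of alpha * (f x * g x) - \sum_k h k x.
  pose S1 := \sum_k c k * 'D_(e k) ('D_(e k) f) x.
  pose S2 := \sum_k c k * 'D_(e k) ('D_(e k) g) x.
  have -> : \sum_k h k x = S1 * g x - f x * S2.
    rewrite /h sumrB /S1 /S2 mulr_suml mulr_sumr; congr (_ - _); apply: eq_bigr => k _.
      by rewrite mulrA.
    by rewrite mulrCA.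
  have sE : potential x * g x - S2 = eigenvalue_of alpha * g x := schrodinger_hermite alpha x.
  rewrite mulrCA -sE -[schrodinger f x]/(potential x * f x - S1).
  by move: S1 S2 (potential x) (f x) (g x) {sE} => S1 S2 P u v; ring.
under eq_Rintegral do rewrite E.
rewrite RintegralB//; last first.
  by have := integrableZl measurableT (eigenvalue_of alpha) ifg; apply: eq_integrable.
by rewrite RintegralZl// hs big1 ?subr0.
Qed.

Lemma is_derive_tensor_dual phi dphi i x :
  (forall j (t : R), is_derive t (1 : R) (phi j) (dphi j t)) ->
  is_derive x (dual i) (tensor l phi) (tensor l (subst phi i (dphi i)) x).
Proof.
move=> Dphi; apply: (is_derive_eq (is_derive_tensor l_lin x (dual i) Dphi)).
rewrite (bigD1 i)//= dual_id eqxx mul1r big1 ?addr0// => j ji.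
by rewrite dual_id (negbTE ji) mul0r.
Qed.

Let dual_derive alpha i x :
  is_derive x (dual i) (hermite_tensor alpha)
    (tensor l (subst (fun j => hermite_fun (alpha j)) i (d1 alpha i)) x).
Proof. exact: is_derive_tensor_dual. Qed.

Let dual_derive2 alpha i x :
  is_derive x (dual i) (tensor l (subst (fun j => hermite_fun (alpha j)) i (d1 alpha i)))
    (tensor l (subst (fun j => hermite_fun (alpha j)) i (d2 alpha i)) x).
Proof.
have := @is_derive_tensor_dual (subst (fun j => hermite_fun (alpha j)) i (d1 alpha i))
  (fun j => if j == i then d2 alpha i else d1 alpha j) i x.
rewrite eqxx subst_same; apply => j t; rewrite /subst.
by case: (boolP (j == i)) => [/eqP ji|_]; [subst j; exact: D2|exact: D1].
Qed.

Let dom_tensor1 alpha i : gauss_dominated l 4^-1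
  (tensor l (subst (fun j => hermite_fun (alpha j)) i (d1 alpha i))).
Proof. by apply: tensor_dominated; apply: subst_ind. Qed.

Let dom_tensor2 alpha i : gauss_dominated l 4^-1
  (tensor l (subst (fun j => hermite_fun (alpha j)) i (d2 alpha i))).
Proof. by apply: tensor_dominated; apply: subst_ind. Qed.

Lemma hermite_tensor_prod_integrable alpha beta :
  intg (fun x => hermite_tensor alpha x * hermite_tensor beta x).
Proof.
apply: (gauss_dominated_integrable l_meas frame (addr_gt0 a4 a4)).
  by apply: measurable_funM; exact: hermite_tensor_measurable.
by apply: gauss_dominated_mul; exact: hermite_tensor_dominated.
Qed.

(** The full eigenvalues of alpha and beta may coincide, so the operator -d_i^2 + l_i^2 in a single
    coordinate is used: its eigenvalues differ as soon as alpha i and beta i do. *)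
Lemma hermite_tensor_orth alpha beta i : alpha i != beta i ->
  \int[mu]_x (hermite_tensor alpha x * hermite_tensor beta x) = 0.
Proof.
move=> ab.
have [i1 i2] := green l_lin l_meas frame a4 (hermite_tensor_measurable alpha)
  (hermite_tensor_measurable beta) (dual_derive alpha i) (dual_derive2 alpha i)
  (dual_derive beta i) (dual_derive2 beta i) (hermite_tensor_dominated alpha)
  (dom_tensor1 alpha i) (dom_tensor2 alpha i) (hermite_tensor_dominated beta)
  (dom_tensor1 beta i) (dom_tensor2 beta i).
move/eqP; rewrite -subr_eq0 -RintegralB//.
have ode gam x : tensor l (subst (fun j => hermite_fun (gam j)) i (d2 gam i)) x =
   (l i x ^+ 2 - (2 * gam i + 1)%:R) * hermite_tensor gam x.
  rewrite tensor_subst /hermite_tensor (tensorD1 _ _ i) mulrA; congr (_ * _).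
  rewrite mulrBl -hermite_fun_ode /d2; ring.
under eq_Rintegral do rewrite !ode.
have E x : (l i x ^+ 2 - (2 * alpha i + 1)%:R) * hermite_tensor alpha x * hermite_tensor beta x
   - hermite_tensor alpha x * ((l i x ^+ 2 - (2 * beta i + 1)%:R) * hermite_tensor beta x)
   = ((2 * beta i + 1)%:R - (2 * alpha i + 1)%:R) * (hermite_tensor alpha x * hermite_tensor beta x).
  ring.
under eq_Rintegral do rewrite E.
rewrite RintegralZl//; last exact: hermite_tensor_prod_integrable.
rewrite mulf_eq0 subr_eq0 eqr_nat !addn1 eqSS eqn_mul2l/= eq_sym (negbTE ab)/=.
by move/eqP.
Qed.

(** With A = l_i B - B' (creation) and l_i A + A' = 2(k+1) B (annihilation), A^2 is 2(k+1) B^2 minus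
    the derivative of A B, whose integral vanishes. *)
Lemma hermite_tensor_norm_succ alpha beta i k :
  alpha i = k.+1 -> beta i = k -> (forall j, j != i -> alpha j = beta j) ->
  \int[mu]_x (hermite_tensor alpha x * hermite_tensor alpha x) =
  (2 * k.+1)%:R * \int[mu]_x (hermite_tensor beta x * hermite_tensor beta x).
Proof.
move=> ai bi ab; have a2 : 0 < (4^-1 + 4^-1 : R) by rewrite addr_gt0.
set A := hermite_tensor alpha; set B := hermite_tensor beta.
pose A' := tensor l (subst (fun j => hermite_fun (alpha j)) i (d1 alpha i)).
pose B' := tensor l (subst (fun j => hermite_fun (beta j)) i (d1 beta i)).
have [mG int0] : measurable_fun setT (fun x => A' x * B x + A x * B' x) /\
    \int[mu]_x (A' x * B x + A x * B' x) = 0.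
  apply: (@integral_derive0 _ _ _ _ l dual l_lin l_meas frame (4^-1 + 4^-1) (fun x => A x * B x) _ (dual i) a2).
  - by apply: measurable_funM; exact: hermite_tensor_measurable.
  - by apply: gauss_dominated_mul; exact: hermite_tensor_dominated.
  - by apply: gauss_dominated_add; apply: gauss_dominated_mul => //;
      (exact: hermite_tensor_dominated || exact: dom_tensor1).
  - move=> x; apply: (is_derive_eq (is_deriveM (dual_derive alpha i x) (dual_derive beta i x))).
    by rewrite /GRing.scale/= addrC; congr (_ + _); rewrite mulrC.
pose rest x := \prod_(j | j != i) hermite_fun (beta j) (l j x).
have rE x : \prod_(j | j != i) hermite_fun (alpha j) (l j x) = rest x.
  by apply: eq_bigr => j /ab ->.
have E x : A x * A x = (2 * k.+1)%:R * (B x * B x) - (A' x * B x + A x * B' x).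
  rewrite /A /B /A' /B' /hermite_tensor !tensor_subst !(tensorD1 _ _ i) rE -/(rest x).
  have ann := hermite_fun_annihilate k (l i x); have cre := hermite_fun_create k (l i x).
  rewrite /d1 ai bi; move: (hermite_fun k.+1 _) (hermite_fun k _) (gauss_poly _ _)
    (gauss_poly _ _) (rest x) ann cre => a b b' a' r ann cre.
  transitivity (a * (l i x * b - b') * r * r); first by rewrite -cre; ring.
  by rewrite !mulrA ann; ring.
under eq_Rintegral do rewrite E.
have iB := hermite_tensor_prod_integrable beta beta.
have i0 : intg (fun x => A' x * B x + A x * B' x).
  apply: (gauss_dominated_integrable l_meas frame a2) => //.
  by apply: gauss_dominated_add; apply: gauss_dominated_mul => //;
      (exact: hermite_tensor_dominated || exact: dom_tensor1).
rewrite RintegralB//; last first.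
  by have := integrableZl measurableT (2 * k.+1)%:R iB; apply: eq_integrable.
by rewrite int0 subr0 RintegralZl.
Qed.

(** Induction on the total degree through [hermite_tensor_norm_succ], down to a Gaussian, which is
    positive everywhere on a space of positive measure. *)
Lemma hermite_tensor_norm_gt0 alpha :
  0 < \int[mu]_x (hermite_tensor alpha x * hermite_tensor alpha x).
Proof.
have [m] := ubnP (\sum_i alpha i); elim: m alpha => // m IH alpha am.
have [/existsP[i ai]|/existsPn a0] := boolP [exists i, (0 < alpha i)%N].
  pose beta j := if j == i then (alpha i).-1 else alpha j.
  have bi : beta i = (alpha i).-1 by rewrite /beta eqxx.
  have bj j : j != i -> alpha j = beta j by rewrite /beta => /negbTE ->.
  rewrite (hermite_tensor_norm_succ _ bi bj) ?prednK// mulr_gt0 ?ltr0n ?muln_gt0// IH//.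
  move: am; rewrite (bigD1 i)//= [X in _ -> (X < _)%N](bigD1 i)//= bi.
  rewrite (eq_bigr _ bj) -{1}(prednK ai) addSn ltnS => /leq_trans; apply.
  by [].
have az i : alpha i = 0%N by have := a0 i; rewrite lt0n negbK => /eqP.
have hpos x : 0 < hermite_tensor alpha x.
  apply: prodr_gt0 => i _; rewrite az /hermite_fun /gauss_poly.
  by rewrite /hermite hornerC mul1r expR_gt0.
rewrite lt_neqAle Rintegral_ge0 ?andbT; last by move=> x _; rewrite mulr_ge0// ltW.
apply/negP => /eqP/esym H0.
have iB := hermite_tensor_prod_integrable alpha alpha.
have := @lebesgue_xy_gt0 R n p; rewrite lt_neqAle => /andP[/negP + _]; apply.
have E0 : (\int[mu]_x `|(hermite_tensor alpha x * hermite_tensor alpha x)%:E| = 0)%E.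
  under eq_integral do rewrite gee0_abs ?lee_fin ?mulr_ge0 ?(ltW (hpos _))//.
  move: H0; rewrite /Rintegral => H0.
  by rewrite -[LHS]fineK ?H0//; exact: integrable_fin_num.
have mh : measurable_fun setT (fun x => (hermite_tensor alpha x * hermite_tensor alpha x)%:E).
  by apply/measurable_EFinP; apply: measurable_funM; exact: hermite_tensor_measurable.
have /(ae_eq_integral_abs _ measurableT mh) [N [mN N0 sub]] := E0.
rewrite eq_sym -measure_le0 -N0 le_measure ?inE// => x _; apply: sub => /= /(_ Logic.I) /eqP.
by rewrite eqe mulf_eq0 gt_eqF.
Qed.

End hermite_tensors.

(** * Completeness of the Hermite functions *)

Lemma exp_coeff_partial_le (R : realType) (x : R) N :
  `|series (exp_coeff (- x)) N| <= expR `|x|.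
Proof.
rewrite /series /=; apply: (le_trans (ler_norm_sum _ _ _)).
apply: (@le_trans _ _ (series (exp_coeff `|x|) N)).
  rewrite /series /=; apply: ler_sum => k _.
  by rewrite !exp_coeffE normrM normrX normrN normfV (ger0_norm (ler0n _ _)).
have nd : nondecreasing_seq (series (exp_coeff `|x|)).
  by apply: nondecreasing_series => k _ _; exact: exp_coeff_ge0.
rewrite -[leRHS]/(limn (series (exp_coeff `|x|))).
by apply: nondecreasing_cvgn_le => //; exact: is_cvg_series_exp_coeff.
Qed.

Lemma bernoulli_le (R : realDomainType) (x : R) k : 0 <= x <= 1 -> 1 - k%:R * x <= (1 - x) ^+ k.
Proof.
case/andP=> x0 x1; elim: k => [|k IH]; first by rewrite mul0r subr0 expr0.
rewrite exprS; apply: (@le_trans _ _ ((1 - x) * (1 - k%:R * x))); last first.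
  by rewrite ler_wpM2l// subr_ge0.
rewrite -natr1 -subr_ge0 [leRHS](_ : _ = k%:R * x ^+ 2); first by rewrite mulr_ge0// sqr_ge0.
by ring.
Qed.

(** With q = t^2, the factor k t^k is at most 1 / (1 - t), and the remaining t^k tends to 0. *)
Lemma cvg_natM_expr (R : realType) (q : R) : 0 <= q < 1 -> k%:R * q ^+ k @[k --> \oo] --> 0.
Proof.
case/andP=> q0 q1; pose t := Num.sqrt q; have t0 : 0 <= t by exact: sqrtr_ge0.
have tq : t ^+ 2 = q by exact: sqr_sqrtr.
have t1 : t < 1 by rewrite -sqrtr1 ltr_sqrt.
have kt k : k%:R * t ^+ k * (1 - t) <= 1.
  have : 1 + k%:R * (1 - t) <= 1 + k%:R * (1 - t) by [].
  have B j : t ^+ j * (1 + j%:R * (1 - t)) <= 1.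
    elim: j => [|j IH]; first by rewrite expr0 mul1r mul0r addr0.
    apply: le_trans IH; rewrite exprSr -mulrA ler_wpM2l ?exprn_ge0// -natr1 -subr_ge0.
    rewrite [leRHS](_ : _ = (j%:R + 1) * (1 - t) ^+ 2); last by ring.
    by rewrite mulr_ge0 ?sqr_ge0// addr_ge0.
  have := B k; have := exprn_ge0 k t0; nra.
apply: (@squeeze_cvgr _ _ _ _ (cst 0) (fun k => (1 - t)^-1 * t ^+ k)).
- apply: nearW => k; rewrite mulr_ge0 ?exprn_ge0//= -tq -exprM mulnC exprM expr2 mulrA ler_wpM2r ?exprn_ge0//.
  by rewrite -[leRHS]mul1r ler_pdivlMr ?subr_gt0.
- exact: cvg_cst.
- rewrite -(mulr0 (1 - t)^-1); apply: cvgMr; apply: cvg_expr; rewrite ger0_norm//.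
Qed.

(** Below 1/2, Bernoulli's inequality gives the lower bound 1 - k (2a)^k. From 1/2 on, 1 - x <=
    exp(-x) gives the upper bound exp(-k (2a)^k) <= exp(-k). The factor k in the exponent settles
    the boundary case: at a = 1/2 the exponent 2^k alone would lead to exp(-1). *)
Lemma cvg_step (R : realType) (a : R) : 0 <= a <= 1 ->
  (1 - a ^+ k) ^+ (k * 2 ^ k) @[k --> \oo] --> ((a < 2^-1)%R%:R : R).
Proof.
case/andP=> a0 a1; have ak k : 0 <= a ^+ k <= 1 by rewrite exprn_ge0//= exprn_ile1.
case: ltP => a2 /=.
- apply: (@squeeze_cvgr _ _ _ _ (fun k => 1 - k%:R * (2 * a) ^+ k) (cst 1)).
  + apply: nearW => k; apply/andP; split; last first.
      by case/andP: (ak k) => ? ?; rewrite exprn_ile1// ?subr_ge0// gerBl.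
    have := bernoulli_le (k * 2 ^ k) (ak k).
    by rewrite natrM natrX exprMn mulrA.
  + rewrite -[X in _ --> X]subr0; apply: cvgB; first exact: cvg_cst.
    apply: cvg_natM_expr; rewrite mulr_ge0//=; lra.
  + exact: cvg_cst.
- apply: (@squeeze_cvgr _ _ _ _ (cst 0) (fun k => (expR (- 1)) ^+ k)).
  + apply: nearW => k; case/andP: (ak k) => ? ?; rewrite exprn_ge0 ?subr_ge0//=.
    apply: (@le_trans _ _ (expR (- a ^+ k) ^+ (k * 2 ^ k))).
      by rewrite lerXn2r ?nnegrE ?subr_ge0// ?expR_ge0// expR_ge1Dx.
    rewrite -!expRM_natl ler_expR mulrN1 mulrN lerN2 natrM natrX -mulrA -exprMn.
    by rewrite ler_peMr// exprn_ege1//; lra.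
  + exact: cvg_cst.
  + by apply: cvg_expr; rewrite ger0_norm ?expR_ge0// -expR0 ltr_expR ltrN10.
Qed.

Section hermite_total.
Context {R : realType} {n p : nat} {I : finType}.
Local Notation X := ('cV[R]_n * 'cV[R]_p)%type.
Local Notation mu := (@lebesgue_xy R n p).
Local Notation intg f := (mu.-integrable setT (EFin \o f)).
Variables (l : I -> X -> R) (dual : I -> X).
Hypothesis l_meas : forall i, measurable_fun setT (l i).
Hypothesis frame : forall x, x = \sum_i l i x *: dual i.

Inductive hermite_span : (X -> R) -> Prop :=
| hermite_span_base alpha : hermite_span (hermite_tensor l alpha)
| hermite_span_add F G : hermite_span F -> hermite_span G ->
    hermite_span (fun x => F x + G x)
| hermite_span_scale c F : hermite_span F -> hermite_span (fun x => c * F x).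

(** The three-term recurrence in the i-th coordinate. For alpha i = 0 the predecessor in [down] is a
    default, multiplied by the coefficient 0. *)
Lemma hermite_span_mul_lin i F : hermite_span F -> hermite_span (fun x => l i x * F x).
Proof.
elim=> [alpha|{}F G _ sF _ sG|c {}F _ sF].
- pose up j := if j == i then (alpha i).+1 else alpha j.
  pose down j := if j == i then (alpha i).-1 else alpha j.
  have E x : l i x * hermite_tensor l alpha x =
     2^-1 * hermite_tensor l up x + (alpha i)%:R * hermite_tensor l down x.
    rewrite /hermite_tensor !(tensorD1 _ _ i) /up /down eqxx.
    have e1 : \prod_(j | j != i) hermite_fun (if j == i then (alpha i).+1 else alpha j) (l j x)
      = \prod_(j | j != i) hermite_fun (alpha j) (l j x).
      by apply: eq_bigr => j /negbTE ->.
    have e2 : \prod_(j | j != i) hermite_fun (if j == i then (alpha i).-1 else alpha j) (l j x)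
      = \prod_(j | j != i) hermite_fun (alpha j) (l j x).
      by apply: eq_bigr => j /negbTE ->.
    rewrite e1 e2 !mulrA -mulrDl; congr (_ * _).
    rewrite /hermite_fun /gauss_poly; case: (alpha i) => [|k].
      rewrite mul0r mul0r addr0 hermiteS -[hermite 0]/(1%:P : {poly R}) derivC subr0.
      by rewrite hornerM hornerZ hornerX hornerC; field.
    have H : l i x * (hermite k.+1).[l i x] =
        2^-1 * (hermite k.+2).[l i x] + k.+1%:R * (hermite k).[l i x].
      have := congr1 (horner^~ (l i x)) (@hermite_recurrence R k).
      move: (hermite k) (hermite k.+1) (hermite k.+2) => H0 H1 H2.
      by rewrite hornerM hornerX hornerD !hornerZ.
    by rewrite -[k.+1.-1]/k H mulrDl.
  rewrite (_ : (fun x => _) = (fun x => 2^-1 * hermite_tensor l up x + (alpha i)%:R * hermite_tensor l down x)).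
    by apply: hermite_span_add; apply: hermite_span_scale; exact: hermite_span_base.
  exact/funext.
- under eq_fun do rewrite mulrDr; exact: hermite_span_add.
- under eq_fun do rewrite mulrCA; exact: hermite_span_scale.
Qed.

Lemma hermite_span_sqr i b s F : hermite_span F ->
  hermite_span (fun x => s * (l i x - b) ^+ 2 * F x).
Proof.
move=> sF; have aff G : hermite_span G -> hermite_span (fun x => (l i x - b) * G x).
  move=> sG; rewrite (_ : (fun x => _) = (fun x => l i x * G x + (- b) * G x)).
    by apply: hermite_span_add; [exact: hermite_span_mul_lin|exact: hermite_span_scale].
  by apply/funext => x; ring.
rewrite (_ : (fun x => _) = (fun x => s * ((l i x - b) * ((l i x - b) * F x)))).
  exact: hermite_span_scale (aff _ (aff _ sF)).
by apply/funext => x; ring.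
Qed.

Lemma hermite_span_exp i b s N F : hermite_span F ->
  hermite_span (fun x => series (exp_coeff (- (s * (l i x - b) ^+ 2))) N * F x).
Proof.
move=> sF.
have pow k : hermite_span (fun x => (s * (l i x - b) ^+ 2) ^+ k * F x).
  elim: k => [|k IH]; first by under eq_fun do rewrite expr0 mul1r.
  by under eq_fun do rewrite exprS -mulrA; exact: hermite_span_sqr.
elim: N => [|N IH].
  rewrite (_ : (fun x => _) = (fun x => 0 * F x)); first exact: hermite_span_scale.
  by apply/funext => x; rewrite /series /= big_geq.
rewrite (_ : (fun x => _) = (fun x => series (exp_coeff (- (s * (l i x - b) ^+ 2))) N * F x +
   (((-1) ^+ N / N`!%:R) * ((s * (l i x - b) ^+ 2) ^+ N * F x)))).
  by apply: hermite_span_add => //; exact: hermite_span_scale.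
apply/funext => x; rewrite /series /= big_nat_recr//= mulrDl; congr (_ + _).
rewrite exp_coeffE /= [in LHS]exprNn; ring.
Qed.

Lemma hermite_span_dominated F : hermite_span F -> gauss_dominated l 4^-1 F.
Proof.
elim=> [alpha|{}F G _ sF _ sG|c {}F _ sF].
- exact: hermite_tensor_dominated.
- exact: gauss_dominated_add.
- exact: gauss_dominated_scale.
Qed.

Lemma hermite_span_measurable F : hermite_span F -> measurable_fun setT F.
Proof.
elim=> [alpha|{}F G _ sF _ sG|c {}F _ sF].
- exact: hermite_tensor_measurable.
- exact: measurable_funD.
- exact: measurable_funM.
Qed.

Variable f : X -> R.
Hypothesis Lf : f \in Lfun mu 2%:E.
Hypothesis f_orth : forall alpha, \int[mu]_x (f x * hermite_tensor l alpha x) = 0.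

Let mf : measurable_fun setT f. Proof. exact: Lfun_measurable Lf. Qed.

Definition bounded_fun (m : X -> R) := measurable_fun setT m /\
  exists2 C : R, 0 <= C & forall x, `|m x| <= C.

(* The multipliers of the class of bounded densities m such that f * m is still
   orthogonal to all the Hermite functions will contain every indicator function. *)
Definition annihilated (m : X -> R) := bounded_fun m /\
  forall F, hermite_span F -> \int[mu]_x (f x * m x * F x) = 0.

(** Unlike annihilated functions, multipliers are visibly closed under products; applied to the
    constant 1 they give annihilated functions. *)
Definition multiplier (g : X -> R) := bounded_fun g /\
  forall m, annihilated m -> annihilated (fun x => g x * m x).

Let int_dom a F m : 0 < a -> measurable_fun setT F -> gauss_dominated l a F ->
  bounded_fun m -> intg (fun x => f x * m x * F x).
Proof.
move=> a0 mF dF [mm [C C0 HC]].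
have LF := gauss_dominated_Lfun l_meas frame a0 mF dF.
have iC : intg (fun x => C * (f x * F x)).
  by have := integrableZl measurableT C (Lfun_mul_integrable Lf LF); apply: eq_integrable.
apply: (le_integrable _ _ _ iC) => //.
  by apply/measurable_EFinP; apply: measurable_funM => //; exact: measurable_funM.
move=> x _; rewrite lee_fin !normrM (ger0_norm C0) mulrA [C * _]mulrC -!mulrA ler_wpM2l//.
by rewrite ler_wpM2r.
Qed.

Let int_span F m : hermite_span F -> bounded_fun m -> intg (fun x => f x * m x * F x).
Proof.
move=> sF; apply: (@int_dom 4^-1); first by rewrite invr_gt0.
  exact: hermite_span_measurable.
exact: hermite_span_dominated.
Qed.

Lemma annihilated1 : annihilated (cst 1).
Proof.
have b1 : bounded_fun (cst 1) by split => //; exists 1 => // x; rewrite normr1.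
split=> // F; elim=> [alpha|{}F G sF IF sG IG|c {}F sF IF].
- by under eq_Rintegral do rewrite mulr1.
- by under eq_Rintegral do rewrite mulrDr; rewrite RintegralD ?int_span// IF IG addr0.
- by under eq_Rintegral do rewrite mulrCA; rewrite RintegralZl ?int_span// IF mulr0.
Qed.

Let bounded_mul g m : bounded_fun g -> bounded_fun m -> bounded_fun (fun x => g x * m x).
Proof.
move=> [mg [C C0 HC]] [mm [D D0 HD]]; split; first exact: measurable_funM.
by exists (C * D) => [|x]; rewrite ?mulr_ge0// normrM ler_pM.
Qed.

Let bounded_add g m : bounded_fun g -> bounded_fun m -> bounded_fun (fun x => g x + m x).
Proof.
move=> [mg [C C0 HC]] [mm [D D0 HD]]; split; first exact: measurable_funD.
by exists (C + D) => [|x]; rewrite ?addr_ge0// (le_trans (ler_normD _ _))// lerD.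
Qed.

Lemma multiplier_cst c : multiplier (cst c).
Proof.
have bc : bounded_fun (cst c) by split => //; exists `|c|.
split=> // m [bm m0]; split; first exact: bounded_mul.
move=> F sF; under eq_Rintegral do rewrite mulrCA -mulrA.
by rewrite RintegralZl ?int_span// m0// mulr0.
Qed.

Lemma multiplier_mul g h : multiplier g -> multiplier h -> multiplier (fun x => g x * h x).
Proof.
move=> [bg Hg] [bh Hh]; split; first exact: bounded_mul.
by move=> m /Hh /Hg; under eq_fun do rewrite mulrA.
Qed.

Lemma multiplier_add g h : multiplier g -> multiplier h -> multiplier (fun x => g x + h x).
Proof.
move=> [bg Hg] [bh Hh]; split; first exact: bounded_add.
move=> m /[dup] am [bm _]; have [b1 H1] := Hg m am; have [b2 H2] := Hh m am.
split; first exact: bounded_mul (bounded_add bg bh) bm.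
move=> F sF; have E x : f x * ((g x + h x) * m x) * F x =
   f x * (g x * m x) * F x + f x * (h x * m x) * F x by ring.
under eq_Rintegral do rewrite E.
by rewrite RintegralD ?int_span// H1// H2// addr0.
Qed.

Lemma multiplier_exp g k : multiplier g -> multiplier (fun x => g x ^+ k).
Proof.
move=> mg; elim: k => [|k IH]; first by under eq_fun do rewrite expr0; exact: multiplier_cst.
by under eq_fun do rewrite exprS; exact: multiplier_mul.
Qed.

(** Dominated convergence, with |C f m F| as dominating function. *)
Lemma multiplier_lim (g_ : nat -> X -> R) g C :
  (forall k, multiplier (g_ k)) -> (forall k x, `|g_ k x| <= C) ->
  (forall x, g_ k x @[k --> \oo] --> g x) -> multiplier g.
Proof.
move=> mg gC cg.
have mgf : measurable_fun setT g.
  by apply: (measurable_fun_cvg (h := g_)) => [k|x _]; [case: (mg k) => -[]|exact: cg].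
have gxC x : `|g x| <= C.
  rewrite leNgt; apply/negP => lt.
  have /cvgrPdist_lt/(_ (`|g x| - C)) := cg x; rewrite subr_gt0 => /(_ lt)[N _ /(_ N (leqnn _))] /=.
  by rewrite ltNge; case/negP; apply: le_trans (lerB_dist _ _); rewrite lerD2l lerN2.
have C0 : 0 <= C by apply: le_trans (gC 0%N (0 : X)).
have bg : bounded_fun g by split => //; exists C.
split=> // m /[dup] am [bm _]; split; first exact: bounded_mul.
move=> F sF; have mF := hermite_span_measurable sF.
have bC : bounded_fun (cst C) by split => //; exists C => // x; rewrite ger0_norm.
have iG : intg (fun x => `|f x * (C * m x) * F x|).
  have := int_span sF (bounded_mul bC bm) => /integrable_norm; apply: eq_integrable => //.
have mm : measurable_fun setT m by case: bm.
have mk k : measurable_fun setT (fun x => f x * (g_ k x * m x) * F x).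
  apply: measurable_funM => //; apply: measurable_funM => //; apply: measurable_funM => //.
  by case: (mg k) => -[].
have ck x : f x * (g_ k x * m x) * F x @[k --> \oo] --> f x * (g x * m x) * F x.
  by apply: cvgMl; apply: cvgMr; apply: cvgMl; exact: cg.
have dk k x : `|f x * (g_ k x * m x) * F x| <= `|f x * (C * m x) * F x|.
  by rewrite !normrM ler_wpM2r// ler_wpM2l// ler_wpM2r// (ger0_norm C0).
have [_] := Rdominated_convergence mk ck iG dk.
have z k : \int[mu]_x (f x * (g_ k x * m x) * F x) = 0.
  by have [_ /(_ _ am)[_ ->]] := mg k.
under eq_fun do rewrite z.
by move=> /(cvg_lim (@Rhausdorff R)) <-; rewrite lim_cst//; exact: Rhausdorff.
Qed.

(* For s <= 1/16 the exponential series of the factor is dominated by a Gaussian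
   weaker than the decay of the Hermite functions, so it can be summed termwise. *)
Lemma multiplier_gauss i b s : 0 <= s -> s <= 16^-1 ->
  multiplier (fun x => expR (- (s * (l i x - b) ^+ 2))).
Proof.
move=> s0 s16.
pose t x := s * (l i x - b) ^+ 2.
have t0 x : 0 <= t x by rewrite mulr_ge0// sqr_ge0.
have mt : measurable_fun setT t.
  by apply: measurable_funM => //; apply: measurable_funX; exact: measurable_funB.
have bg : bounded_fun (fun x => expR (- t x)).
  split; first by apply: measurableT_comp => //; exact: measurableT_comp.
  by exists 1 => // x; rewrite ger0_norm ?expR_ge0// -expR0 ler_expR oppr_le0.
split=> // m /[dup] am [bm m0]; split; first exact: bounded_mul.
move=> F sF; have mF := hermite_span_measurable sF; have mm : measurable_fun setT m by case: bm.
(* Since s <= 1/16, the exponent [t x] is at most (l_i^2 + b^2) / 8, which leaves 1/4 - 1/8 = 1/8 of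
   the decay of F. *)
have dF : gauss_dominated l 8^-1 (fun x => expR (t x) * F x).
  have [C C0 HC] := hermite_span_dominated sF.
  exists (C * expR (b ^+ 2 / 8)); first by rewrite mulr_ge0 ?expR_ge0.
  move=> x; rewrite normrM (ger0_norm (expR_ge0 _)) mulrC.
  apply: (le_trans (ler_wpM2r (expR_ge0 _) (HC x))).
  rewrite -!mulrA -!expRD ler_wpM2l// ler_expR.
  have ti : t x <= 8^-1 * l i x ^+ 2 + b ^+ 2 / 8.
    apply: (@le_trans _ _ (16^-1 * (l i x - b) ^+ 2)); first by rewrite ler_wpM2r// sqr_ge0.
    by have := sqr_ge0 (l i x + b); nra.
  have qi : l i x ^+ 2 <= quad l x.
    by rewrite /quad (bigD1 i)//= lerDl sumr_ge0// => j _; exact: sqr_ge0.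
  nra.
pose u N x := series (exp_coeff (- t x)) N.
have mu_ N : measurable_fun setT (u N).
  apply: measurable_sum => k; under eq_fun do rewrite exp_coeffE.
  by apply: measurable_funM => //; apply: measurable_funX; exact: measurableT_comp.
have mk k : measurable_fun setT (fun x => f x * (u k x * m x) * F x).
  by apply: measurable_funM => //; apply: measurable_funM => //; exact: measurable_funM.
have ck x : f x * (u k x * m x) * F x @[k --> \oo] --> f x * (expR (- t x) * m x) * F x.
  apply: cvgMl; apply: cvgMr; apply: cvgMl; exact: is_cvg_series_exp_coeff.
have iG : intg (fun x => `|f x * m x * (expR (t x) * F x)|).
  have i8 : 0 < (8^-1 : R) by rewrite invr_gt0.
  have mE : measurable_fun setT (fun x => expR (t x) * F x).
    by apply: measurable_funM => //; exact: measurableT_comp.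
  have := int_dom i8 mE dF bm => /integrable_norm; apply: eq_integrable => //.
have dk k x : `|f x * (u k x * m x) * F x| <= `|f x * m x * (expR (t x) * F x)|.
  rewrite !normrM (ger0_norm (expR_ge0 _)) -!mulrA ler_wpM2l// mulrCA ler_wpM2l//.
  by rewrite ler_wpM2r// -[in leRHS](ger0_norm (t0 x)); exact: exp_coeff_partial_le.
have [_] := Rdominated_convergence mk ck iG dk.
have z k : \int[mu]_x (f x * (u k x * m x) * F x) = 0.
  rewrite -(m0 _ (hermite_span_exp i b s k sF)); apply: eq_Rintegral => x _.
  by rewrite -/(t x) -/(u k x); ring.
under eq_fun do rewrite z.
by move=> /(cvg_lim (@Rhausdorff R)) <-; rewrite lim_cst//; exact: Rhausdorff.
Qed.

(* A power a of a Gaussian multiplier equals 1/2 exactly where |l i x - b| = r;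
   cvg_step turns it into the indicator of {a < 1/2}. *)
Lemma multiplier_indic_far i b r : 0 < r -> multiplier (\1_[set x | r < `|l i x - b|]).
Proof.
move=> r0; have r20 : 0 < r ^+ 2 by exact: exprn_gt0.
have ln20 : 0 < ln 2 :> R by rewrite ln_gt0// ltr1n.
(* [j] is large enough for s = ln 2 / (r^2 j) to be at most 1/16; the j-th power of the Gaussian is
   then 2 to the power -(l_i x - b)^2 / r^2. *)
pose j := (Num.truncn (16 * ln 2 / r ^+ 2)).+1.
have j0 : 0 < j%:R :> R by rewrite ltr0n.
have jr : 16 * ln 2 / r ^+ 2 < j%:R.
  by have /andP[] := truncn_itv (ltW (divr_gt0 (mulr_gt0 (ltr0n R 16) ln20) r20)).
pose s := ln 2 / r ^+ 2 / j%:R.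
have s0 : 0 <= s by rewrite ltW// !divr_gt0.
have s16 : s <= 16^-1.
  by rewrite ler_pdivrMr//; lra.
pose a x := expR (- (s * (l i x - b) ^+ 2)) ^+ j.
have ma : multiplier a by apply: multiplier_exp; exact: multiplier_gauss.
have aE x : a x = expR (- (ln 2 * ((l i x - b) ^+ 2 / r ^+ 2))).
  by rewrite /a -expRM_natl /s; congr expR; field; rewrite !gt_eqF.
have a01 x : 0 <= a x <= 1.
  rewrite aE expR_ge0/= -[leRHS]expR0 ler_expR oppr_le0 mulr_ge0 ?(ltW ln20)//.
  by rewrite divr_ge0 ?sqr_ge0.
have ak k x : 0 <= a x ^+ k <= 1.
  by case/andP: (a01 x) => ? ?; rewrite exprn_ge0//= exprn_ile1.
apply: (@multiplier_lim (fun k x => (1 - a x ^+ k) ^+ (k * 2 ^ k)) _ 1).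
- move=> k; apply: multiplier_exp; apply: multiplier_add; first exact: multiplier_cst.
  have := multiplier_mul (multiplier_cst (-1)) (multiplier_exp k ma).
  by under eq_fun do rewrite mulN1r.
- move=> k x; case/andP: (ak k x) => ? ?.
  by rewrite ger0_norm ?exprn_ge0 ?subr_ge0// exprn_ile1// ?subr_ge0// gerBl.
- move=> x; have := cvg_step (a01 x); congr (_ --> _).
  rewrite indicE; congr (_%:R); congr nat_of_bool.
  rewrite (_ : (x \in _) = (r < `|l i x - b|)); last by apply/idP/idP; rewrite inE.
  have h : 2^-1 = expR (- ln 2) :> R by rewrite expRN lnK ?posrE.
  rewrite aE h ltr_expR ltrN2 -[ltLHS]mulr1 ltr_pM2l// ltr_pdivlMr// mul1r.
  rewrite -[(l i x - b) ^+ 2]real_normK ?num_real//.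
  by apply: ltr_pXn2r; rewrite ?nnegrE ?normr_ge0 ?(ltW r0).
Qed.

Definition indic_multiplier (E : set X) := measurable E /\ multiplier (\1_E).

Lemma indic_multiplier_sigma_algebra : sigma_algebra setT indic_multiplier.
Proof.
have C E : indic_multiplier E -> multiplier (fun x => 1 - \1_E x).
  move=> [_ mE]; apply: multiplier_add; first exact: multiplier_cst.
  have := multiplier_mul (multiplier_cst (-1)) mE.
  by under eq_fun do rewrite mulN1r.
split.
- split=> //; rewrite indic0; exact: multiplier_cst.
- move=> E gE; split; first by apply: measurableD => //; case: gE.
  rewrite (_ : \1__ = (fun x => 1 - \1_E x)); first exact: C.
  apply/funext => x; rewrite setTD !indicE in_setC.
  by case: (x \in E); rewrite /= ?subrr ?subr0.
- move=> E gE; split; first by apply: bigcup_measurable => k _; case: (gE k).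
  (* The indicator of the complement of a finite union; 1 - P k tends pointwise to the indicator of
     the whole union. *)
  pose P k x := \prod_(j < k) (1 - \1_(E j) x) : R.
  have mP k : multiplier (P k).
    elim: k => [|k IH]; first by rewrite /P; under eq_fun do rewrite big_ord0; exact: multiplier_cst.
    rewrite (_ : P k.+1 = fun x => P k x * (1 - \1_(E k) x)).
      by apply: multiplier_mul => //; exact: C.
    by apply/funext => x; rewrite /P big_ord_recr.
  have P01 k x : 0 <= P k x <= 1.
    have h (j : 'I_k) : 0 <= (1 - \1_(E j) x : R) <= 1.
      by rewrite indicE; case: (x \in E j); rewrite /= ?subrr ?subr0 ?lexx ?ler01.
    by rewrite prodr_ge0 ?prodr_ile1// => j _; case/andP: (h j).
  apply: (@multiplier_lim (fun k x => 1 - P k x) _ 1).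
  + move=> k; apply: multiplier_add; first exact: multiplier_cst.
    have := multiplier_mul (multiplier_cst (-1)) (mP k).
    by under eq_fun do rewrite mulN1r.
  + by move=> k x; case/andP: (P01 k x) => ? ?; rewrite ger0_norm ?subr_ge0// gerBl.
  + move=> x; rewrite indicE; case: (boolP (x \in _)) => [|/negP] xE.
      move: xE; rewrite inE => -[k _ Ekx]; apply: cvg_near_cst; exists k.+1 => // N /= kN.
      rewrite /P (bigD1 (Ordinal kN))//= indicE mem_set// subrr mul0r subr0 //.
    apply: cvg_near_cst; apply: nearW => N; rewrite /P big1 ?subrr// => j _.
    rewrite indicE memNset ?subr0// => Ejx; apply: xE; rewrite inE; exists j => //.
Qed.

(** On X with the sigma-algebra of the sets whose indicator is a multiplier, each l_i is measurable.
    By [frame] so is every entry, hence the identity map to X with its usual sigma-algebra. *)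
Lemma indic_multiplier_measurable E : measurable E -> indic_multiplier E.
Proof.
move=> mE; have sG := indic_multiplier_sigma_algebra; have [s0 sC sU] := sG.
pose T := g_sigma_algebraType indic_multiplier.
have TE (F : set T) : measurable F <-> indic_multiplier F by rewrite measurable_g_measurableTypeE.
have ml i : measurable_fun setT (l i : T -> R).
  apply: (measurability (@RGenCInfty.G R)) => [|/= _ [_] [c] -> <-].
    exact: RGenCInfty.measurableE.
  rewrite setTI; apply/TE.
  (* The half-line [c, +oo) is the union of the intervals [c, c + 2(k+1)], complements of the sets
     of [multiplier_indic_far]. *)
  rewrite (_ : _ @^-1` _ = \bigcup_k (setT `\` [set x | k.+1%:R < `|l i x - (c + k.+1%:R)|])).
    apply: sU => k; apply: sC; split; last exact: multiplier_indic_far.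
    rewrite (_ : [set x | _] = (fun x => `|l i x - (c + k.+1%:R)|) @^-1` `]k.+1%:R, +oo[).
      rewrite -[X in measurable X]setTI; apply: (_ : measurable_fun setT _) => //.
      by apply: measurableT_comp => //; exact: measurable_funB.
    by apply/seteqP; split=> x /=; rewrite in_itv/= andbT.
  apply/seteqP; split=> x /=; rewrite in_itv/= andbT.
    move=> cx; exists (Num.truncn (l i x - c)) => //=; split => //; apply/negP; rewrite -leNgt.
    have /andP[t1 t2] : (Num.truncn (l i x - c))%:R <= l i x - c < (Num.truncn (l i x - c)).+1%:R.
      by apply: truncn_itv; rewrite subr_ge0.
    by rewrite ler_norml; apply/andP; split; lra.
  move=> [k _ [_ /negP]]; rewrite -leNgt ler_norml => /andP[h _]; lra.
have xE (x : X) : x = (\sum_i l i x *: (dual i).1, \sum_i l i x *: (dual i).2).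
  rewrite {1}(frame x) [LHS]surjective_pairing; congr pair.
    by elim/big_rec2: _ => // i a b _ <-.
  by elim/big_rec2: _ => // i a b _ <-.
have mid : measurable_fun setT (id : T -> X).
  apply/measurable_fun_pairP; split; apply: measurable_fun_matrix => a b.
    rewrite (_ : (fun s => _) = fun s => \sum_i l i s * (dual i).1 a b).
      by apply: measurable_sum => i; exact: measurable_funM.
    apply/funext => x; rewrite /= [in LHS](xE x) /= summxE.
    by apply: eq_bigr => i _; rewrite mxE.
  rewrite (_ : (fun s => _) = fun s => \sum_i l i s * (dual i).2 a b).
    by apply: measurable_sum => i; exact: measurable_funM.
  apply/funext => x; rewrite /= [in LHS](xE x) /= summxE.
  by apply: eq_bigr => i _; rewrite mxE.
by apply/TE; have := mid measurableT _ mE; rewrite setTI.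
Qed.

(** The sign of f is a multiplier. Testing it against the Gaussian H > 0 gives that the integral of
    |f H| is 0. *)
Lemma hermite_total : {ae mu, forall x, f x = 0}.
Proof.
pose E := [set x | 0 <= f x]; pose H := hermite_tensor l (fun=> 0%N).
have H0 x : 0 < H x.
  apply: prodr_gt0 => i _; rewrite /hermite_fun /gauss_poly -[hermite 0]/(1%:P : {poly R}).
  by rewrite hornerC mul1r expR_gt0.
have mE : measurable E by rewrite -[E]setTI; exact: measurable_fun_le.
have [_ mI] := indic_multiplier_measurable mE.
have ms : multiplier (fun x => 2 * \1_E x + (-1)).
  apply: multiplier_add; last exact: multiplier_cst.
  by apply: multiplier_mul mI; exact: multiplier_cst.
have sH : hermite_span H by exact: hermite_span_base.
have [_ /(_ _ annihilated1)[bs /(_ _ sH)]] := ms.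
have -> : \int[mu]_x (f x * ((2 * \1_E x + -1) * cst 1 x) * H x) = \int[mu]_x `|f x * H x|.
  apply: eq_Rintegral => x _; rewrite normrM (gtr0_norm (H0 x)) mulr1; congr (_ * _).
  rewrite indicE; case: (boolP (x \in _)) => [|/negP]; rewrite inE /E /= => xE.
    by rewrite ger0_norm//; ring.
  by rewrite ltr0_norm ?ltNge; [ring|exact/negP].
have LH := gauss_dominated_Lfun l_meas frame (ltac:(by rewrite invr_gt0) : 0 < 4^-1 :> R)
   (hermite_span_measurable sH) (hermite_span_dominated sH).
have iH := Lfun_mul_integrable Lf LH.
move=> I0; have mfH : measurable_fun setT (EFin \o (fun x => f x * H x)) by exact: measurable_int iH.
have : (\int[mu]_x `|(EFin \o (fun x => f x * H x)%R) x| = 0)%E.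
  rewrite -[LHS]fineK; first exact: (congr1 EFin I0).
  rewrite ge0_fin_numE ?integral_ge0//.
  by case/integrableP: iH.
move/(ae_eq_integral_abs mu measurableT mfH); apply: filterS => x /(_ Logic.I) /= [] /eqP.
by rewrite mulf_eq0 (gt_eqF (H0 x)) orbF => /eqP.
Qed.

End hermite_total.

(** * Diagonalization of symmetric matrices *)

Section symmetric_matrices.
Context {R : rcfType}.

Let row_norm n (v : 'rV[R]_n) : R := (v *m v^T) 0 0.

Let row_normE n (v : 'rV[R]_n) : v *m v^T = (row_norm v)%:M.
Proof. by rewrite [LHS]mx11_scalar. Qed.

Let row_norm_sum n (v : 'rV[R]_n) : row_norm v = \sum_i v 0 i ^+ 2.
Proof. by rewrite /row_norm mxE; apply: eq_bigr => i _; rewrite mxE expr2. Qed.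

Let row_norm_gt0 n (v : 'rV[R]_n) : v != 0 -> 0 < row_norm v.
Proof.
move=> v0; rewrite lt_neqAle eq_sym row_norm_sum sumr_ge0 ?andbT; last by move=> i _; exact: sqr_ge0.
apply: contra v0; rewrite psumr_eq0 => [/allP v0|i _]; last exact: sqr_ge0.
apply/eqP/rowP => i; rewrite mxE; apply/eqP.
by rewrite -sqrf_eq0; apply: v0; rewrite mem_index_enum.
Qed.

(* H is the Householder reflection exchanging v and the first basis vector. *)
Lemma orthogonal_first_row n (v : 'rV[R]_n.+1) : v *m v^T = 1%:M ->
  exists2 H : 'M[R]_n.+1, H *m H^T = 1%:M & row 0 H = v.
Proof.
move=> v1; pose e : 'rV[R]_n.+1 := delta_mx 0 0; pose u := v - e.
have [u0|u0] := eqVneq u 0.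
  exists 1%:M; first by rewrite trmx1 mulmx1.
  by rewrite row1; apply/esym/eqP; rewrite -subr_eq0 -/u u0.
have N0 : row_norm u != 0 by rewrite gt_eqF// row_norm_gt0.
pose c := 2 / row_norm u; pose H := 1%:M - c *: (u^T *m u).
have HT : H^T = H by rewrite /H linearB linearZ/= trmx1 trmx_mul trmxK.
have e1 : e *m e^T = 1%:M.
  by rewrite [LHS]mx11_scalar /e trmx_delta mul_delta_mx mxE eqxx.
have ev : v *m e^T = (v 0 0)%:M.
  by rewrite [LHS]mx11_scalar /e trmx_delta -colE mxE.
have ve : e *m v^T = (v 0 0)%:M by rewrite -[LHS]trmxK trmx_mul trmxK ev tr_scalar_mx.
have uE : row_norm u = 2 - 2 * v 0 0.
  rewrite /row_norm /u linearB /= mulmxBl !mulmxBr v1 e1 ev ve !mxE eqxx /=; ring.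
exists H.
  have WW : (u^T *m u) *m (u^T *m u) = row_norm u *: (u^T *m u).
    by rewrite mulmxA -[u^T *m u *m _]mulmxA row_normE scalar_mxC mul_scalar_mx -scalemxAl.
  have cc : c * c * row_norm u = c + c by rewrite /c; field.
  rewrite HT /H; move: (u^T *m u) WW => W WW.
  rewrite mulmxBl mul1mx mulmxBr mulmx1 -!scalemxAl -!scalemxAr WW !scalerA cc.
  by rewrite scalerDl opprB addrK subrK.
rewrite rowE -/e /H mulmxBr mulmx1 -scalemxAr mulmxA.
have -> : e *m u^T = (v 0 0 - 1)%:M by rewrite /u linearB/= mulmxBr ve e1 raddfB.
(* As v and e are unit vectors, |u|^2 = 2 - 2 v_0; hence e H = e + u = v. *)
rewrite mul_scalar_mx scalerA.
have -> : c * (v 0 0 - 1) = -1.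
  have := N0; rewrite /c uE => N0'; field; first exact: N0'.
by rewrite scaleN1r opprK addrC subrK.
Qed.

Lemma char_poly_similar n (P Q A : 'M[R]_n) : P *m Q = 1%:M ->
  char_poly (P *m A *m Q) = char_poly A.
Proof.
move=> PQ; rewrite /char_poly /char_poly_mx.
have PQ' : map_mx polyC P *m map_mx polyC Q = 1%:M by rewrite -map_mxM PQ map_mx1.
have -> : 'X%:M - map_mx polyC (P *m A *m Q) =
    map_mx polyC P *m ('X%:M - map_mx polyC A) *m map_mx polyC Q.
  by rewrite mulmxBr mulmxBl !map_mxM scalar_mxC -[_ *m _ *m map_mx polyC Q in RHS]mulmxA PQ' mulmx1.
by rewrite !det_mulmx mulrAC -det_mulmx PQ' det1 mul1r.
Qed.

(** Deflation: a unit eigenvector for [a 0] becomes the first row of an orthogonal matrix, and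
    symmetry clears the first row and column. Cancelling 'X - a 0 in the characteristic polynomial
    leaves the prescribed remaining eigenvalues for the lower block. *)
Lemma symmetric_diagonalization n (A : 'M[R]_n) (a : 'I_n -> R) : A^T = A ->
  char_poly A = \prod_(i < n) ('X - (a i)%:P) ->
  exists2 Q : 'M[R]_n, Q *m Q^T = 1%:M & Q *m A *m Q^T = diag_mx (\row_i a i).
Proof.
elim: n A a => [|n IH] A a AT Achar.
  by exists 1%:M; apply/matrixP => -[].
have : root (char_poly A) (a 0) by rewrite Achar big_ord_recl rootM root_XsubC eqxx.
rewrite -eigenvalue_root_char => /eigenvalueP[v0 v0A v00].
have [v vA v1] : exists2 v : 'rV[R]_n.+1, v *m A = a 0 *: v & v *m v^T = 1%:M.
  have N0 := row_norm_gt0 v00.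
  exists ((Num.sqrt (row_norm v0))^-1 *: v0); first by rewrite -scalemxAl v0A !scalerA mulrC.
  rewrite linearZ/= -scalemxAl -scalemxAr scalerA row_normE scale_scalar_mx.
  by rewrite -invfM -expr2 sqr_sqrtr ?ltW// mulVf// gt_eqF.
have [H HHT Hv] := orthogonal_first_row v1.
have HTH : H^T *m H = 1%:M by exact: mulmx1C.
have [B Bdef] : exists B, B = H *m A *m H^T by exists (H *m A *m H^T).
have BT : B^T = B by rewrite Bdef !trmx_mul trmxK AT mulmxA.
have B0 : row 0 B = a 0 *: delta_mx 0 0.
  by rewrite Bdef !row_mul Hv vA -scalemxAl -Hv -row_mul HHT row1.
have B0j j : B 0 j = a 0 * (j == 0)%:R.
  by have /rowP/(_ j) := B0; rewrite !mxE eqxx /= eq_sym.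
have Bj0 j : B j 0 = a 0 * (j == 0)%:R by rewrite -[B]BT mxE B0j.
pose A' : 'M[R]_n := drsubmx (B : 'M[R]_(1 + n)).
have lift0 (i : 'I_n) : (rshift 1 i == 0 :> 'I_(1 + n)) = false by apply/negbTE.
have l0 (i : 'I_1) : lshift n i = 0 :> 'I_(1 + n) by rewrite ord1; exact: val_inj.
have BE : (B : 'M[R]_(1 + n)) = block_mx (a 0)%:M 0 0 A'.
  rewrite -[LHS](@submxK _ 1 n 1 n); congr block_mx.
  - by apply/matrixP => i j; rewrite !ord1 !mxE l0 B0j eqxx mulr1.
  - by apply/matrixP => i j; rewrite !mxE l0 B0j lift0 mulr0.
  - by apply/matrixP => i j; rewrite !mxE l0 Bj0 lift0 mulr0.
have A'T : A'^T = A' by rewrite /A' trmx_drsub BT.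
have A'char : char_poly A' = \prod_(i < n) ('X - (a (lift ord0 i))%:P).
  have := char_poly_similar A HHT; rewrite -Bdef Achar big_ord_recl.
  rewrite /char_poly /char_poly_mx.
  have -> : 'X%:M - map_mx polyC B = block_mx ('X - (a 0)%:P)%:M 0 0 (char_poly_mx A') :> 'M[{poly R}]_(1 + n).
    rewrite BE (@map_block_mx _ _ polyC 1 n 1 n) !map_mx0 map_scalar_mx [LHS]/=.
    rewrite (scalar_mx_block 1 n) (@opp_block_mx _ 1 n 1 n) (@add_block_mx _ 1 n 1 n).
    by rewrite !oppr0 !addr0 /char_poly_mx raddfB.
  rewrite (@det_ublock _ 1 n) det_scalar1 => /mulfI; apply.
  by rewrite polyXsubC_eq0.
have [Q QQT QA] := IH A' (a \o lift ord0) A'T A'char.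
pose P : 'M[R]_(1 + n) := block_mx 1%:M 0 0 Q.
have PT : P^T = block_mx 1%:M 0 0 Q^T by rewrite /P tr_block_mx trmx1 !trmx0.
have PPT : P *m P^T = 1%:M.
  by rewrite PT /P mulmx_block !mul1mx !mulmx0 !mul0mx !addr0 add0r QQT -scalar_mx_block.
exists ((P : 'M[R]_n.+1) *m H).
  by rewrite trmx_mul mulmxA -[P *m H *m H^T]mulmxA HHT mulmx1.
rewrite trmx_mul !mulmxA -[P *m H *m A]mulmxA -[P *m _ *m H^T]mulmxA -Bdef.
rewrite BE PT /P (@mulmx_block _ 1 n 1 n 1 n) !mul1mx !mulmx0 !mul0mx !addr0 !add0r.
rewrite (@mulmx_block _ 1 n 1 n 1 n) !mulmx1 !mulmx0 !mul0mx !addr0 !add0r QA.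
have r (k : 'I_n) : rshift 1 k = lift ord0 k :> 'I_(1 + n) by exact: val_inj.
rewrite -[RHS](@submxK _ 1 n 1 n); apply: (f_equal4 (@block_mx R 1 n 1 n)); apply/matrixP => i j; rewrite !mxE.
- by rewrite !ord1 !l0 !eqxx.
- by rewrite l0 eq_sym lift0 mulr0n.
- by rewrite l0 lift0 mulr0n.
- by rewrite (inj_eq (@rshift_inj 1 n)) /= r.
Qed.

End symmetric_matrices.

(** * The closure of the oscillator *)

Lemma closureP (K : numFieldType) (V W : normedModType K) (A : set (V * W)) (u : V) (v : W) :
  closure A (u, v) <-> forall eps : K, 0 < eps -> exists u' v',
    [/\ A (u', v'), `|u' - u| < eps & `|v' - v| < eps].
Proof.
split=> [cA eps e0|H B /nbhs_ballP[eps /= e0 Beps]].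
  have [[u' v'] [Auv]] := cA _ (nbhsx_ballx (u, v) _ e0).
  case; rewrite -!ball_normE /ball_ /= => uu vv.
  by exists u', v'; split; rewrite // distrC.
have [u' [v' [Auv uu vv]]] := H _ e0; exists (u', v'); split => //.
by apply: Beps; split; rewrite -ball_normE /ball_ /= distrC.
Qed.

Lemma L2_dominated_cvg d (T : measurableType d) (R : realType)
    (mu : {measure set T -> \bar R}) (f : nat -> T -> R) (g G : T -> R)
    (Lf : forall k, f k \in Lfun mu 2%:E) (Lg : g \in Lfun mu 2%:E) :
  G \in Lfun mu 2%:E -> (forall x, f k x @[k --> \oo] --> g x) ->
  (forall k x, `|f k x| <= G x) ->
  forall eps : R[i], 0 < eps -> exists N, forall k, (N <= k)%N ->
    `|L2class (L2_of_real (Lf k)) - L2class (L2_of_real Lg)| < eps.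
Proof.
move=> LG fg fG eps eps0.
have epsE : eps = (complex.Re eps)%:C by rewrite RRe_real// gtr0_real.
have e0 : 0 < complex.Re eps by rewrite -ltcR -epsE.
have gG x : `|g x| <= G x.
  by apply: (cvgr_to_le (cvg_norm (fg x))); exact: nearW.
have mD k : measurable_fun setT (fun x => (f k x - g x) ^+ 2).
  by apply: measurable_funX; exact: Lfun_measurable (LfunB (Lf k) Lg).
have cD x : (f k x - g x) ^+ 2 @[k --> \oo] --> (0 : R).
  have c0 : f k x - g x @[k --> \oo] --> (0 : R).
    by rewrite -(subrr (g x)); apply: cvgB => //; exact: cvg_cst.
  by rewrite -(mulr0 0); under eq_fun do rewrite expr2; exact: cvgM.
have iG : mu.-integrable setT (EFin \o (fun x => 4 * (G x * G x))).
  by have := integrableZl measurableT 4 (Lfun_mul_integrable LG LG); apply: eq_integrable.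
have dD k x : `|(f k x - g x) ^+ 2| <= 4 * (G x * G x).
  rewrite normrX [leRHS](_ : _ = (2 * G x) ^+ 2); last by ring.
  have := fG k x; have := gG x => h1 h2; have := ler_normB (f k x) (g x) => h3.
  have G0 : 0 <= G x by apply: le_trans h1.
  by rewrite lerXn2r ?nnegrE ?mulr_ge0//; lra.
have [_] := Rdominated_convergence mD cD iG dD.
rewrite Rintegral_cst// mul0r => /cvgrPdist_lt/(_ (complex.Re eps ^+ 2)).
rewrite exprn_gt0// => /(_ isT)[N _ HN]; exists N => k /HN /=; rewrite sub0r normrN => lt.
rewrite -L2classB -(@ltr_pXn2r _ 2)// ?nnegrE ?(ltW eps0)// L2_norm_sqr epsE -rmorphXn ltcR.
rewrite (le_lt_trans (ler_norm _))//; congr (`|_| < _): lt.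
by apply: eq_Rintegral => x _; rewrite L2fun_subE /= subr0 expr0n addr0.
Qed.

Section smooth_linear.
Context {R : realType} {V : normedModType R}.

Lemma derive_linear (f g : V -> R) a b v : (forall x, derivable f x v) ->
  (forall x, derivable g x v) ->
  (forall x, derivable (fun y => a * f y + b * g y) x v) /\
  'D_v (fun x => a * f x + b * g x) = (fun x => a * 'D_v f x + b * 'D_v g x).
Proof.
move=> df dg.
have D x : is_derive x v (fun y => a * f y + b * g y) (a * 'D_v f x + b * 'D_v g x).
  have /derivableP dfx := df x; have /derivableP dgx := dg x.
  exact: (is_deriveD (is_deriveZ a dfx) (is_deriveZ b dgx)).
by split=> [x|]; [case: (D x)|apply/funext => x; exact: derive_val].
Qed.

Lemma smooth_linear (f g : V -> R) a b : smooth f -> smooth g ->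
  smooth (fun x => a * f x + b * g x).
Proof.
move=> sf sg.
have E s : iter_derive s (fun x => a * f x + b * g x) =
    (fun x => a * iter_derive s f x + b * iter_derive s g x).
  elim: s => //= v s ->; have [_ df] := sf s; have [_ dg] := sg s.
  by have [_ ->] := derive_linear a b (fun x => df x v) (fun x => dg x v).
move=> s; rewrite E; have [cf df] := sf s; have [cg dg] := sg s; split=> [x|x v].
  by apply: cvgD; apply: cvgMr; [exact: cf|exact: cg].
by have [+ _] := derive_linear a b (fun x => df x v) (fun x => dg x v); exact.
Qed.

Lemma smooth_cst (r : R) : smooth (cst r : V -> R).
Proof.
have E s : iter_derive s (cst r : V -> R) = cst (if s is [::] then r else 0).
  elim: s => //= v s ->; apply/funext => x; exact: derive_cst.
by move=> s; rewrite E; split=> [x|x v]; [exact: cvg_cst|exact: derivable_cst].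
Qed.

Lemma smooth_derivable (f : V -> R) : smooth f ->
  (forall x v, derivable f x v) /\ (forall x u v, derivable ('D_u f) x v).
Proof. by move=> sf; split=> [|x u]; [case: (sf [::])|case: (sf [:: u]) => _; exact]. Qed.

Lemma test_function_linear (a : R[i]) (f g : V -> R[i]) : test_function f ->
  test_function g -> test_function (a *: f + g).
Proof.
move=> [rf jf cf] [rg jg cg]; split.
- rewrite (_ : (fun x => _) = fun x => 1 * (complex.Re a * complex.Re (f x) +
     (- complex.Im a) * complex.Im (f x)) + 1 * complex.Re (g x)).
    exact: (smooth_linear 1 1 (smooth_linear _ _ rf jf) rg).
  apply/funext => x; rewrite !fctE /=.
  by case: a (f x) (g x) => [a1 a2] [b1 b2] [c1 c2] /=; rewrite !mul1r mulNr.
- rewrite (_ : (fun x => _) = fun x => 1 * (complex.Re a * complex.Im (f x) +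
     complex.Im a * complex.Re (f x)) + 1 * complex.Im (g x)).
    exact: (smooth_linear 1 1 (smooth_linear _ _ jf rf) jg).
  apply/funext => x; rewrite !fctE /=.
  by case: a (f x) (g x) => [a1 a2] [b1 b2] [c1 c2] /=; rewrite !mul1r.
- apply: (@subclosed_compact _ _ (closure [set x | f x != 0] `|` closure [set x | g x != 0])).
  + exact: closed_closure.
  + exact: compactU.
  + rewrite -closureU; apply: closure_subset => x /= fgx.
    have [fx|] := eqVneq (f x) 0; last by left.
    by right; apply: contra_neq fgx => gx; rewrite !fctE fx gx scaler0 addr0.
Qed.

End smooth_linear.

(** * The closed operator in adapted coordinates *)

Section frame_oscillator.
Context {R : realType} {n p : nat} {I K : finType}.
Local Notation X := ('cV[R]_n * 'cV[R]_p)%type.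
Local Notation mu := (@lebesgue_xy R n p).
Variables (l : I -> X -> R) (dual : I -> X).
Hypothesis l_lin : forall i a x y, l i (a *: x + y) = a * l i x + l i y.
Hypothesis l_cont : forall i, continuous (l i).
Hypothesis l_meas : forall i, measurable_fun setT (l i).
Hypothesis frame : forall x, x = \sum_i l i x *: dual i.
Hypothesis dual_id : forall i j, l i (dual j) = (i == j)%:R.
Variables (c : K -> R) (e : K -> X) (nu : I -> R).
Hypothesis nu_gt0 : forall i, 0 < nu i.
Hypothesis orth : forall i j, \sum_k c k * (l i (e k) * l j (e k)) = nu i *+ (i == j).
Variables (h : R) (A : 'M[R]_n) (B : 'M[R]_p).
Local Notation S := (schrodinger l c e nu).
Local Notation H := (oscillator h A B).
(** The coefficients of the operator are real, so it acts separately on real and imaginary parts. *)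
Hypothesis oscillator_Re : forall f x,
  complex.Re (oscillator_expr h A B f x) = S (fun y => complex.Re (f y)) x.
Hypothesis oscillator_Im : forall f x,
  complex.Im (oscillator_expr h A B f x) = S (fun y => complex.Im (f y)) x.

Lemma schrodinger_linear (f g : X -> R) a b x : smooth f -> smooth g ->
  S (fun y => a * f y + b * g y) x = a * S f x + b * S g x.
Proof.
move=> /smooth_derivable[df d2f] /smooth_derivable[dg d2g].
have ring1 r s t : r * (a * s + b * t) = a * (r * s) + b * (r * t) by ring.
have ring2 r s s' t t' :
  r * (a * s + b * t) - (a * s' + b * t') = a * (r * s - s') + b * (r * t - t') by ring.
have E k : 'D_(e k) ('D_(e k) (fun y => a * f y + b * g y)) x =
    a * 'D_(e k) ('D_(e k) f) x + b * 'D_(e k) ('D_(e k) g) x.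
  have [_ ->] := derive_linear a b (fun x => df x (e k)) (fun x => dg x (e k)).
  have [_ D2] := derive_linear a b (fun x => d2f x (e k) (e k)) (fun x => d2g x (e k) (e k)).
  exact: (congr1 (fun F => F x) D2).
have E' : \sum_k c k * 'D_(e k) ('D_(e k) (fun y => a * f y + b * g y)) x =
    a * (\sum_k c k * 'D_(e k) ('D_(e k) f) x) + b * (\sum_k c k * 'D_(e k) ('D_(e k) g) x).
  rewrite !mulr_sumr -big_split /=; apply: eq_bigr => k _.
  exact: etrans (congr1 (fun t => c k * t) (E k)) (ring1 _ _ _).
exact: etrans (congr1 (fun t => potential l nu x * (a * f x + b * g x) - t) E') (ring2 _ _ _ _ _).
Qed.

Lemma schrodinger_linear3 (f g k : X -> R) a b x : smooth f -> smooth g -> smooth k ->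
  S (fun y => a * f y + b * g y + k y) x = a * S f x + b * S g x + S k x.
Proof.
move=> sf sg sk; have one (r s : R) : 1 * r + 1 * s = r + s by rewrite !mul1r.
have -> : (fun y => a * f y + b * g y + k y) = (fun y => 1 * (a * f y + b * g y) + 1 * k y).
  by apply/funext => y; rewrite one.
apply: etrans (schrodinger_linear 1 1 x (smooth_linear a b sf sg) sk) _.
exact: etrans (one _ _) (congr1 (fun t => t + S k x) (schrodinger_linear a b x sf sg)).
Qed.

Lemma oscillator_expr_linear (f g : X -> R[i]) a : test_function f -> test_function g ->
  oscillator_expr h A B (a *: f + g) = a *: oscillator_expr h A B f + oscillator_expr h A B g.
Proof.
move=> [rf jf _] [rg jg _]; apply/funext => x; rewrite !fctE.
have E1 : complex.Re (oscillator_expr h A B (a *: f + g) x) =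
    complex.Re a * S (fun y => complex.Re (f y)) x +
    (- complex.Im a) * S (fun y => complex.Im (f y)) x + S (fun y => complex.Re (g y)) x.
  apply: etrans (oscillator_Re _ _) _; apply: etrans (schrodinger_linear3 _ _ x rf jf rg).
  congr (S _ x); apply/funext => y; rewrite !fctE /=.
  by case: a (f y) (g y) => [a1 a2] [b1 b2] [c1 c2] /=; rewrite mulNr.
have E2 : complex.Im (oscillator_expr h A B (a *: f + g) x) =
    complex.Re a * S (fun y => complex.Im (f y)) x +
    complex.Im a * S (fun y => complex.Re (f y)) x + S (fun y => complex.Im (g y)) x.
  apply: etrans (oscillator_Im _ _) _; apply: etrans (schrodinger_linear3 _ _ x jf rf jg).
  congr (S _ x); apply/funext => y; rewrite !fctE /=.
  by case: a {E1} (f y) (g y) => [a1 a2] [b1 b2] [c1 c2] /=.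
apply/eqP; rewrite eq_complex E1 E2 -!oscillator_Re -!oscillator_Im.
case: a {E1 E2} (oscillator_expr _ _ _ f x) (oscillator_expr _ _ _ g x) => [a1 a2] [b1 b2] [c1 c2].
by rewrite /= mulNr !eqxx.
Qed.

Lemma oscillator_closed u v : (forall eps : R[i], 0 < eps -> exists u' v',
  [/\ H (u', v'), `|u' - u| < eps & `|v' - v| < eps]) -> H (u, v).
Proof.
move=> Huv; apply/closureP => eps eps0; have e2 : 0 < eps / 2 by rewrite divr_gt0.
have [u' [v' [/closureP/(_ _ e2)[u2 [v2 [H2 uu2 vv2]]] uu vv]]] := Huv _ e2.
exists u2, v2; split=> //; rewrite (splitr eps).
  by rewrite -(subrKA u') (le_lt_trans (ler_normD _ _))// ltrD.
by rewrite -(subrKA v') (le_lt_trans (ler_normD _ _))// ltrD.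
Qed.

Lemma oscillator_linear a u v u' v' : H (u, v) -> H (u', v') ->
  H (a *: u + u', a *: v + v').
Proof.
move=> /closureP Huv /closureP Huv'; apply/closureP => eps eps0.
have e2 : 0 < eps / 2 by rewrite divr_gt0.
have a1 : 0 < 1 + `|a| by rewrite ltr_wpDr.
have ea : 0 < eps / 2 / (1 + `|a|) by rewrite divr_gt0.
have [_ [_ [[f [g [tf gE [-> ->]]]] uf vg]]] := Huv _ ea.
have [_ [_ [[f' [g' [tf' gE' [-> ->]]]] uf' vg']]] := Huv' _ e2.
exists (a *: L2class f + L2class f'), (a *: L2class g + L2class g'); split.
- exists (a *: f + f'), (a *: g + g'); rewrite !L2classD -!L2scale_class; split=> //.
    exact: test_function_linear.
  rewrite -[LHS]/(a *: (g : X -> R[i]) + g') gE gE'; symmetry; exact: oscillator_expr_linear.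
- rewrite opprD addrACA -scalerBr (le_lt_trans (ler_normD _ _))// (splitr eps) ltr_leD ?(ltW uf')//.
  rewrite normrZ (le_lt_trans (y := (1 + `|a|) * `|L2class f - u|))// ?ler_wpM2r ?lerDr//.
  by rewrite mulrC -ltr_pdivlMr.
- rewrite opprD addrACA -scalerBr (le_lt_trans (ler_normD _ _))// (splitr eps) ltr_leD ?(ltW vg')//.
  rewrite normrZ (le_lt_trans (y := (1 + `|a|) * `|L2class g - v|))// ?ler_wpM2r ?lerDr//.
  by rewrite mulrC -ltr_pdivlMr.
Qed.

Lemma hermite_tensor_Lfun alpha : hermite_tensor l alpha \in Lfun mu 2%:E.
Proof.
apply: (gauss_dominated_Lfun l_meas frame (a := 4^-1)); first by rewrite invr_gt0.
  exact: hermite_tensor_measurable.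
exact: hermite_tensor_dominated.
Qed.

Definition hermite_vec alpha : L2 mu := L2class (L2_of_real (hermite_tensor_Lfun alpha)).

Local Notation eig alpha := (eigenvalue_of nu alpha).

Lemma hermite_vec_ip (f : L2fun mu) alpha : L2_ip (L2class f) (hermite_vec alpha) =
  \int[mu]_x (complex.Re (f x) * hermite_tensor l alpha x) +i*
  \int[mu]_x (complex.Im (f x) * hermite_tensor l alpha x).
Proof.
rewrite L2_ip_class /L2_dot /=.
have z (g : X -> R) : \int[mu]_x (g x * 0) = 0.
  by under eq_Rintegral do rewrite mulr0; rewrite Rintegral_cst ?mul0r.
by rewrite !z addr0 subr0.
Qed.

(** The Hermite functions are real, so orthogonality holds separately for the real and imaginary
    parts, and [hermite_total] applies to each. *)
Lemma hermite_vec_total u : (forall alpha, L2_ip u (hermite_vec alpha) = 0) -> u = 0.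
Proof.
rewrite -[u]L2reprK; set f := L2repr u => H0.
have Hr alpha : \int[mu]_x (complex.Re (f x) * hermite_tensor l alpha x) = 0.
  by have := H0 alpha; rewrite hermite_vec_ip => -[].
have Hi alpha : \int[mu]_x (complex.Im (f x) * hermite_tensor l alpha x) = 0.
  by have := H0 alpha; rewrite hermite_vec_ip => -[].
have r0 := hermite_total l_meas frame (Re_Lfun f) Hr.
have i0 := hermite_total l_meas frame (Im_Lfun f) Hi.
have -> : (0 : L2 mu) = L2class (f - f) by rewrite L2classB subrr.
apply/L2classP; move: r0 i0; apply: filterS2 => x r0 i0.
rewrite L2fun_subE subrr; apply/eqP; rewrite eq_complex; apply/andP.
by split; apply/eqP.
Qed.

Lemma hermite_vec_orth alpha beta i : alpha i != beta i ->
  L2_ip (hermite_vec alpha) (hermite_vec beta) = 0.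
Proof.
move=> ab; rewrite hermite_vec_ip /= (hermite_tensor_orth l_lin l_meas frame dual_id ab).
by under eq_Rintegral do rewrite mul0r; rewrite Rintegral_cst ?mul0r.
Qed.

Lemma hermite_vec_neq0 alpha : hermite_vec alpha != 0.
Proof.
apply/eqP => E; have := L2_ip_norm (hermite_vec alpha).
rewrite {3}E normr0 expr0n /= hermite_vec_ip /= => -[E0 _].
by have := hermite_tensor_norm_gt0 l_lin l_meas frame dual_id alpha; rewrite E0 ltxx.
Qed.

Lemma oscillator_symmetric u v alpha : H (u, v) ->
  L2_ip v (hermite_vec alpha) = (eig alpha)%:C * L2_ip u (hermite_vec alpha).
Proof.
set w := hermite_vec alpha; move=> /closureP Huv.
have sym u' v' : oscillator_min h A B (u', v') -> L2_ip v' w = (eig alpha)%:C * L2_ip u' w.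
  move=> [f [g [[rf jf cf] gE [-> ->]]]]; rewrite !hermite_vec_ip.
  have supp (q : R[i] -> R) : q 0 = 0 -> compact (closure [set x | q (f x) != 0]).
    move=> q0; apply: subclosed_compact cf _; first exact: closed_closure.
    by apply: closure_subset => x; apply: contra_neq => ->.
  have Sr := schrodinger_symmetric l_lin l_cont l_meas frame orth alpha
    (Lfun_measurable (Re_Lfun f)) rf (supp _ (erefl _)).
  have Si := schrodinger_symmetric l_lin l_cont l_meas frame orth alpha
    (Lfun_measurable (Im_Lfun f)) jf (supp _ (erefl _)).
  rewrite -[RHS]/(complex.Complex _ _) mul0r subr0 mul0r addr0 -Sr -Si; congr (_ +i* _).
    by apply: eq_Rintegral => x _; rewrite gE oscillator_Re.
  by apply: eq_Rintegral => x _; rewrite gE oscillator_Im.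
(* The identity passes to the closure by Cauchy-Schwarz. The two factors absorb the eigenvalue and
   the norm of [w], and the ones keep them positive. *)
have B0 : 0 < (1 + `|(eig alpha)%:C|) * (1 + `|w|) :> R[i].
  by rewrite mulr_gt0 // ltr_wpDr.
apply/eqP; rewrite -subr_eq0 -normr_le0; apply/ler_addgt0Pr => eps eps0; rewrite add0r.
have [u' [v' [Hm uu vv]]] := Huv _ (divr_gt0 eps0 B0).
have := sym _ _ Hm => /eqP; rewrite -subr_eq0 => /eqP z.
have lin a b : L2_ip (a - b) w = L2_ip a w - L2_ip b w.
  by have := L2_ip_linear (-1) b a w; rewrite scaleN1r mulN1r addrC => ->; rewrite addrC.
have aux (r s t s' t' : R[i]) : t' - r * s' = 0 -> t - r * s = r * (s' - s) - (t' - t).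
  by move/subr0_eq => ->; ring.
have -> : L2_ip v w - (eig alpha)%:C * L2_ip u w =
    (eig alpha)%:C * L2_ip (u' - u) w - L2_ip (v' - v) w.
  by rewrite !lin; exact: aux z.
have CS a : `|L2_ip a w| <= `|a| * `|w| :> R[i].
  exact: (cauchy_schwarz (@L2_ip_linear _ _ _ _) (@L2_ip_conj _ _ _ _) (@L2_ip_norm _ _ _ _)).
apply: le_trans (ler_normB _ _) _; rewrite normrM.
rewrite [leRHS](_ : _ = (1 + `|(eig alpha)%:C|) * (eps / ((1 + `|(eig alpha)%:C|) * (1 + `|w|)) * (1 + `|w|))); last first.
  by rewrite mulrCA divfK// gt_eqF.
have b a : `|a| < eps / ((1 + `|(eig alpha)%:C|) * (1 + `|w|)) -> `|L2_ip a w| <=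
    eps / ((1 + `|(eig alpha)%:C|) * (1 + `|w|)) * (1 + `|w|).
  move=> /ltW a_le; apply: le_trans (CS a) _; apply: ler_pM => //.
  by rewrite lerDr.
rewrite mulrDl mul1r addrC lerD ?b//.
by rewrite ler_wpM2l ?b.
Qed.

Lemma tensor_le phi (C : I -> R) x :
  (forall i t, `|phi i t| <= C i * expR (- (t ^+ 2 / 4))) ->
  `|tensor l phi x| <= tensor l (fun i t => C i * expR (- (t ^+ 2 / 4))) x.
Proof.
by move=> H0; rewrite /tensor normr_prod; apply: ler_prod => i _; rewrite normr_ge0 H0.
Qed.

(** Products of one-dimensional cutoffs are test functions. They and their images under the operator
    converge pointwise under a square integrable bound, hence in L^2. *)
Lemma oscillator_hermite alpha : H (hermite_vec alpha, (eig alpha)%:C *: hermite_vec alpha).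
Proof.
have [f0 /choice[f1 /choice[f2 /choice[C HC]]]] := choice (fun i => @hermite_cutoff R (alpha i)).
pose phi N i := f0 i N.
pose kap i N t := - f2 i N t + t ^+ 2 * f0 i N t.
pose F N := tensor l (phi N).
pose T i N := tensor l (subst (phi N) i (kap i N)).
pose G := tensor l (fun i t => C i * expR (- (t ^+ 2 / 4))).
have SF N x : S (F N) x = \sum_i nu i * T i N x.
  apply: (schrodinger_tensor (dphi := fun i => f1 i N) (ddphi := fun i => f2 i N) l_lin orth).
    by move=> i t; have [[_ H1 _] _ _ _] := HC i; exact: H1.
  by move=> i t; have [[_ _ H2] _ _ _] := HC i; exact: H2.
have FG N x : `|F N x| <= G x by apply: tensor_le => i t; have [_ [_ _ H3 _] _ _] := HC i; exact: H3.
have TG i N x : `|T i N x| <= G x.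
  apply: tensor_le => j t; rewrite /subst; case: eqP => [->|_].
    by have [_ [_ _ _ H4] _ _] := HC i; exact: H4.
  by have [_ [_ _ H3 _] _ _] := HC j; exact: H3.
have G0 x : 0 <= G x by apply: le_trans (FG 0%N x).
have LG : G \in Lfun mu 2%:E.
  apply: (gauss_dominated_Lfun l_meas frame (a := 4^-1)); first by rewrite invr_gt0.
    apply: measurable_tensor => // i; apply: measurable_funM => //.
    by apply: measurableT_comp => //; apply: measurableT_comp => //; exact: measurable_funM.
  apply: tensor_dominated => i; have [_ [C0 _ _ _] _ _] := HC i.
  by exists (C i) => // t; rewrite ger0_norm ?mulr_ge0 ?expR_ge0// [t ^+ 2 / 4]mulrC.
have sphi N i : smooth1 (phi N i) by have [[H0 _ _] _ _ _] := HC i; exact: H0.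
have mphi N i : measurable_fun setT (phi N i) by exact: smooth1_measurable.
(* The derivatives provided by [hermite_cutoff] agree with those of the class [smooth1] by
   uniqueness, which makes them measurable. *)
have mkap i N : measurable_fun setT (kap i N).
  have [[_ H1 H2] _ _ _] := HC i.
  have [g1 sg1 dg1] := smooth1_derive (sphi N i); have [g2 sg2 dg2] := smooth1_derive sg1.
  have E1 : f1 i N = g1.
    by apply/funext => t; have /@derive_val <- := H1 N t; have /@derive_val <- := dg1 t.
  have E2 : f2 i N = g2.
    apply/funext => t; have /@derive_val <- := H2 N t; rewrite E1.
    by have /@derive_val <- := dg2 t.
  apply: measurable_funD; last by apply: measurable_funM => //; exact: mphi.
  by apply: measurableT_comp => //; rewrite E2; exact: smooth1_measurable.
have mF N : measurable_fun setT (F N) by exact: measurable_tensor.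
have mT i N : measurable_fun setT (T i N).
  by apply: measurable_tensor => //; apply: subst_ind.
have LF N : F N \in Lfun mu 2%:E.
  by apply: Lfun2_dom LG _ => // x; rewrite (ger0_norm (G0 x)).
have mS N : measurable_fun setT (S (F N)).
  rewrite (_ : S (F N) = fun x => \sum_i nu i * T i N x); last exact/funext.
  by apply: measurable_sum => i; exact: measurable_funM.
pose M := \sum_i nu i.
have M0 : 0 <= M by apply: sumr_ge0 => i _; exact: ltW.
have SG N x : `|S (F N) x| <= M * G x.
  rewrite SF (le_trans (ler_norm_sum _ _ _))// mulr_suml; apply: ler_sum => i _.
  by rewrite normrM (gtr0_norm (nu_gt0 i)) ler_wpM2l// ltW.
have LMG := LfunZ M LG.
have LS N : S (F N) \in Lfun mu 2%:E.
  by apply: Lfun2_dom LMG _ => // x; rewrite [leRHS]ger0_norm// mulr_ge0.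
have cF x : F N x @[N --> \oo] --> hermite_tensor l alpha x.
  by apply: cvg_big => [|i _]; [exact: mul_continuous|have [_ _ H3 _] := HC i; exact: H3].
have cS x : S (F N) x @[N --> \oo] --> eig alpha * hermite_tensor l alpha x.
  under eq_fun do rewrite SF.
  rewrite /eigenvalue_of mulr_suml.
  apply: cvg_big => [|i _]; first exact: add_continuous.
  have -> : nu i * (2 * alpha i + 1)%:R * hermite_tensor l alpha x = nu i *
     tensor l (subst (fun j => hermite_fun (alpha j)) i
        (fun t => (2 * alpha i + 1)%:R * hermite_fun (alpha i) t)) x.
    by rewrite tensor_subst /hermite_tensor (tensorD1 _ _ i) -!mulrA.
  apply: cvgMr; apply: cvg_big => [|j _]; first exact: mul_continuous.
  rewrite /subst; case: eqP => [->|_]; first by have [_ _ _ H4] := HC i; exact: H4.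
  by have [_ _ H3 _] := HC j; exact: H3.
have Eh : (eig alpha)%:C *: hermite_vec alpha =
    L2class (L2_of_real (LfunZ (eig alpha) (hermite_tensor_Lfun alpha))).
  rewrite /hermite_vec [_ *: L2class _]L2scale_class; apply/L2classP; apply: nearW => x.
  by rewrite -[LHS]/((eig alpha)%:C * (hermite_tensor l alpha x)%:C) -rmorphM.
apply/closureP => eps eps0; rewrite Eh.
have [N1 H1] := L2_dominated_cvg LF (hermite_tensor_Lfun alpha) LG cF FG eps0.
have [N2 H2] := L2_dominated_cvg LS (LfunZ (eig alpha) (hermite_tensor_Lfun alpha)) LMG cS SG eps0.
pose N := maxn N1 N2.
exists (L2class (L2_of_real (LF N))), (L2class (L2_of_real (LS N))); split.
- exists (L2_of_real (LF N)), (L2_of_real (LS N)); split=> //.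
  + split.
    * exact: (smooth_expr_smooth l_lin l_cont (smooth_expr_tensor l (sphi N))).
    * exact: (smooth_cst 0).
    * rewrite (_ : [set x | _] = [set x | tensor l (phi N) x != 0]).
        have phi0 i t : N.+1%:R < `|t| -> phi N i t = 0.
          by have [_ [_ H3 _ _] _ _] := HC i; exact: H3.
        exact: (tensor_compact_support frame phi0).
      apply/seteqP; split=> x /=; apply: contra_neq.
        exact: (congr1 (fun r : R => r%:C)).
      by case.
  + apply/funext => x; apply/eqP; rewrite eq_complex oscillator_Re oscillator_Im eqxx /=.
    rewrite /schrodinger mulr0 big1 ?subr0// => k _.
    rewrite (_ : 'D_(e k) (cst 0) = cst 0) ?derive_cst ?mulr0//.
    by apply/funext => y; exact: derive_cst.
- by apply: H1; rewrite leq_maxl.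
- by apply: H2; rewrite leq_maxr.
Qed.

Lemma frame_oscillator_spectrum :
  spectrum H = discrete_spectrum H /\
  discrete_spectrum H = [set z : R[i] | exists alpha : I -> nat, z = (eig alpha)%:C].
Proof.
(* Multi-indices as finite functions form a countable type; integers that encode none of them
   receive the vector 0. *)
pose J := {ffun I -> nat}.
pose idx k : option J := pickle_inv k.
pose ev k : L2 mu := if idx k is Some a then hermite_vec a else 0.
pose lam k : R[i] := if idx k is Some a then (eig a)%:C else 0.
have H00 : H (0, 0).
  have h0 := oscillator_hermite (alpha := fun=> 0%N).
  by have := oscillator_linear (a := -1) h0 h0; rewrite !scaleN1r !addNr.
have idxP k a : idx k = Some a -> pickle a = k.
  by move=> E; have := @pickle_invK J k; rewrite -/(idx k) E.
have ip0r u : L2_ip u (0 : L2 mu) = 0.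
  by rewrite L2_ip_conj; have := L2_ip_linear (-1) u u u; rewrite scaleN1r addNr => ->;
     rewrite mulN1r addNr conjC0.
have ip0l u : L2_ip (0 : L2 mu) u = 0 by rewrite L2_ip_conj ip0r conjC0.
have ev_orth i j : i != j -> L2_ip (ev i) (ev j) = 0.
  move=> ij; rewrite /ev; case Ei : (idx i) => [a|]; last by rewrite ip0l.
  case Ej : (idx j) => [b|]; last by rewrite ip0r.
  have [/existsP[k abk]|/existsPn ab] := boolP [exists k, a k != b k].
    exact: hermite_vec_orth abk.
  case/negP: ij; rewrite -(idxP _ _ Ei) -(idxP _ _ Ej); apply/eqP; congr pickle.
  by apply/ffunP => k; apply/eqP; have := ab k; rewrite negbK.
have ev_total u : (forall k, L2_ip u (ev k) = 0) -> u = 0.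
  move=> u0; apply: hermite_vec_total => alpha.
  have := u0 (pickle [ffun i => alpha i]); rewrite /ev /idx pickleK_inv.
  by rewrite (_ : [ffun i => alpha i] = alpha :> (I -> nat)) //; apply/funext => i; rewrite ffunE.
have ev_eig k : H (ev k, lam k *: ev k).
  rewrite /ev /lam; case: (idx k) => [a|]; first exact: oscillator_hermite.
  by rewrite scaler0.
have ev_sym u v k : H (u, v) -> L2_ip v (ev k) = lam k * L2_ip u (ev k).
  move=> Huv; rewrite /ev /lam; case: (idx k) => [a|]; first exact: oscillator_symmetric.
  by rewrite !ip0r mulr0.
have lam_infty z : exists N, forall k, (N <= k)%N -> ev k != 0 -> 1 <= `|lam k - z|.
  (* An eigenvalue of at least M is at distance at least 1 from z. Its terms are positive, so one
     entry of the multi-index that is at least [b] is enough. *)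
  pose M := `|complex.Re z| + 1; have M0 : 0 < M by rewrite ltr_wpDl.
  pose b := (Num.truncn (\sum_i M / nu i)).+1.
  have bM i : M <= nu i * b%:R.
    rewrite -ler_pdivrMl// mulrC; apply: (@le_trans _ _ (\sum_i M / nu i)).
      by rewrite (bigD1 i)//= lerDl sumr_ge0// => j _; rewrite divr_ge0 ?ltW.
    by apply: ltW; apply: truncnS_gt.
  (* Only finitely many multi-indices have all entries below [b]; the bound exceeds all their
     codes. *)
  exists (\max_(a : {ffun I -> 'I_b}) pickle [ffun i => a i : nat]).+1 => k Nk.
  rewrite /ev /lam; case Ek : (idx k) => [a|]; last by rewrite eqxx.
  move=> _; have [i bi] : exists i, (b <= a i)%N.
    apply/existsP; apply: contraTT Nk => /existsPn ab.
    have ab' i : (a i < b)%N by rewrite ltnNge.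
    rewrite -leqNgt -(idxP _ _ Ek).
    apply: leq_trans (leq_bigmax [ffun i => Ordinal (ab' i)]).
    apply: eq_leq; congr pickle.
    by apply/ffunP => i; rewrite !ffunE.
  have lamM : M <= eig a.
    rewrite (le_trans (bM i))// /eigenvalue_of (bigD1 i)//= ler_wpDr//.
      by rewrite sumr_ge0// => j _; rewrite mulr_ge0 ?ltW.
    by rewrite ler_wpM2l ?(ltW (nu_gt0 i))// ler_nat (leq_trans bi)// mul2n -addnn -addnA leq_addr.
  apply: le_trans (normc_ge_Re _); rewrite lecR raddfB /=.
  apply: le_trans (ler_norm _); have := ler_norm (complex.Re z); rewrite /M in lamM *; lra.
have [-> ->] := @spectrum_diagonal R (L2 mu) (@L2_ip _ _ _ mu) (@L2_ip_linear _ _ _ mu)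
  (@L2_ip_conj _ _ _ mu) (@L2_ip_norm _ _ _ mu) (@L2_complete _ _ _ mu) ev lam
  ev_orth ev_total H oscillator_linear oscillator_closed ev_eig ev_sym lam_infty.
split=> //; apply/seteqP; split=> [z [k]|z [alpha ->]].
    by rewrite /ev /lam; case: (idx k) => [a _ ->|]; [by exists a|rewrite eqxx].
  exists (pickle [ffun i => alpha i]); rewrite /ev /lam /idx pickleK_inv.
    exact: hermite_vec_neq0.
  by congr (eigenvalue_of _ _)%:C; apply/funext => i; rewrite ffunE.
Qed.

End frame_oscillator.

(** * Dilated orthogonal coordinates and their dual basis *)

Section scaled_orthogonal_frame.
Context {R : realType} {n : nat}.
Variables (Q : 'M[R]_n) (a : 'I_n -> R).
Hypothesis QQT : Q *m Q^T = 1%:M.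
Hypothesis a_neq0 : forall i, a i != 0.

Definition scaled_coord i (x : 'cV[R]_n) : R := a i * (Q *m x) i 0.
Definition scaled_dual i : 'cV[R]_n := (a i)^-1 *: col i Q^T.

Let QTQ : Q^T *m Q = 1%:M. Proof. exact: mulmx1C. Qed.

Lemma scaled_coord_linear i b x y :
  scaled_coord i (b *: x + y) = b * scaled_coord i x + scaled_coord i y.
Proof. by rewrite /scaled_coord mulmxDr -scalemxAr !mxE mulrDr mulrCA. Qed.

Let scaled_coordE i x : scaled_coord i x = \sum_j a i * Q i j * x j 0.
Proof. by rewrite /scaled_coord mxE mulr_sumr; apply: eq_bigr => j _; rewrite mulrA. Qed.

Lemma scaled_coord_continuous i : continuous (scaled_coord i).
Proof.
rewrite (_ : scaled_coord i = fun x => \sum_j a i * Q i j * x j 0); last first.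
  by apply/funext => y; exact: scaled_coordE.
apply: continuous_big => [|j _ x]; first exact: add_continuous.
have cj : continuous (fun y : 'cV[R]_n => y j 0) := @coord_continuous R n 1 j 0.
by apply: cvgMr; [exact: (@nbhs_filter _ x)|exact: cj].
Qed.

Lemma scaled_coord_measurable i : measurable_fun setT (scaled_coord i).
Proof.
rewrite (_ : scaled_coord i = fun x => \sum_j a i * Q i j * x j 0); last first.
  by apply/funext => y; exact: scaled_coordE.
by apply: measurable_sum => j; apply: measurable_funM => //; exact: measurable_fun_entry.
Qed.

Lemma scaled_frame x : x = \sum_i scaled_coord i x *: scaled_dual i.
Proof.
apply/colP => k; rewrite -[in LHS](mul1mx x) -QTQ -mulmxA mxE summxE.
apply: eq_bigr => i _; rewrite /scaled_coord /scaled_dual; move: (Q *m x) => y.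
by rewrite !mxE mulrACA divff// mul1r mulrC.
Qed.

Lemma scaled_coord_dual i j : scaled_coord i (scaled_dual j) = (i == j)%:R.
Proof.
rewrite /scaled_coord /scaled_dual -scalemxAr colE mulmxA QQT mul1mx !mxE.
have [->|ij] := eqVneq i j; last by rewrite !mulr0.
by rewrite mulr1 divff.
Qed.

Lemma scaled_coord_orth i j :
  \sum_k scaled_coord i (delta_mx k 0) * scaled_coord j (delta_mx k 0) = a i ^+ 2 *+ (i == j).
Proof.
have E i' k : scaled_coord i' (delta_mx k 0) = a i' * Q i' k.
  by rewrite /scaled_coord -colE mxE.
under eq_bigr do rewrite !E mulrACA.
rewrite -mulr_sumr; have /matrixP/(_ i j) := QQT; rewrite !mxE.
under eq_bigr do rewrite mxE; move=> ->.
by have [->|] := eqVneq i j; rewrite ?mulr1// mulr0.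
Qed.

Lemma dotv_diagonalized (A : 'M[R]_n) (b : 'I_n -> R) x :
  Q *m A *m Q^T = diag_mx (\row_i b i) ->
  dotv (A *m x) x = \sum_i b i * (Q *m x) i 0 ^+ 2.
Proof.
move=> QA; have dot (u v : 'cV[R]_n) : dotv u v = (u^T *m v) 0 0.
  by rewrite /dotv mxE; apply: eq_bigr => i _; rewrite mxE.
have dotQ u v : dotv (Q *m u) (Q *m v) = dotv u v.
  by rewrite !dot trmx_mul -mulmxA (mulmxA Q^T) QTQ mul1mx.
rewrite -dotQ.
have -> : Q *m (A *m x) = diag_mx (\row_i b i) *m (Q *m x).
  by rewrite -QA -!mulmxA (mulmxA Q^T) QTQ mul1mx.
by apply: eq_bigr => i _; rewrite mul_diag_mx !mxE expr2 mulrA.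
Qed.

End scaled_orthogonal_frame.

Theorem mainTheorem7 (R : realType) (n p : nat) (n_ge1 : (1 <= n)%N)
    (p_ge1 : (1 <= p)%N) (A : 'M[R]_n) (B : 'M[R]_p)
    (w : 'I_n -> R) (m : 'I_p -> R)
    (A_posdef : posdef A) (B_posdef : posdef B)
    (w_gt0 : forall i, 0 < w i) (m_gt0 : forall j, 0 < m j)
    (A_eigen : char_poly A = \prod_(i < n) ('X - (w i ^+ 2)%:P))
    (B_eigen : char_poly B = \prod_(j < p) ('X - (m j ^+ 2)%:P))
    (h0 h : R) (h0_gt0 : 0 < h0) (h_gt0 : 0 < h) (h_le : h <= h0) :
  spectrum (oscillator h A B) = discrete_spectrum (oscillator h A B) /\
  discrete_spectrum (oscillator h A B) =
    [set z : R[i] | exists (k : 'I_n -> nat) (l : 'I_p -> nat),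
       z = (\sum_(i < n) (2 * k i + 1)%:R * h * w i
            + \sum_(j < p) (2 * l j + 1)%:R * m j)%:C].
Proof.
have [Q QQT QA] := symmetric_diagonalization A_posdef.1 A_eigen.
have [P PPT PB] := symmetric_diagonalization B_posdef.1 B_eigen.
(* With a_i^2 = w_i / h, both h^2 a_i^2 and w_i^2 / a_i^2 equal h w_i: kinetic and potential terms
   get the same weight. In y the same holds with h = 1. *)
pose a i := Num.sqrt (w i / h); pose b j := Num.sqrt (m j).
have a0 i : a i != 0 by rewrite gt_eqF// sqrtr_gt0 divr_gt0.
have b0 j : b j != 0 by rewrite gt_eqF// sqrtr_gt0.
have a2 i : a i ^+ 2 = w i / h by rewrite sqr_sqrtr// divr_ge0 ?ltW.
have b2 j : b j ^+ 2 = m j by rewrite sqr_sqrtr// ltW.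
pose I := ('I_n + 'I_p)%type; pose X := ('cV[R]_n * 'cV[R]_p)%type.
pose l (i : I) (x : X) :=
  match i with inl i => scaled_coord Q a i x.1 | inr j => scaled_coord P b j x.2 end.
pose dual (i : I) : X :=
  match i with inl i => (scaled_dual Q a i, 0) | inr j => (0, scaled_dual P b j) end.
pose nu (i : I) := match i with inl i => h * w i | inr j => m j end.
pose c (k : I) : R := match k with inl _ => h ^+ 2 | inr _ => 1 end.
pose e (k : I) : X := match k with inl i => @basis_x R n p i | inr j => @basis_y R n p j end.
have l_lin i r x y : l i (r *: x + y) = r * l i x + l i y.
  by case: i => i; exact: scaled_coord_linear.
have l_cont i : continuous (l i).
  case: i => i [x y].
    apply: (@continuous_comp _ _ _ fst (scaled_coord Q a i)); first exact: cvg_fst.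
    exact: scaled_coord_continuous.
  apply: (@continuous_comp _ _ _ snd (scaled_coord P b i)); first exact: cvg_snd.
  exact: scaled_coord_continuous.
have l_meas i : measurable_fun setT (l i).
  by case: i => i; apply: measurableT_comp => //; exact: scaled_coord_measurable.
have frame x : x = \sum_i l i x *: dual i.
  rewrite big_sumType /= [LHS]surjective_pairing; congr pair.
    rewrite {1}(scaled_frame QQT a0 x.1) !raddf_sum /= [X in _ + X]big1 ?addr0// => j _.
    by rewrite scaler0.
  rewrite {1}(scaled_frame PPT b0 x.2) !raddf_sum /= [X in X + _]big1 ?add0r// => j _.
  by rewrite scaler0.
have dual_id i j : l i (dual j) = (i == j)%:R.
  case: i j => i [] j /=; try exact: scaled_coord_dual.
    by rewrite /scaled_coord mulmx0 mxE mulr0.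
  by rewrite /scaled_coord mulmx0 mxE mulr0.
have nu_gt0 i : 0 < nu i by case: i => i /=; rewrite ?mulr_gt0.
have sc0 k (Q' : 'M[R]_k) d i : scaled_coord Q' d i 0 = 0.
  by rewrite /scaled_coord mulmx0 mxE mulr0.
have orth i j : \sum_k c k * (l i (e k) * l j (e k)) = nu i *+ (i == j).
  rewrite big_sumType /= /e /c; case: i j => i [] j /=.
  - under eq_bigr do rewrite /=.
    rewrite -mulr_sumr scaled_coord_orth// [X in _ + X]big1 => [|k _]; last by rewrite sc0 mul0r mulr0.
    by rewrite addr0 a2 mulrnAr; congr (_ *+ _); field; rewrite gt_eqF.
  - by rewrite !big1 ?addr0// => k _; rewrite /= sc0 ?mul0r ?mulr0.
  - by rewrite !big1 ?addr0// => k _; rewrite /= sc0 ?mul0r ?mulr0.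
  - rewrite [X in X + _]big1 => [|k _]; last by rewrite sc0 mul0r mulr0.
    by rewrite add0r -mulr_sumr scaled_coord_orth// b2 mul1r.
have potE x : dotv (A *m x.1) x.1 + dotv (B *m x.2) x.2 = potential l nu x.
  rewrite /potential big_sumType /= (dotv_diagonalized QQT _ QA) (dotv_diagonalized PPT _ PB).
  congr (_ + _); apply: eq_bigr => i _; rewrite /scaled_coord exprMn ?a2 ?b2 expr2 !mulrA//.
  by rewrite mulrAC; congr (_ * _); field; rewrite gt_eqF.
have ring3 (r D1 D2 s t z : R) : - r * D1 - D2 + s * z + t * z = (s + t) * z - (r * D1 + D2).
  by ring.
(* Stated for arbitrary complex numbers, so that the computation does not unfold the derivatives to
   which it is applied. *)
have ReE (z1 z2 z3 : R[i]) (r s t : R) : complex.Re (- r%:C * z1 - z2 + s%:C * z3 + t%:C * z3) =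
    (s + t) * complex.Re z3 - (r * complex.Re z1 + complex.Re z2).
  by rewrite -ring3; case: z1 z2 z3 => [? ?] [? ?] [? ?] /=; rewrite oppr0 !mul0r !subr0.
have ImE (z1 z2 z3 : R[i]) (r s t : R) : complex.Im (- r%:C * z1 - z2 + s%:C * z3 + t%:C * z3) =
    (s + t) * complex.Im z3 - (r * complex.Im z1 + complex.Im z2).
  by rewrite -ring3; case: z1 z2 z3 => [? ?] [? ?] [? ?] /=; rewrite oppr0 !mul0r !addr0.
have lapE (F : 'I_n -> R) (G : 'I_p -> R) :
    h ^+ 2 * (\sum_i F i) + \sum_j G j = \sum_k c k * match k with inl i => F i | inr j => G j end.
  by rewrite big_sumType /= mulr_sumr; congr (_ + _); apply: eq_bigr => j _; rewrite mul1r.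
have osc_Re f x : complex.Re (oscillator_expr h A B f x) =
    schrodinger l c e nu (fun y => complex.Re (f y)) x.
  rewrite /schrodinger -potE; apply: etrans (ReE _ _ _ _ _ _) _; congr (_ - _).
  rewrite /laplacian !raddf_sum; apply: etrans (lapE _ _) _.
  by apply: eq_bigr => -[].
have osc_Im f x : complex.Im (oscillator_expr h A B f x) =
    schrodinger l c e nu (fun y => complex.Im (f y)) x.
  rewrite /schrodinger -potE; apply: etrans (ImE _ _ _ _ _ _) _; congr (_ - _).
  rewrite /laplacian !raddf_sum; apply: etrans (lapE _ _) _.
  by apply: eq_bigr => -[].
have [-> ->] := frame_oscillator_spectrum l_lin l_cont l_meas frame dual_id nu_gt0 orth osc_Re osc_Im.
split=> //; apply/seteqP; split=> [z [alpha ->]|z [k [k' ->]]].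
  exists (fun i => alpha (inl i)), (fun j => alpha (inr j)); congr (_%:C).
  rewrite /eigenvalue_of big_sumType /=; congr (_ + _); apply: eq_bigr => i _; ring.
exists (fun i => match i with inl i => k i | inr j => k' j end); congr (_%:C).
rewrite /eigenvalue_of big_sumType /=; congr (_ + _); apply: eq_bigr => i _; ring.
Qed.
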